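(* Let $L\in\mathcal{L}$ be such that $L$ and $L^*$ have order continuous norms. Let $\Psi_1,\dots,\Psi_m$ be bounded sets of nonnegative matrices that define operators on $L$, and put $\Phi_j=\Psi_j\cdots\Psi_m\Psi_1\cdots\Psi_{j-1}$ for $j=1,\dots,m$ (so $\Phi_1=\Psi_1\cdots\Psi_m$). Let $\alpha\ge\frac1m$, $n\in\mathbb{N}$, $r\in\{\rho_{ess},\hat\rho_{ess}\}$, and put $\Sigma_j=\Psi_j^{(\alpha m)}\cdots\Psi_m^{(\alpha m)}\Psi_1^{(\alpha m)}\cdots\Psi_{j-1}^{(\alpha m)}$ for $j=1,\dots,m$. Then $$r(\Psi_1^{(\alpha)}\circ\cdots\circ\Psi_m^{(\alpha)})\le r(\Phi_1^{(\alpha)}\circ\cdots\circ\Phi_m^{(\alpha)})^{1/m}\le r((\Phi_1^n)^{(\alpha)}\circ\cdots\circ(\Phi_m^n)^{(\alpha)})^{1/(mn)}\le r(\Psi_1\cdots\Psi_m)^\alpha,$$ $$r(\Psi_1^{(\alpha)}\circ\cdots\circ\Psi_m^{(\alpha)})\le r(\Psi_1^{(\alpha m)}\cdots\Psi_m^{(\alpha m)})^{1/m}\le r((\Psi_1\cdots\Psi_m)^{(\alpha m)})^{1/m}\le r(((\Psi_1\cdots\Psi_m)^n)^{(\alpha m)})^{1/(nm)}\le r(\Psi_1\cdots\Psi_m)^\alpha.$$ If in addition $\alpha\ge1$, then $$r(\Psi_1^{(\alpha)}\circ\cdots\circ\Psi_m^{(\alpha)})\le r(\Phi_1^{(\alpha)}\circ\cdots\circ\Phi_m^{(\alpha)})^{1/m}\le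 r((\Phi_1^n)^{(\alpha)}\circ\cdots\circ(\Phi_m^n)^{(\alpha)})^{1/(mn)}\le\left(r((\Phi_1^n)^{(m)})\cdots r((\Phi_m^n)^{(m)})\right)^{\alpha/(m^2n)}\le r(\Psi_1\cdots\Psi_m)^\alpha,$$ and $$r(\Psi_1^{(\alpha)}\circ\cdots\circ\Psi_m^{(\alpha)})\le r(\Sigma_1^{(1/m)}\circ\cdots\circ\Sigma_m^{(1/m)})^{1/m}\le r((\Sigma_1^n)^{(1/m)}\circ\cdots\circ(\Sigma_m^n)^{(1/m)})^{1/(mn)}\le r(\Psi_1^{(\alpha m)}\cdots\Psi_m^{(\alpha m)})^{1/m}$$ $$\le r((\Psi_1\cdots\Psi_m)^{(\alpha m)})^{1/m}\le r(((\Psi_1\cdots\Psi_m)^n)^{(\alpha m)})^{1/(nm)}\le r(\Psi_1\cdots\Psi_m)^\alpha.$$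
   Context: Let $R=\mathbb{N}$ or $R=\{1,\dots,N\}$. A Banach sequence space is a Banach space $L$ of complex sequences indexed by $R$ such that if $x$ is a complex sequence, $y\in L$ and $|x|\le|y|$ entrywise, then $x\in L$ and $\|x\|_L\le\|y\|_L$. $\mathcal{L}$ is the class of Banach sequence spaces containing every standard unit vector $e_n$ with $\|e_n\|_L=1$. A Banach lattice has order continuous norm if every decreasing net $0\le f_\alpha\downarrow0$ satisfies $\|f_\alpha\|\to0$; $L^*$ is the Banach dual. A nonnegative matrix $A=[a_{ij}]$ defines an operator on $L$ if $(Ax)_i=\sum_j a_{ij}x_j$ converges absolutely and $Ax\in L$ for all $x\in L$. Hadamard power $A^{(t)}=[a_{ij}^t]$, Hadamard product $A\circ B=[a_{ij}b_{ij}]$. For sets: $\Psi\Sigma=\{AB\}$, $\Psi^n=\{A_1\cdots A_n:A_i\in\Psi\}$, $\Psi^{(t)}=\{A^{(t)}:A\in\Psi\}$, $\Psi_1^{(\alpha_1)}\circ\cdots\circ\Psi_m^{(\alpha_m)}=\{A_1^{(\alpha_1)}\circ\cdots\circ A_m^{(\alpha_m)}:A_j\in\Psi_j\}$; in products, $\Psi_{j-1}$ with $j=1$ means the factor is absent. $\gamma$ is the Hausdorff measure of noncompactness, $\rho_{ess}$ the essential spectral radius; for a bounded set $\Sigma$, $\rho_{ess}(\Sigma)=\sup_m[\sup_{A\in\Sigma^m}\rho_{ess}(A)]^{1/m}$ and $\hat\rho_{ess}(\Sigma)=\lim_{m\to\infty}[\sup_{A\in\Sigma^m}\gamma(A)]^{1/m}$.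 *)

(* Defs.v *)
From mathcomp Require Import all_boot all_order all_algebra.
From mathcomp Require Import all_classical all_reals all_analysis.
From mathcomp Require Import complex.
Import Order.TTheory GRing.Theory Num.Theory.
Import numFieldNormedType.Exports.

Set Implicit Arguments.
Unset Strict Implicit.
Unset Printing Implicit Defensive.

Local Open Scope ring_scope.
Local Open Scope classical_set_scope.

Section Defs.
Variable R : realType.
Local Notation C := R[i].

(* complex sequences (indexed by nat; the index set R is a subset of nat) *)
Definition cseq := nat -> C.
(* matrices with real (nonnegative, in our use) entries *)
Definition mat := nat -> nat -> R.

Definition cabs (z : C) : R := Normc.normc z.

(* index set: R = N when Nopt = None, R = {0,...,N-1} when Nopt = Some N *)
Definition inR (Nopt : option nat) (i : nat) : bool :=
  if Nopt is Some N then (i < N)%N else true.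

Definition unit_vec (k : nat) : cseq := fun i => if i == k then 1 else 0.

(* entrywise order on complex sequences (0 <= z in C means z real, >= 0) *)
Definition cle (x y : cseq) : Prop := forall i, x i <= y i.

Definition seq_zero : cseq := fun _ => 0.

Definition banach_seq_space (Nopt : option nat) (L : set cseq) (nrm : cseq -> R)
  : Prop :=
  (forall x, L x -> forall i, ~~ inR Nopt i -> x i = 0) /\
  L seq_zero /\
  (forall x y, L x -> L y -> L (fun i => x i + y i)) /\
  (forall (c : C) x, L x -> L (fun i => c * x i)) /\
  (forall x, L x -> 0 <= nrm x) /\
  (forall x, L x -> nrm x = 0 -> forall i, x i = 0) /\
  (forall (c : C) x, L x -> nrm (fun i => c * x i) = cabs c * nrm x) /\
  (forall x y, L x -> L y -> nrm (fun i => x i + y i) <= nrm x + nrm y) /\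
  (forall u : nat -> cseq, (forall k, L (u k)) ->
     (forall e : R, 0 < e -> exists N, forall p q, (N <= p)%N -> (N <= q)%N ->
        nrm (fun i => u p i - u q i) < e) ->
     exists x, L x /\ forall e : R, 0 < e -> exists N, forall p, (N <= p)%N ->
        nrm (fun i => u p i - x i) < e) /\
  (forall x y, (forall i, ~~ inR Nopt i -> x i = 0) -> L y ->
     (forall i, cabs (x i) <= cabs (y i)) -> L x /\ nrm x <= nrm y).

Definition in_class_L (Nopt : option nat) (L : set cseq) (nrm : cseq -> R) : Prop :=
  banach_seq_space Nopt L nrm /\
  forall k, inR Nopt k -> L (unit_vec k) /\ nrm (unit_vec k) = 1.

Definition directed (D : Type) (le : D -> D -> Prop) : Prop :=
  (exists d : D, True) /\ (forall a, le a a) /\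
  (forall a b c, le a b -> le b c -> le a c) /\
  (forall a b, exists c, le a c /\ le b c).

Definition order_continuous (L : set cseq) (nrm : cseq -> R) : Prop :=
  forall (D : Type) (le : D -> D -> Prop) (f : D -> cseq),
    directed le -> (forall a, L (f a)) -> (forall a, cle seq_zero (f a)) ->
    (forall a b, le a b -> cle (f b) (f a)) ->
    (forall g, L g -> (forall a, cle g (f a)) -> cle g seq_zero) ->
    forall e : R, 0 < e -> exists a0, forall a, le a0 a -> nrm (f a) < e.

Definition in_dual (L : set cseq) (nrm : cseq -> R) (phi : cseq -> C) : Prop :=
  (forall x y, L x -> L y -> phi (fun i => x i + y i) = phi x + phi y) /\
  (forall (c : C) x, L x -> phi (fun i => c * x i) = c * phi x) /\
  exists M : R, forall x, L x -> cabs (phi x) <= M * nrm x.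

Definition dual_norm (L : set cseq) (nrm : cseq -> R) (phi : cseq -> C) : R :=
  sup [set cabs (phi x) | x in [set x | L x /\ nrm x <= 1]].

Definition dual_ord_le (L : set cseq) (phi psi : cseq -> C) : Prop :=
  forall x, L x -> cle seq_zero x -> 0 <= psi x - phi x.

Definition dual_order_continuous (L : set cseq) (nrm : cseq -> R) : Prop :=
  forall (D : Type) (le : D -> D -> Prop) (f : D -> cseq -> C),
    directed le -> (forall a, in_dual L nrm (f a)) ->
    (forall a, dual_ord_le L (fun _ => 0) (f a)) ->
    (forall a b, le a b -> dual_ord_le L (f b) (f a)) ->
    (forall psi, in_dual L nrm psi -> (forall a, dual_ord_le L psi (f a)) ->
       dual_ord_le L psi (fun _ => 0)) ->
    forall e : R, 0 < e -> exists a0, forall a, le a0 a -> dual_norm L nrm (f a) < e.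

Definition nonneg_mat (Nopt : option nat) (A : mat) : Prop :=
  forall i j, 0 <= A i j /\ (~~ inR Nopt i || ~~ inR Nopt j -> A i j = 0).

Definition matapply (A : mat) (x : cseq) : cseq := fun i =>
  Complex (limn (series (fun j => A i j * complex.Re (x j))))
          (limn (series (fun j => A i j * complex.Im (x j)))).

Definition defines_op (L : set cseq) (A : mat) : Prop :=
  forall x, L x ->
    (forall i, cvgn (series (fun j => A i j * cabs (x j)))) /\ L (matapply A x).

Definition bounded_matset (L : set cseq) (nrm : cseq -> R) (S : set mat) : Prop :=
  exists M : R, forall A, S A -> forall x, L x -> nrm (matapply A x) <= M * nrm x.

Definition matmul (A B : mat) : mat := fun i j => limn (series (fun k => A i k * B k j)).
Definition hpow (A : mat) (t : R) : mat := fun i j => powR (A i j) t.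
Definition hmul (A B : mat) : mat := fun i j => A i j * B i j.

Definition setmul (S T : set mat) : set mat :=
  fun M => exists A B, S A /\ T B /\ M = matmul A B.
Fixpoint setprodn (F : nat -> set mat) (k : nat) : set mat :=
  match k with
  | 0 => F 0%N
  | k'.+1 => setmul (setprodn F k') (F k)
  end.
(* S^n, n >= 1 *)
Definition setpown (S : set mat) (n : nat) : set mat := setprodn (fun _ => S) n.-1.
Definition setpow (S : set mat) (t : R) : set mat :=
  fun M => exists A, S A /\ M = hpow A t.
Fixpoint hprodn (F : nat -> set mat) (k : nat) : set mat :=
  match k with
  | 0 => F 0%N
  | k'.+1 => fun M => exists A B, hprodn F k' A /\ F k B /\ M = hmul A B
  end.

Definition hausdorff_mnc (L : set cseq) (nrm : cseq -> R) (S : set cseq) : R :=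
  inf [set e : R | 0 < e /\ exists cs : seq cseq,
         (forall k, (k < size cs)%N -> L (nth seq_zero cs k)) /\
         forall x, S x -> exists k, (k < size cs)%N /\
           nrm (fun i => x i - nth seq_zero cs k i) <= e].

Definition gamma_op (L : set cseq) (nrm : cseq -> R) (A : mat) : R :=
  hausdorff_mnc L nrm [set matapply A x | x in [set x | L x /\ nrm x <= 1]].

(* Fredholm operators on L (kernel finite dimensional, range of finite
   codimension; closedness of the range is then automatic) *)
Definition in_span (s : seq cseq) (y : cseq) : Prop :=
  exists c : nat -> C, forall i,
    y i = \sum_(k < size s) c k * nth seq_zero s k i.

Definition fredholm (L : set cseq) (T : cseq -> cseq) : Prop :=
  (exists s : seq cseq, (forall k, (k < size s)%N -> L (nth seq_zero s k)) /\
     forall x, L x -> (forall i, T x i = 0) -> in_span s x) /\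
  (exists s : seq cseq, (forall k, (k < size s)%N -> L (nth seq_zero s k)) /\
     forall y, L y -> exists x z, L x /\ in_span s z /\
       forall i, y i = T x i + z i).

Definition rho_ess (L : set cseq) (A : mat) : R :=
  sup [set cabs lam | lam in
        [set lam : C | ~ fredholm L (fun x i => lam * x i - matapply A x i)]].

Definition rho_ess_set (L : set cseq) (S : set mat) : R :=
  sup [set powR (sup [set rho_ess L A | A in setpown S k]) (k%:R^-1)
        | k in [set k : nat | (0 < k)%N]].

Definition rho_hat_ess_set (L : set cseq) (nrm : cseq -> R) (S : set mat) : R :=
  limn (fun k : nat => powR (sup [set gamma_op L nrm A | A in setpown S k.+1])
                            (k.+1%:R^-1)).

Definition jr (b : bool) (L : set cseq) (nrm : cseq -> R) (S : set mat) : R :=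
  if b then rho_ess_set L S else rho_hat_ess_set L nrm S.

(* Psi_j ... Psi_m Psi_1 ... Psi_{j-1}, with Psi indexed 0..m-1 *)
Definition cyc_prod (Psi : nat -> set mat) (m j : nat) : set mat :=
  setprodn (fun k => Psi ((j + k) %% m)%N) m.-1.

Definition cyc_prod_pow (Psi : nat -> set mat) (m j : nat) (t : R) : set mat :=
  setprodn (fun k => setpow (Psi ((j + k) %% m)%N) t) m.-1.

Definition hprod_pow (F : nat -> set mat) (m : nat) (t : R) : set mat :=
  hprodn (fun k => setpow (F k) t) m.-1.

End Defs.

(* Main.v *)
(** Order continuity makes the tails of every vector of L small, so the Hausdorff measure of
    noncompactness of a nonnegative operator A is the limit gam A of the norms of its row tails;
    in this form it is visibly monotone and submultiplicative. Hadamard means inherit norm bounds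
    through the entrywise AM-GM inequality. If their exponents add up to more than 1, one also uses
    that the entries of a matrix are at most its norm. By Hoelder's inequality a product of Hadamard
    means is dominated entrywise by the Hadamard mean of the products, so gam, and with it the joint
    growth rate of gam on products of matrices from bounded sets, is submultiplicative for Hadamard
    means.

    Nussbaum's formula rho_ess A = lim gam (A^k)^(1/k) reduces both radii to such growth rates.
    A Neumann series gives one inequality. For the other one, positivity is used: if s - A were
    Fredholm at s = lim gam (A^k)^(1/k), the open mapping theorem would bound the truncated
    resolvents of A near s modulo compact operators, against gam (A^k) >= s^k.

    All the inequalities then follow from r(S T) = r(T S), r(S^n) = r(S)^n, monotonicity of r under
    entrywise domination and submultiplicativity of r for Hadamard means. *)

Require Import Defs.
From mathcomp Require Import all_boot all_order all_algebra.
From mathcomp Require Import all_classical all_reals all_analysis.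
From mathcomp Require Import complex.
From mathcomp Require Import ring lra.
Import Order.TTheory GRing.Theory Num.Theory.
Import numFieldNormedType.Exports.
Set Implicit Arguments.
Unset Strict Implicit.
Unset Printing Implicit Defensive.
Local Open Scope ring_scope.
Local Open Scope classical_set_scope.
Local Open Scope complex_scope.

(** The delicate point is that s = [rh X [set A]] lies in the essential spectrum. For nonnegative
    matrices [gam] of a sum dominates [gam] of each summand, but not the sum of these values. The
    resulting lower bounds for the terms lam^(-k-1) A^k of the resolvent never exceed 1/s as lam
    decreases to s, so the resolvent alone gives no contradiction. The square of the resolvent does,
    through its coefficients k+1. The sums are truncated so that no series of operators has to
    converge; the error is a multiple of A^(K+1), which a large K makes small.

    In the chains of inequalities, the Hadamard product is commutative, so in the k-th factor of the
    m-th power of Psi_1^(alpha) o ... o Psi_m^(alpha) the slots may be rotated by k. Hoelder's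
    inequality then collects exactly Phi_j in slot j. The chain with the Sigma_j is the chain with
    the Phi_j, written for the sets Psi_j^(alpha m) and the exponent 1/m. A Hadamard power with
    exponent at least 1 is a Hadamard mean with one factor. *)

Section NonnegSeries.
Variable R : realType.
Implicit Types (f g : nat -> R) (c : R).

(** * Series with nonnegative terms *)

Lemma series_nondecreasing f : (forall i, 0 <= f i) ->
  nondecreasing_seq (series f).
Proof.
move=> f0; apply/nondecreasing_seqP => n; rewrite /series /= big_nat_recr //=.
by rewrite lerDl.
Qed.

Lemma series_bounded_cvg f c : (forall i, 0 <= f i) ->
  (forall n, series f n <= c) -> cvgn (series f).
Proof.
move=> f0 fc; apply: nondecreasing_is_cvgn; first exact: series_nondecreasing.
by exists c => _ [n _ <-].
Qed.

Lemma limn_series_le f c : (forall i, 0 <= f i) ->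
  (forall n, series f n <= c) -> limn (series f) <= c.
Proof.
move=> f0 fc; apply: limr_le; first exact: series_bounded_cvg fc.
by near=> n.
Unshelve. all: by end_near. Qed.

Lemma series_le_limn f c n : (forall i, 0 <= f i) ->
  (forall p, series f p <= c) -> series f n <= limn (series f).
Proof.
move=> f0 fc; apply: nondecreasing_cvgn_le; first exact: series_nondecreasing.
exact: series_bounded_cvg fc.
Qed.

End NonnegSeries.

Record lspace (R : realType) := LSpace {
  idx : option nat;
  carrier : set (cseq R);
  lnorm : cseq R -> R;
  lspaceP : in_class_L idx carrier lnorm;
  lspace_oc : order_continuous carrier lnorm }.

(** * Modulus of complex numbers *)

Section Complex.
Variable R : realType.
Local Notation C := R[i].
Implicit Types (z w : C).

Lemma cabs0 : cabs (0 : C) = 0. Proof. exact: Normc.normc0. Qed.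
Lemma cabs1 : cabs (1 : C) = 1. Proof. exact: Normc.normc1. Qed.
Lemma cabsM z w : cabs (z * w) = cabs z * cabs w.
Proof. exact: Normc.normcM. Qed.
Lemma cabsD z w : cabs (z + w) <= cabs z + cabs w.
Proof. exact: le_normcD. Qed.
Lemma cabsN z : cabs (- z) = cabs z.
Proof. exact: normcN. Qed.
Lemma cabs_ge0 z : 0 <= cabs z.
Proof. by case: z => a b; rewrite /cabs /= sqrtr_ge0. Qed.
Lemma cabsR (x : R) : cabs x%:C = `|x|.
Proof. by rewrite /cabs /= expr0n addr0 sqrtr_sqr. Qed.
Lemma cabs_ge0R (x : R) : 0 <= x -> cabs x%:C = x.
Proof. by move=> x0; rewrite cabsR ger0_norm. Qed.
Lemma cabs_Re z : `|complex.Re z| <= cabs z.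
Proof.
case: z => a b; rewrite /cabs /= -sqrtr_sqr ler_sqrt ?addr_ge0 ?sqr_ge0 //.
by rewrite lerDl sqr_ge0.
Qed.
Lemma cabs_Im z : `|complex.Im z| <= cabs z.
Proof.
case: z => a b; rewrite /cabs /= -sqrtr_sqr ler_sqrt ?addr_ge0 ?sqr_ge0 //.
by rewrite lerDr sqr_ge0.
Qed.
Lemma cabs_ReIm z : cabs z <= `|complex.Re z| + `|complex.Im z|.
Proof.
rewrite {1}[z]complexE; apply: (le_trans (cabsD _ _)).
rewrite cabsM !cabsR {1}/cabs /= expr0n expr1n add0r sqrtr1 mul1r.
by [].
Qed.
Lemma cabs_le z (c : R) : 0 <= c ->
  (complex.Re z) ^+ 2 + (complex.Im z) ^+ 2 <= c ^+ 2 -> cabs z <= c.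
Proof.
case: z => a b /= c0 h; rewrite /cabs /= -(ger0_norm c0) -sqrtr_sqr.
by rewrite ler_sqrt // sqr_ge0.
Qed.
Lemma cabs_sqr z : cabs z ^+ 2 = (complex.Re z) ^+ 2 + (complex.Im z) ^+ 2.
Proof. by case: z => a b; rewrite /cabs /= sqr_sqrtr // addr_ge0 ?sqr_ge0. Qed.

Lemma cabs_sum (I : Type) (r : seq I) (P : pred I) (F : I -> C) :
  cabs (\sum_(i <- r | P i) F i) <= \sum_(i <- r | P i) cabs (F i).
Proof.
elim/big_rec2: _ => [|i y x _ h]; first by rewrite cabs0.
by apply: (le_trans (cabsD _ _)); rewrite lerD2l.
Qed.

End Complex.

(** * Norm, solidity and tails in a Banach sequence space *)

Section SpaceBasics.
Variables (R : realType) (X : lspace R).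
Local Notation C := R[i].
Local Notation L := (carrier X).
Local Notation nrm := (lnorm X).
Implicit Types (x y : cseq R) (c : C).

Lemma L_supp x i : L x -> ~~ inR (idx X) i -> x i = 0.
Proof. by case: (lspaceP X) => -[h _] _ /h; exact. Qed.
Lemma L_zero : L (@seq_zero R).
Proof. by case: (lspaceP X) => -[_ []]. Qed.
Lemma L_add x y : L x -> L y -> L (fun i => x i + y i).
Proof. by case: (lspaceP X) => -[_ [_ [h _]]] _; exact: h. Qed.
Lemma L_scale c x : L x -> L (fun i => c * x i).
Proof. by case: (lspaceP X) => -[_ [_ [_ [h _]]]] _; exact: h. Qed.
Lemma nrm_ge0 x : L x -> 0 <= nrm x.
Proof. by case: (lspaceP X) => -[_ [_ [_ [_ [h _]]]]] _; exact: h. Qed.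
Lemma nrm_eq0 x : L x -> nrm x = 0 -> x = @seq_zero R.
Proof.
by case: (lspaceP X) => -[_ [_ [_ [_ [_ [h _]]]]]] _ Lx x0; apply/funext; exact: h.
Qed.
Lemma nrm_scale c x : L x -> nrm (fun i => c * x i) = cabs c * nrm x.
Proof. by case: (lspaceP X) => -[_ [_ [_ [_ [_ [_ [h _]]]]]]] _; exact: h. Qed.
Lemma nrm_add x y : L x -> L y -> nrm (fun i => x i + y i) <= nrm x + nrm y.
Proof. by case: (lspaceP X) => -[_ [_ [_ [_ [_ [_ [_ [h _]]]]]]]] _; exact: h. Qed.
Lemma L_complete (u : nat -> cseq R) : (forall k, L (u k)) ->
  (forall e : R, 0 < e -> exists N, forall p q, (N <= p)%N -> (N <= q)%N ->
        nrm (fun i => u p i - u q i) < e) ->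
  exists x, L x /\ forall e : R, 0 < e -> exists N, forall p, (N <= p)%N ->
        nrm (fun i => u p i - x i) < e.
Proof. by case: (lspaceP X) => -[_ [_ [_ [_ [_ [_ [_ [_ [h _]]]]]]]]] _; exact: h. Qed.
Lemma L_solid x y : (forall i, ~~ inR (idx X) i -> x i = 0) -> L y ->
  (forall i, cabs (x i) <= cabs (y i)) -> L x /\ nrm x <= nrm y.
Proof. by case: (lspaceP X) => -[_ [_ [_ [_ [_ [_ [_ [_ [_ h]]]]]]]]] _; exact: h. Qed.
Lemma L_unit k : inR (idx X) k -> L (@unit_vec R k).
Proof. by case: (lspaceP X) => _ /(_ k) h /h[]. Qed.
Lemma nrm_unit k : inR (idx X) k -> nrm (@unit_vec R k) = 1.
Proof. by case: (lspaceP X) => _ /(_ k) h /h[]. Qed.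

Lemma nrm0 : nrm (@seq_zero R) = 0.
Proof.
have -> : @seq_zero R = (fun i => 0 * @seq_zero R i) by apply/funext=> i; rewrite mul0r.
by rewrite nrm_scale ?cabs0 ?mul0r//; exact: L_zero.
Qed.

Lemma L_opp x : L x -> L (fun i => - x i).
Proof.
move=> Lx; have -> : (fun i => - x i) = (fun i => (-1) * x i).
  by apply/funext=> i; rewrite mulN1r.
exact: L_scale.
Qed.
Lemma nrm_opp x : L x -> nrm (fun i => - x i) = nrm x.
Proof.
move=> Lx; have -> : (fun i => - x i) = (fun i => (-1) * x i).
  by apply/funext=> i; rewrite mulN1r.
by rewrite nrm_scale// cabsN cabs1 mul1r.
Qed.
Lemma L_sub x y : L x -> L y -> L (fun i => x i - y i).
Proof. by move=> Lx Ly; apply: (L_add Lx); exact: L_opp. Qed.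
Lemma nrm_sub x y : L x -> L y -> nrm (fun i => x i - y i) <= nrm x + nrm y.
Proof.
by move=> Lx Ly; apply: (le_trans (nrm_add Lx (L_opp Ly))); rewrite nrm_opp.
Qed.
Lemma nrm_subC x y : L x -> L y ->
  nrm (fun i => x i - y i) = nrm (fun i => y i - x i).
Proof.
move=> Lx Ly; rewrite -nrm_opp; last exact: L_sub.
by congr nrm; apply/funext => i; rewrite opprB.
Qed.
Lemma nrm_sub_trans x y z : L x -> L y -> L z ->
  nrm (fun i => x i - z i) <= nrm (fun i => x i - y i) + nrm (fun i => y i - z i).
Proof.
move=> Lx Ly Lz; apply: le_trans (nrm_add (L_sub Lx Ly) (L_sub Ly Lz)).
by rewrite le_eqVlt; apply/orP; left; apply/eqP; congr nrm; apply/funext => i; ring.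
Qed.
Lemma nrm_le_sub x y : L x -> L y ->
  nrm x <= nrm y + nrm (fun i => x i - y i).
Proof.
move=> Lx Ly; apply: le_trans (nrm_add Ly (L_sub Lx Ly)).
by rewrite le_eqVlt; apply/orP; left; apply/eqP; congr nrm; apply/funext => i; ring.
Qed.

Lemma L_sum (n : nat) (u : nat -> cseq R) : (forall k, (k < n)%N -> L (u k)) ->
  L (fun i => \sum_(0 <= k < n) u k i) /\
  nrm (fun i => \sum_(0 <= k < n) u k i) <= \sum_(0 <= k < n) nrm (u k).
Proof.
elim: n => [_|n IH Lu].
  rewrite big_nil.
  have -> : (fun i => \sum_(0 <= k < 0) u k i) = @seq_zero R.
    by apply/funext => i; rewrite big_nil.
  by rewrite nrm0; split=> //; exact: L_zero.
have [L1 n1] := IH (fun k kn => Lu k (ltnW kn)).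
have -> : (fun i => \sum_(0 <= k < n.+1) u k i) =
    (fun i => (fun i => \sum_(0 <= k < n) u k i) i + u n i).
  by apply/funext => i; rewrite big_nat_recr.
split; first by apply: L_add => //; exact: Lu.
rewrite big_nat_recr //=; apply: (le_trans (nrm_add L1 (Lu _ _))) => //.
by rewrite lerD2r.
Qed.

(** [x i] times the unit vector [i] lies below [x] in modulus, and the unit vector has norm 1.
    Bounds on coordinates and on matrix entries come from here. *)
Lemma cabs_le_nrm x i : L x -> cabs (x i) <= nrm x.
Proof.
move=> Lx; case: (boolP (inR (idx X) i)) => [iR|iR]; last first.
  by rewrite (L_supp Lx iR) cabs0 nrm_ge0.
have h0 k : ~~ inR (idx X) k -> x i * @unit_vec R i k = 0.
  by move=> kR; rewrite (L_supp (L_unit iR) kR) mulr0.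
have h1 k : cabs (x i * @unit_vec R i k) <= cabs (x k).
  rewrite cabsM /unit_vec; case: eqP => [->|_]; last by rewrite cabs0 mulr0 cabs_ge0.
  by rewrite cabs1 mulr1.
have [_ h] := L_solid h0 Lx h1.
by move: h; rewrite nrm_scale ?nrm_unit ?mulr1//; exact: L_unit.
Qed.

Definition ctail n x : cseq R := fun i => if (n <= i)%N then x i else 0.
Definition chead n x : cseq R := fun i => if (n <= i)%N then 0 else x i.

Lemma chead_tail n x i : x i = chead n x i + ctail n x i.
Proof. by rewrite /chead /ctail; case: ifP; rewrite ?add0r ?addr0. Qed.

Lemma L_tail n x : L x -> L (ctail n x) /\ nrm (ctail n x) <= nrm x.
Proof.
move=> Lx; apply: L_solid => // i; rewrite /ctail; case: ifP => // _.
  by move=> h; rewrite (L_supp Lx h).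
by rewrite cabs0 cabs_ge0.
Qed.

Lemma L_head n x : L x -> L (chead n x) /\ nrm (chead n x) <= nrm x.
Proof.
move=> Lx; apply: L_solid => // i; rewrite /chead; case: ifP => // _.
  by move=> h; rewrite (L_supp Lx h).
by rewrite cabs0 cabs_ge0.
Qed.

Lemma nrm_tail_anti n p x : (n <= p)%N -> L x -> nrm (ctail p x) <= nrm (ctail n x).
Proof.
move=> np Lx; have [Lt _] := L_tail n Lx.
apply: (proj2 (L_solid _ Lt _)) => i.
  by move=> iR; rewrite /ctail (L_supp Lx iR) if_same.
rewrite /ctail; case: ifP => pi; last by rewrite cabs0 cabs_ge0.
by rewrite (leq_trans np pi).
Qed.

(* Order continuity applied to the decreasing sequence of tails of |x|. *)
Lemma nrm_tail_small x (e : R) : L x -> 0 < e -> exists n, nrm (ctail n x) < e.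
Proof.
move=> Lx e0; pose f n : cseq R := fun i => (cabs (ctail n x i))%:C.
have fL n : L (f n) /\ nrm (f n) = nrm (ctail n x).
  have [Lt _] := L_tail n Lx.
  have [L1 n1] : L (f n) /\ nrm (f n) <= nrm (ctail n x).
    apply: L_solid => // i; last by rewrite /f cabs_ge0R ?cabs_ge0.
    by move=> iR; rewrite /f (L_supp Lt iR) cabs0.
  split => //; apply/eqP; rewrite eq_le n1 /=.
  apply: (proj2 (L_solid _ L1 _)) => i; first exact: L_supp.
  by rewrite /f cabs_ge0R ?cabs_ge0.
have [] := @lspace_oc _ X nat leq f _ _ _ _ _ e e0; last first.
- by move=> a0 /(_ a0 (leqnn _)); case: (fL a0) => _ -> h; exists a0.
- move=> g Lg gf i; have := gf i.+1 i; rewrite /f /ctail ltnn cabs0; exact.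
- move=> a b ab i; rewrite /f lecR /ctail; case: ifP => bi; last by rewrite cabs0 cabs_ge0.
  by rewrite (leq_trans ab bi).
- by move=> n i; rewrite /f /seq_zero lecR cabs_ge0.
- by move=> n; case: (fL n).
- by split; [exists 0%N | split; [exact: leqnn | split; [move=> a b c ab; exact: leq_trans |
    move=> a b; exists (maxn a b); rewrite leq_maxl leq_maxr]]].
Qed.

Lemma nrm_tail_small_le x (e : R) : L x -> 0 < e ->
  exists n, forall p, (n <= p)%N -> nrm (ctail p x) < e.
Proof.
move=> Lx e0; have [n h] := nrm_tail_small Lx e0; exists n => p np.
by apply: le_lt_trans h; exact: nrm_tail_anti.
Qed.

Lemma nrm_tail_small_fin (u : nat -> cseq R) m (e : R) : (forall k, (k < m)%N -> L (u k)) ->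
  0 < e -> exists n, forall k p, (k < m)%N -> (n <= p)%N -> nrm (ctail p (u k)) < e.
Proof.
move=> + e0; elim: m => [_|m IH Lu]; first by exists 0%N.
have [n1 h1] := IH (fun k km => Lu k (ltnW km)).
have [n2 h2] := nrm_tail_small_le (Lu m (ltnSn m)) e0.
exists (maxn n1 n2) => k p; rewrite ltnS leq_eqVlt geq_max => /orP[/eqP->|km] /andP[p1 p2].
  exact: h2.
exact: h1.
Qed.

End SpaceBasics.

(** * Finite sums of limits of series *)

Section SumLimit.
Variable R : realType.

Lemma sum_series_cvg (g : nat -> nat -> R) (w : nat -> R) n :
  (forall j, cvgn (series (g j))) ->
  (fun p => \sum_(0 <= j < n) series (g j) p * w j) @ \oo -->
    \sum_(0 <= j < n) limn (series (g j)) * w j.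
Proof.
move=> gc; elim: n => [|n IH].
  rewrite big_nil; under eq_fun do rewrite big_nil; exact: cvg_cst.
rewrite big_nat_recr //=; under eq_fun do rewrite big_nat_recr //=.
by apply: cvgD => //; apply: cvgMl; exact: gc.
Qed.

(** Bounds finite sums of entries of a matrix product through the partial sums of the inner series;
    together with monotonicity this takes the place of Tonelli's theorem. *)
Lemma sum_limn_le (g : nat -> nat -> R) (w : nat -> R) n c :
  (forall j, cvgn (series (g j))) ->
  (forall p, \sum_(0 <= j < n) series (g j) p * w j <= c) ->
  \sum_(0 <= j < n) limn (series (g j)) * w j <= c.
Proof.
move=> gc h; have cv := @sum_series_cvg g w n gc.
rewrite -(cvg_lim _ cv)//; apply: limr_le; first by apply/cvg_ex; eexists; exact: cv.
by near=> p.
Unshelve. all: by end_near. Qed.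

Lemma series_single_le (f : nat -> R) j n : 0 <= f j -> (forall k, k != j -> f k = 0) ->
  series f n <= f j.
Proof.
move=> f0 h; rewrite /series /=; elim: n => [|n IH]; first by rewrite big_nil.
case: (ltnP j n) => jn.
  by rewrite big_nat_recr //= h ?addr0// gtn_eqF.
rewrite big_nat_recr //= big_nat big1 ?add0r; last first.
  by move=> i /andP[_ iN]; apply: h; rewrite ltn_eqF// (leq_trans iN jn).
by case: (eqVneq n j) => [->//|/h ->].
Qed.

Lemma limn_series_single (f : nat -> R) j : (forall k, 0 <= f k) ->
  (forall k, k != j -> f k = 0) -> limn (series f) = f j.
Proof.
move=> f0 h; have hb n := @series_single_le f j n (f0 j) h.
apply/eqP; rewrite eq_le limn_series_le//=.
apply: le_trans (series_le_limn j.+1 f0 hb).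
by rewrite /series /= big_nat_recr //= lerDr sumr_ge0.
Qed.

End SumLimit.

(** * Bounded nonnegative matrices and their products *)

Section PosSeq.
Variables (R : realType) (X : lspace R).
Local Notation C := R[i].
Local Notation L := (carrier X).
Local Notation nrm := (lnorm X).
Implicit Types (x y : nat -> R) (A B D : mat R).

Definition rc x : cseq R := fun i => (x i)%:C.

Lemma rc_mono x y : (forall i, 0 <= x i) -> (forall i, x i <= y i) -> L (rc y) ->
  L (rc x) /\ nrm (rc x) <= nrm (rc y).
Proof.
move=> x0 xy Ly; apply: L_solid => // i.
  move=> iR; have /(congr1 (@complex.Re R)) /= y0 := L_supp Ly iR.
  by rewrite /rc (_ : x i = 0)//; apply/eqP; rewrite eq_le x0 andbT -y0.
by rewrite /rc !cabs_ge0R// (le_trans (x0 i)).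
Qed.

Lemma rc_add x y : L (rc x) -> L (rc y) -> L (rc (fun i => x i + y i)) /\
  nrm (rc (fun i => x i + y i)) <= nrm (rc x) + nrm (rc y).
Proof.
have -> : rc (fun i => x i + y i) = (fun i => rc x i + rc y i).
  by apply/funext => i; rewrite /rc rmorphD.
by move=> Lx Ly; split; [exact: L_add|exact: nrm_add].
Qed.

Lemma rc_scale (c : R) x : 0 <= c -> L (rc x) -> L (rc (fun i => c * x i)) /\
  nrm (rc (fun i => c * x i)) = c * nrm (rc x).
Proof.
have -> : rc (fun i => c * x i) = (fun i => c%:C * rc x i).
  by apply/funext => i; rewrite /rc rmorphM.
by move=> c0 Lx; split; [exact: L_scale|rewrite nrm_scale// cabs_ge0R].
Qed.

Lemma rc0 : rc (fun _ => 0) = @seq_zero R.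
Proof. by apply/funext => i; rewrite /rc rmorph0. Qed.

Lemma rc_unit k : rc (fun i => (i == k)%:R) = @unit_vec R k.
Proof. by apply/funext => i; rewrite /rc /unit_vec; case: eqP. Qed.

Lemma rc_sum n (u : nat -> nat -> R) : (forall k, (k < n)%N -> L (rc (u k))) ->
  L (rc (fun i => \sum_(0 <= k < n) u k i)) /\
  nrm (rc (fun i => \sum_(0 <= k < n) u k i)) <= \sum_(0 <= k < n) nrm (rc (u k)).
Proof.
have -> : rc (fun i => \sum_(0 <= k < n) u k i) =
    (fun i => \sum_(0 <= k < n) rc (u k) i).
  by apply/funext => i; rewrite /rc rmorph_sum.
exact: (@L_sum _ X n (fun k => rc (u k))).
Qed.

Lemma rc_ge0_le_nrm x i : L (rc x) -> x i <= nrm (rc x).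
Proof.
move=> /(cabs_le_nrm i); apply: le_trans; rewrite /rc cabsR; exact: ler_norm.
Qed.

(* A defines an operator on L of norm at most M. Asking only for a vector of L above all partial
   sums is equivalent by solidity, and no infinite sum has to be formed. *)
Definition bnd A (M : R) : Prop :=
  nonneg_mat (idx X) A /\ 0 <= M /\
  forall x, (forall i, 0 <= x i) -> L (rc x) ->
    exists y, L (rc y) /\ nrm (rc y) <= M * nrm (rc x) /\
      forall i n, \sum_(0 <= j < n) A i j * x j <= y i.

Lemma bnd_ge0 A M i j : bnd A M -> 0 <= A i j.
Proof. by case=> /(_ i j)[]. Qed.

Lemma bnd_M0 A M : bnd A M -> 0 <= M. Proof. by case=> _ []. Qed.

Lemma bnd_supp A M i j : bnd A M -> ~~ inR (idx X) i || ~~ inR (idx X) j -> A i j = 0.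
Proof. by case=> /(_ i j)[]. Qed.

Lemma bnd_apply A M x : bnd A M -> (forall i, 0 <= x i) -> L (rc x) ->
  exists y, L (rc y) /\ (forall i, 0 <= y i) /\ nrm (rc y) <= M * nrm (rc x) /\
      forall i n, \sum_(0 <= j < n) A i j * x j <= y i.
Proof.
move=> [_ [M0 h]] x0 Lx; have [y [Ly [ny hy]]] := h x x0 Lx.
exists y; split=> //; split=> // i; have := hy i 0%N; rewrite big_nil; exact.
Qed.

Lemma nonneg_mat_le A B : (forall i j, 0 <= A i j <= B i j) ->
  nonneg_mat (idx X) B -> nonneg_mat (idx X) A.
Proof.
move=> h nB i j; have /andP[A0 AB] := h i j; split=> // /(proj2 (nB i j)) B0.
by apply/eqP; rewrite eq_le A0 andbT -B0.
Qed.

Lemma bnd_le A B M : (forall i j, 0 <= A i j <= B i j) -> bnd B M -> bnd A M.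
Proof.
move=> h [nB [M0 hB]]; split; first exact: nonneg_mat_le nB.
split=> // x x0 Lx; have [y [Ly [ny hy]]] := hB x x0 Lx; exists y; split=> //.
split=> // i n; apply: le_trans (hy i n); apply: ler_sum => j _.
by apply: ler_wpM2r => //; case/andP: (h i j).
Qed.

Lemma bnd_weak A M M' : M <= M' -> bnd A M -> bnd A M'.
Proof.
move=> MM [nA [M0 hA]]; split=> //; split; first exact: le_trans MM.
move=> x x0 Lx; have [y [Ly [ny hy]]] := hA x x0 Lx; exists y; split=> //; split=> //.
by apply: (le_trans ny); apply: ler_wpM2r => //; exact: nrm_ge0.
Qed.

(** The column is dominated by a vector bounding [A] on the unit vector [k], which has norm 1; a
    column outside the index set vanishes. *)
Lemma bnd_col A M k : bnd A M -> L (rc (fun i => A i k)) /\ nrm (rc (fun i => A i k)) <= M.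
Proof.
move=> bA; case: (boolP (inR (idx X) k)) => kR; last first.
  have -> : (fun i => A i k) = (fun _ => 0).
    by apply/funext => i; rewrite (bnd_supp bA)// kR orbT.
  by rewrite rc0 nrm0 (bnd_M0 bA); split=> //; exact: L_zero.
have [||y [Ly [_ [ny hy]]]] := @bnd_apply A M (fun i => (i == k)%:R) bA.
- by move=> i; rewrite ler0n.
- by rewrite rc_unit; exact: L_unit.
have [|||h1 h2] := @rc_mono (fun i => A i k) y => //.
- by move=> i; exact: bnd_ge0 bA.
- move=> i; apply: le_trans (hy i k.+1); rewrite big_nat_recr //= eqxx mulr1 lerDr.
  by apply: sumr_ge0 => j _; rewrite mulr_ge0 ?ler0n ?(bnd_ge0 _ _ bA).
split=> //; apply: (le_trans h2); apply: (le_trans ny).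
by rewrite rc_unit nrm_unit// mulr1.
Qed.

Lemma bnd_entry A M i j : bnd A M -> A i j <= M.
Proof.
by move=> bA; have [Lc nc] := bnd_col j bA; apply: le_trans nc; exact: (rc_ge0_le_nrm i Lc).
Qed.

Lemma bnd_zero : bnd (fun _ _ => 0) 0.
Proof.
split; first by move=> i j.
split=> // x x0 Lx; exists (fun _ => 0); rewrite rc0 nrm0 mul0r; split; first exact: L_zero.
by split=> // i n; rewrite big1// => j _; rewrite mul0r.
Qed.

Lemma bnd_add A B M N : bnd A M -> bnd B N -> bnd (fun i j => A i j + B i j) (M + N).
Proof.
move=> bA bB; split.
  move=> i j; rewrite addr_ge0 ?(bnd_ge0 _ _ bA) ?(bnd_ge0 _ _ bB)//; split=> // h.
  by rewrite (bnd_supp bA)// (bnd_supp bB)// addr0.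
split; first by rewrite addr_ge0 ?(bnd_M0 bA) ?(bnd_M0 bB).
move=> x x0 Lx; have [y [Ly [_ [ny hy]]]] := bnd_apply bA x0 Lx.
have [z [Lz [_ [nz hz]]]] := bnd_apply bB x0 Lx.
exists (fun i => y i + z i); have [L1 n1] := rc_add Ly Lz; split=> //; split.
  by apply: (le_trans n1); rewrite mulrDl lerD.
move=> i n; under eq_bigr do rewrite mulrDl.
by rewrite big_split lerD.
Qed.

Lemma bnd_scale c A M : 0 <= c -> bnd A M -> bnd (fun i j => c * A i j) (c * M).
Proof.
move=> c0 bA; split.
  move=> i j; rewrite mulr_ge0 ?(bnd_ge0 _ _ bA)//; split=> // h.
  by rewrite (bnd_supp bA)// mulr0.
split; first by rewrite mulr_ge0 ?(bnd_M0 bA).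
move=> x x0 Lx; have [y [Ly [_ [ny hy]]]] := bnd_apply bA x0 Lx.
exists (fun i => c * y i); have [L1 n1] := rc_scale c0 Ly; split=> //; split.
  by rewrite n1 -mulrA ler_wpM2l.
move=> i n; under eq_bigr do rewrite -mulrA.
by rewrite -mulr_sumr ler_wpM2l.
Qed.

Lemma bnd_sum m (A : nat -> mat R) (M : nat -> R) : (forall k, (k < m)%N -> bnd (A k) (M k)) ->
  bnd (fun i j => \sum_(0 <= k < m) A k i j) (\sum_(0 <= k < m) M k).
Proof.
elim: m => [_|m IH h].
  rewrite big_nil; have -> : (fun i j => \sum_(0 <= k < 0) A k i j) = (fun _ _ => 0 : R).
    by apply/funext => i; apply/funext => j; rewrite big_nil.
  exact: bnd_zero.
rewrite big_nat_recr //=.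
have -> : (fun i j => \sum_(0 <= k < m.+1) A k i j) =
    (fun i j => \sum_(0 <= k < m) A k i j + A m i j).
  by apply/funext => i; apply/funext => j; rewrite big_nat_recr.
apply: (@bnd_add (fun i j => \sum_(0 <= k < m) A k i j)).
  by apply: IH => k km; apply: h; exact: ltnW.
exact: h.
Qed.

Lemma mul_series_le A B M N i j n : bnd A M -> bnd B N ->
  series (fun k => A i k * B k j) n <= M * N.
Proof.
move=> bA bB; have [Lc nc] := bnd_col j bB.
have [|y [Ly [_ [ny hy]]]] := bnd_apply bA _ Lc; first by move=> k; exact: bnd_ge0 bB.
apply: (le_trans (hy i n)); apply: (le_trans (rc_ge0_le_nrm i Ly)).
by apply: (le_trans ny); apply: ler_wpM2l nc; exact: bnd_M0 bA.
Qed.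

Lemma mul_series_cvg A B M N i j : bnd A M -> bnd B N ->
  cvgn (series (fun k => A i k * B k j)).
Proof.
move=> bA bB; apply: (@series_bounded_cvg _ _ (M * N)).
  by move=> k; rewrite mulr_ge0 ?(bnd_ge0 _ _ bA) ?(bnd_ge0 _ _ bB).
by move=> n; exact: mul_series_le.
Qed.

Lemma mul_series_le_mul A B M N i j n : bnd A M -> bnd B N ->
  series (fun k => A i k * B k j) n <= matmul A B i j.
Proof.
move=> bA bB; apply: (@series_le_limn _ _ (M * N)).
  by move=> k; rewrite mulr_ge0 ?(bnd_ge0 _ _ bA) ?(bnd_ge0 _ _ bB).
by move=> p; exact: mul_series_le.
Qed.

Lemma matmul_le A B M N i j c : bnd A M -> bnd B N ->
  (forall n, \sum_(0 <= k < n) A i k * B k j <= c) -> matmul A B i j <= c.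
Proof.
move=> bA bB h; apply: limn_series_le => //.
by move=> k; rewrite mulr_ge0 ?(bnd_ge0 _ _ bA) ?(bnd_ge0 _ _ bB).
Qed.

Lemma matmul_ge0 A B M N i j : bnd A M -> bnd B N -> 0 <= matmul A B i j.
Proof.
by move=> bA bB; apply: le_trans (mul_series_le_mul i j 0 bA bB); rewrite /series /= big_nil.
Qed.

(** If [w] majorizes [B x] and [z] majorizes [A w], then [z] majorizes [(A B) x]: for each
    truncation of the inner series two finite sums are exchanged. *)
Lemma matmul_partial A B M N x (w : nat -> R) z i :
  bnd A M -> bnd B N -> (forall k q, \sum_(0 <= j < q) B k j * x j <= w k) ->
  (forall s, \sum_(0 <= k < s) A i k * w k <= z) ->
  forall q, \sum_(0 <= j < q) matmul A B i j * x j <= z.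
Proof.
move=> bA bB hB hA q; apply: sum_limn_le => [j|p]; first exact: mul_series_cvg bA bB.
rewrite /series /=; under eq_bigr do rewrite mulr_suml.
rewrite exchange_big /=; apply: le_trans (hA p); apply: ler_sum => k _.
under eq_bigr do rewrite -mulrA.
by rewrite -mulr_sumr ler_wpM2l// (bnd_ge0 _ _ bA).
Qed.

Lemma matmul_nonneg A B M N : bnd A M -> bnd B N -> nonneg_mat (idx X) (matmul A B).
Proof.
move=> bA bB i j; split; first exact: matmul_ge0 bA bB.
move=> h; apply/eqP; rewrite eq_le (matmul_ge0 _ _ bA bB) andbT.
apply: (matmul_le bA bB) => n; rewrite big1// => k _.
case/orP: h => h; first by rewrite (bnd_supp bA) ?h// mul0r.
by rewrite (bnd_supp bB) ?h ?orbT// mulr0.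
Qed.

Lemma bnd_mul A B M N : bnd A M -> bnd B N -> bnd (matmul A B) (M * N).
Proof.
move=> bA bB; split; first exact: matmul_nonneg bA bB.
split; first by rewrite mulr_ge0 ?(bnd_M0 bA) ?(bnd_M0 bB).
move=> x x0 Lx; have [y [Ly [y0 [ny hy]]]] := bnd_apply bB x0 Lx.
have [z [Lz [z0 [nz hz]]]] := bnd_apply bA y0 Ly.
exists z; split=> //; split.
  by apply: (le_trans nz); rewrite -mulrA ler_wpM2l// (bnd_M0 bA).
by move=> i; apply: (matmul_partial bA bB hy); exact: hz.
Qed.

Lemma matmul_mono A B A' B' M N : (forall i j, 0 <= A i j <= A' i j) ->
  (forall i j, 0 <= B i j <= B' i j) -> bnd A' M -> bnd B' N ->
  forall i j, 0 <= matmul A B i j <= matmul A' B' i j.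
Proof.
move=> hA hB bA bB i j; have bA' := bnd_le hA bA; have bB' := bnd_le hB bB.
rewrite (matmul_ge0 _ _ bA' bB') /=; apply: matmul_le bA' bB' _ => n.
apply: le_trans (mul_series_le_mul i j n bA bB); apply: ler_sum => k _.
by have /andP[? ?] := hA i k; have /andP[? ?] := hB k j; rewrite ler_pM.
Qed.

(** The exact image of a real vector, for equalities between operators; the majorants in [bnd] give
    only inequalities. *)
Definition vapp A (x : nat -> R) : nat -> R := fun i => limn (series (fun j => A i j * x j)).

Lemma vapp_le A x i c : (forall i j, 0 <= A i j) -> (forall j, 0 <= x j) ->
  (forall n, \sum_(0 <= j < n) A i j * x j <= c) -> vapp A x i <= c.
Proof. by move=> A0 x0 h; apply: limn_series_le => // k; rewrite mulr_ge0. Qed.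

Lemma vapp_cvg A M x i : bnd A M -> (forall j, 0 <= x j) -> L (rc x) ->
  cvgn (series (fun j => A i j * x j)).
Proof.
move=> bA x0 Lx; have [y [_ [_ [_ hy]]]] := bnd_apply bA x0 Lx.
apply: (@series_bounded_cvg _ _ (y i)); last exact: hy.
by move=> k; rewrite mulr_ge0// (bnd_ge0 _ _ bA).
Qed.

Lemma vapp_ge A M x i n : bnd A M -> (forall j, 0 <= x j) -> L (rc x) ->
  \sum_(0 <= j < n) A i j * x j <= vapp A x i.
Proof.
move=> bA x0 Lx; have [y [_ [_ [_ hy]]]] := bnd_apply bA x0 Lx.
apply: (@series_le_limn _ _ (y i) n); last exact: hy.
by move=> k; rewrite mulr_ge0// (bnd_ge0 _ _ bA).
Qed.

Lemma vapp_ge0 A M x i : bnd A M -> (forall j, 0 <= x j) -> L (rc x) -> 0 <= vapp A x i.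
Proof. by move=> bA x0 Lx; apply: le_trans (vapp_ge i 0%N bA x0 Lx); rewrite big_nil. Qed.

Lemma vapp_L A M x : bnd A M -> (forall j, 0 <= x j) -> L (rc x) ->
  L (rc (vapp A x)) /\ nrm (rc (vapp A x)) <= M * nrm (rc x).
Proof.
move=> bA x0 Lx; have [y [Ly [_ [ny hy]]]] := bnd_apply bA x0 Lx.
have v0 i := vapp_ge0 i bA x0 Lx.
have vy i : vapp A x i <= y i by apply: vapp_le => // k j; exact: bnd_ge0 bA.
by have [L1 n1] := rc_mono v0 vy Ly; split; [exact: L1|exact: le_trans ny].
Qed.

(** Each inequality is proved on finite partial sums, where the order of summation can be exchanged,
    and then passes to the monotone limits. *)
Lemma vapp_mul A B M N x : bnd A M -> bnd B N -> (forall j, 0 <= x j) -> L (rc x) ->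
  vapp (matmul A B) x = vapp A (vapp B x).
Proof.
move=> bA bB x0 Lx; have bAB := bnd_mul bA bB.
have v0 i := vapp_ge0 i bB x0 Lx; have [Lv _] := vapp_L bB x0 Lx.
apply/funext => i; apply/eqP; rewrite eq_le; apply/andP; split.
  apply: vapp_le => // [k j|n]; first exact: bnd_ge0 bAB.
  move: n; apply: (matmul_partial (w := vapp B x) bA bB) => [k q|s].
    exact: vapp_ge bB x0 Lx.
  exact: vapp_ge bA v0 Lv.
apply: vapp_le => // [k j|p]; first exact: bnd_ge0 bA.
under eq_bigr do rewrite mulrC.
apply: sum_limn_le => [j|n]; first exact: vapp_cvg bB x0 Lx.
apply: le_trans (vapp_ge i n bAB x0 Lx); rewrite /series /=.
under eq_bigr do rewrite mulr_suml.
rewrite exchange_big /=; apply: ler_sum => k _.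
have h := mul_series_le_mul i k p bA bB.
under eq_bigr do rewrite mulrC mulrA.
by rewrite -mulr_suml ler_wpM2r.
Qed.

(** By conversion, column [l] of a product is the image of column [l] of the right factor, so this
    is [vapp_mul] on the columns of [D]. *)
Lemma matmulA A B D M N P : bnd A M -> bnd B N -> bnd D P ->
  matmul (matmul A B) D = matmul A (matmul B D).
Proof.
move=> bA bB bD; apply/funext => i; apply/funext => l.
have [Lc _] := bnd_col l bD.
by have /(congr1 (fun f => f i)) := vapp_mul bA bB (fun k => bnd_ge0 k l bD) Lc.
Qed.

(* The identity of L; indices outside the index set carry the zero row. *)
Definition idm : mat R := fun i j => ((i == j) && inR (idx X) i)%:R.

Lemma bnd_idm : bnd idm 1.
Proof.
split.
  move=> i j; rewrite /idm ler0n; split=> //; case: eqP => [->|]//=.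
  by rewrite orbb => /negbTE ->.
split=> // x x0 Lx; exists x; rewrite mul1r; split=> //; split=> // i n.
have := @series_single_le R (fun j => idm i j * x j) i n.
rewrite /idm /series /= eqxx => h; apply: (le_trans (h _ _)).
- by rewrite mulr_ge0 ?ler0n.
- by move=> k; rewrite eq_sym => /negbTE ->; rewrite mul0r.
by case: (inR _ _); rewrite /= ?mul1r ?mul0r.
Qed.

Lemma matmul1m A M : bnd A M -> matmul idm A = A.
Proof.
move=> bA; apply/funext => i; apply/funext => j; rewrite /matmul.
rewrite (@limn_series_single _ _ i) /idm ?eqxx /=.
- by case: (boolP (inR _ _)) => iR; rewrite ?mul1r// mul0r (bnd_supp bA) ?iR.
- by move=> k; rewrite mulr_ge0 ?ler0n ?(bnd_ge0 _ _ bA).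
- by move=> k; rewrite eq_sym => /negbTE ->; rewrite mul0r.
Qed.

Lemma matmulm1 A M : bnd A M -> matmul A idm = A.
Proof.
move=> bA; apply/funext => i; apply/funext => j; rewrite /matmul.
rewrite (@limn_series_single _ _ j) /idm ?eqxx /=.
- by case: (boolP (inR _ _)) => jR; rewrite ?mulr1// mulr0 (bnd_supp bA) ?jR ?orbT.
- by move=> k; rewrite mulr_ge0 ?ler0n ?(bnd_ge0 _ _ bA).
- by move=> k /negbTE ->; rewrite mulr0.
Qed.

End PosSeq.

(** * Arithmetic and geometric means *)

Section GeometricMean.
Variable R : realType.

Lemma prod_powR (m : nat) (F : 'I_m -> R) (t : R) : (forall j, 0 <= F j) ->
  \prod_(j < m) powR (F j) t = powR (\prod_(j < m) F j) t.
Proof.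
elim: m F => [|m IH] F F0; first by rewrite !big_ord0 powR1.
by rewrite !big_ord_recr /= powRM ?IH// prodr_ge0.
Qed.

(** The product of the [u j] is at most 1, so lowering the exponent from [t] to [m^-1] can only
    increase its power; the rest is AM-GM. *)
Lemma powR_prod_le_mean (m : nat) (u : 'I_m -> R) (t : R) : (0 < m)%N ->
  m%:R^-1 <= t -> (forall j, 0 <= u j <= 1) ->
  \prod_(j < m) powR (u j) t <= m%:R^-1 * \sum_(j < m) u j.
Proof.
move=> m0 mt hu; have u0 j : 0 <= u j by case/andP: (hu j).
have mR : 0 < m%:R^-1 :> R by rewrite invr_gt0 ltr0n.
have S0 : 0 <= \sum_(j < m) u j by exact: sumr_ge0.
rewrite prod_powR//; set P := \prod_(j < m) u j.
have P0 : 0 <= P by exact: prodr_ge0.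
have P1 : P <= 1.
  have := @ler_prod R _ (index_enum 'I_m) (fun=> true) u (fun=> 1) (fun j _ => hu j).
  by rewrite [X in _ <= X]big1.
apply: (@le_trans _ _ (powR P (m%:R^-1))).
  move: P0; rewrite le_eqVlt => /predU1P[<-|P0]; last by apply: ger_powR => //; rewrite P0.
  by rewrite !powR0 ?gt_eqF// (lt_le_trans mR).
have := @leif_AGM R 'I_m [pred _ | true] u; rewrite /= => /(_ _)[|h _]; first by move=> i _.
rewrite cardT size_enum_ord in h.
have {}h : P <= (m%:R^-1 * \sum_(j < m) u j) ^+ m by rewrite mulrC.
have q0 : 0 <= m%:R^-1 * \sum_(j < m) u j by rewrite mulr_ge0// ltW.
apply: (@le_trans _ _ (powR ((m%:R^-1 * \sum_(j < m) u j) ^+ m) (m%:R^-1))).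
  apply: ge0_ler_powR => //; by rewrite nnegrE exprn_ge0.
by rewrite -powR_mulrn// -powRrM mulfV ?powRr1// pnatr_eq0 -lt0n.
Qed.

(** The previous bound for the ratios [x j / c j], which lie in [0, 1]. This normalization is what
    admits exponents with sum above 1. *)
Lemma powR_prod_le_wmean (m : nat) (c x : 'I_m -> R) (t : R) : (0 < m)%N ->
  m%:R^-1 <= t -> (forall j, 0 < c j) -> (forall j, 0 <= x j <= c j) ->
  \prod_(j < m) powR (x j) t <=
    powR (\prod_(j < m) c j) t * (m%:R^-1 * \sum_(j < m) x j / c j).
Proof.
move=> m0 mt c0 hx.
have xc j : x j = c j * (x j / c j) by rewrite mulrCA divff ?mulr1// gt_eqF.
have h j : 0 <= x j / c j <= 1.
  by case/andP: (hx j) => x0 xlec; rewrite divr_ge0 ?(ltW (c0 j))//= ler_pdivrMr// mul1r.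
have h0 j : 0 <= x j / c j by case/andP: (h j).
rewrite -prod_powR; last by move=> j; exact: ltW.
under eq_bigr do rewrite xc (powRM _ (ltW (c0 _)) (h0 _)).
rewrite big_split /= ler_wpM2l//; last exact: powR_prod_le_mean.
by apply: prodr_ge0 => j _; exact: powR_ge0.
Qed.

(* The exponents t may add up to more than 1, unlike in the usual Hoelder inequality. *)
Lemma hoelder_sum (m n : nat) (x : nat -> 'I_m -> R) (t : R) : (0 < m)%N ->
  m%:R^-1 <= t -> (forall k j, 0 <= x k j) ->
  \sum_(0 <= k < n) \prod_(j < m) powR (x k j) t <=
    \prod_(j < m) powR (\sum_(0 <= k < n) x k j) t.
Proof.
move=> m0 mt x0; set c := fun j => \sum_(0 <= k < n) x k j.
have c0 j : 0 <= c j by exact: sumr_ge0.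
have xc k j : (k < n)%N -> x k j <= c j.
  move=> kn; rewrite /c (bigD1_seq k) ?mem_index_iota ?iota_uniq//= lerDl.
  exact: sumr_ge0.
have t0 : 0 < t by rewrite (lt_le_trans _ mt)// invr_gt0 ltr0n.
(* Positive sums [c j] serve as weights: the ratios [x k j / c j] add up to 1 over [k]. If some
   [c j] is 0, every term on the left has a factor 0 to the power [t]. *)
have [cp|] := pselect (forall j, 0 < c j).
  apply: (@le_trans _ _ (\sum_(0 <= k < n)
      powR (\prod_(j < m) c j) t * (m%:R^-1 * \sum_(j < m) x k j / c j))).
    rewrite big_nat [leRHS]big_nat; apply: ler_sum => k kn.
    by apply: powR_prod_le_wmean => // j; rewrite x0 xc//; case/andP: kn.
  rewrite -mulr_sumr prod_powR// ler_piMr ?powR_ge0//.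
  rewrite -mulr_sumr exchange_big /= ler_pdivrMl ?ltr0n// mulr1.
  rewrite (eq_bigr (fun => 1)) ?sumr_const ?cardT ?size_enum_ord// => j _.
  by rewrite -mulr_suml -/(c j) divff// gt_eqF.
move=> /existsNP[j /negP]; rewrite lt_neqAle c0 andbT negbK => /eqP cj.
rewrite big_nat big1; first by apply: prodr_ge0 => i _; exact: powR_ge0.
move=> k /andP[_ kn]; rewrite (bigD1 j)//=.
have -> : x k j = 0 by apply/eqP; rewrite eq_le x0 andbT cj xc.
by rewrite powR0 ?gt_eqF// mul0r.
Qed.

(** The infima [gam] and [rh] are only approached with a slack [d]; continuity of the product at
    [d = 0] removes it. *)
Lemma le_prod_addgt0 (m : nat) (a : 'I_m -> R) (x : R) :
  (forall d : R, 0 < d -> x <= \prod_(j < m) (a j + d)) -> x <= \prod_(j < m) a j.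
Proof.
move=> h.
have cv : (fun d : R => \prod_(j < m) (a j + d)) @ 0^'+ --> \prod_(j < m) a j.
  apply: cvg_at_right_filter; elim: m a {h} => [|m IH] a.
    by rewrite big_ord0; under eq_fun do rewrite big_ord0; exact: cvg_cst.
  rewrite big_ord_recr /=; under eq_fun do rewrite big_ord_recr /=.
  apply: cvgM; first exact: (IH (fun j => a (widen_ord (leqnSn m) j))).
  by rewrite -[X in _ --> X]addr0; apply: cvgD; [exact: cvg_cst|exact: cvg_id].
rewrite -(cvg_lim _ cv)//; apply: limr_ge; first by apply/cvg_ex; eexists; exact: cv.
near=> d; apply: h; near: d; exact: nbhs_right_gt.
Unshelve. all: by end_near. Qed.

Lemma le_powR_prod_addgt0 (m : nat) (a : 'I_m -> R) (t x : R) : 0 < t -> 0 <= x ->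
  (forall j, 0 <= a j) ->
  (forall d : R, 0 < d -> x <= \prod_(j < m) powR (a j + d) t) ->
  x <= \prod_(j < m) powR (a j) t.
Proof.
move=> t0 x0 a0 h; have ti : 0 <= t^-1 by rewrite invr_ge0 ltW.
have tN : t != 0 by rewrite gt_eqF.
have -> : x = powR (powR x t^-1) t by rewrite -powRrM mulVf// powRr1.
rewrite prod_powR//.
apply: ge0_ler_powR; [exact: ltW|by rewrite nnegrE powR_ge0|by rewrite nnegrE prodr_ge0|].
apply: le_prod_addgt0 => d d0.
have ad0 j : 0 <= a j + d by rewrite addr_ge0// ltW.
have P0 : 0 <= \prod_(j < m) (a j + d) by exact: prodr_ge0.
have -> : \prod_(j < m) (a j + d) = powR (powR (\prod_(j < m) (a j + d)) t) t^-1.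
  by rewrite -powRrM mulfV// powRr1.
rewrite -prod_powR//; apply: ge0_ler_powR => //; [|exact: h].
by rewrite nnegrE prodr_ge0// => j _; exact: powR_ge0.
Qed.

End GeometricMean.

(** * Row tails and the measure of noncompactness *)

Section Gamma.
Variables (R : realType) (X : lspace R).
Local Notation L := (carrier X).
Local Notation nrm := (lnorm X).
Local Notation bnd := (bnd X).
Implicit Types (A B : mat R).

Definition mtail n A : mat R := fun i j => if (n <= i)%N then A i j else 0.

Lemma mtail_le n p A : (n <= p)%N -> (forall i j, 0 <= A i j) ->
  forall i j, 0 <= mtail p A i j <= mtail n A i j.
Proof.
move=> np A0 i j; rewrite /mtail; case: ifP => pi; first by rewrite (leq_trans np pi) A0/=.
by case: ifP; rewrite ?lexx ?A0.
Qed.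

Lemma bnd_mtail n A M : bnd A M -> bnd (mtail n A) M.
Proof. by move=> bA; apply: (bnd_le _ bA) => i j; apply: (@mtail_le 0%N) => // k l; exact: bnd_ge0 bA. Qed.

Lemma bnd_mtail_le n p A M : (n <= p)%N -> (forall i j, 0 <= A i j) ->
  bnd (mtail n A) M -> bnd (mtail p A) M.
Proof. by move=> np A0; apply: bnd_le => i j; exact: mtail_le. Qed.

(* The norms of the row tails of A decrease to the Hausdorff measure of noncompactness of A. *)
Definition gam A : R := inf [set e : R | exists n, bnd (mtail n A) e].

Lemma gam_set_inf A M : bnd A M -> has_inf [set e : R | exists n, bnd (mtail n A) e].
Proof.
move=> bA; split; first by exists M, 0%N.
by exists 0 => e [n /bnd_M0].
Qed.

Lemma gam_le A n e : bnd (mtail n A) e -> gam A <= e.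
Proof. by move=> h; apply: ge_inf; [exists 0 => f [p /bnd_M0]|exists n]. Qed.

Lemma gam_le_bnd A M : bnd A M -> gam A <= M.
Proof. by move=> bA; apply: (@gam_le _ 0%N). Qed.

Lemma gam_lt A M e : bnd A M -> gam A < e -> exists n, bnd (mtail n A) e.
Proof.
move=> bA; rewrite -subr_gt0 => h.
have [f [n bf] fe] := inf_adherent h (gam_set_inf bA); exists n.
apply: (bnd_weak _ bf); apply: ltW; apply: (lt_le_trans fe).
by rewrite addrC subrK.
Qed.

Lemma gam_ge0 A M : bnd A M -> 0 <= gam A.
Proof.
move=> bA; apply: lb_le_inf; first by case: (gam_set_inf bA).
by move=> e [n /bnd_M0].
Qed.

Lemma gam_mono A B M : (forall i j, 0 <= A i j <= B i j) -> bnd B M -> gam A <= gam B.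
Proof.
move=> AB bB; apply/ler_addgt0Pr => d d0.
have [|n bn] := gam_lt bB (e := gam B + d); first by rewrite ltrDl.
apply: (@gam_le _ n); apply: (bnd_le _ bn) => i j; rewrite /mtail.
by case: ifP; rewrite ?lexx ?AB.
Qed.

(** Finitely many columns of [A] lie in L, so their tails are uniformly small. This is how
    compactness of the first [p] columns enters. *)
Lemma head_small A M p (d : R) : bnd A M -> 0 < d ->
  exists N, nrm (rc (fun i => \sum_(0 <= k < p) mtail N A i k)) < d /\
    L (rc (fun i => \sum_(0 <= k < p) mtail N A i k)).
Proof.
move=> bA d0; pose u k := rc (fun i => A i k).
have Lu k : (k < p)%N -> L (u k) by move=> _; case: (bnd_col k bA).
(* [p.+1] instead of [p] covers [p = 0] and makes the final inequality strict. *)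
have d1 : 0 < d / p.+1%:R by rewrite divr_gt0.
have [N hN] := nrm_tail_small_fin Lu d1; exists N.
have e k : rc (fun i => mtail N A i k) = ctail N (u k).
  by apply/funext => i; rewrite /rc /ctail /mtail /u /rc; case: ifP.
have [|L1 n1] := @rc_sum _ X p (fun k i => mtail N A i k).
  by move=> k kp; rewrite e; case: (L_tail N (Lu k kp)).
split=> //; apply: (le_lt_trans n1).
apply: (@le_lt_trans _ _ (\sum_(0 <= k < p) d / p.+1%:R)).
  by rewrite big_nat [leRHS]big_nat; apply: ler_sum => k kp; rewrite e; apply: ltW; apply: hN.
rewrite sumr_const_nat subn0 -[_ *+ _]mulr_natr -mulrA -[ltRHS]mulr1 ltr_pM2l// mulrC.
by rewrite ltr_pdivrMr ?ltr0n// mul1r ltr_nat.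
Qed.

(** [B x] is split at row [p]. Its tail has norm at most [f] times that of [x], and the rows of [A]
    from [n] on contribute the factor [e]. Its head meets only the first [p] columns of [A], whose
    tails are made small by a large [q]. *)
Lemma bnd_tail_mul A B M N n p (e f d : R) : bnd A M -> bnd B N ->
  bnd (mtail n A) e -> bnd (mtail p B) f -> 0 < d ->
  exists q, bnd (mtail q (matmul A B)) (e * f + d).
Proof.
move=> bA bB be bf d0; have N0 := bnd_M0 bB.
have N1 : 0 < N + 1 by rewrite ltr_wpDl.
have [q1 [hq1 Lq1]] := head_small p bA (divr_gt0 d0 N1).
pose q := maxn n q1; exists q.
pose s i := \sum_(0 <= k < p) mtail q A i k.
have A0 i j : 0 <= A i j by exact: bnd_ge0 bA.
have s0 i : 0 <= s i by apply: sumr_ge0 => k _; rewrite /mtail; case: ifP.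
have [||Ls ns] := @rc_mono _ X s (fun i => \sum_(0 <= k < p) mtail q1 A i k) _ _ Lq1.
- exact: s0.
- move=> i; apply: ler_sum => k _; have /andP[] := mtail_le (leq_maxr n q1) A0 i k.
  by [].
split.
  apply: (@nonneg_mat_le _ X _ (matmul A B)); last exact: matmul_nonneg bA bB.
  by move=> i j; apply: (@mtail_le 0%N) => // k l; exact: matmul_ge0 bA bB.
split; first by rewrite addr_ge0 ?mulr_ge0 ?(bnd_M0 be) ?(bnd_M0 bf)// ltW.
move=> x x0 Lx.
have [y [Ly [y0 [ny hy]]]] := bnd_apply bf x0 Lx.
have [v [Lv [v0 [nv hv]]]] := bnd_apply bB x0 Lx.
have [z [Lz [z0 [nz hz]]]] := bnd_apply be y0 Ly.
have r0 : 0 <= N * nrm (rc x) by rewrite mulr_ge0 ?nrm_ge0.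
have [L1 n1] := rc_scale r0 Ls; have [L2 n2] := rc_add L1 Lz.
exists (fun i => N * nrm (rc x) * s i + z i); split=> //; split.
  apply: (le_trans n2); rewrite n1 mulrDl addrC lerD//.
    by apply: (le_trans nz); rewrite -mulrA ler_wpM2l ?(bnd_M0 be).
  rewrite mulrC mulrA ler_wpM2r ?nrm_ge0//.
  apply: (@le_trans _ _ (d / (N + 1) * N)).
    by rewrite ler_wpM2r// (le_trans ns)// ltW.
  by rewrite mulrAC ler_pdivrMr// ler_pM2l// lerDl.
move=> i k; rewrite /mtail; case: (boolP (q <= i)%N) => qi; last first.
  rewrite big1; last by move=> j _; rewrite mul0r.
  by rewrite addr_ge0 ?mulr_ge0 ?s0 ?z0 ?nrm_ge0.
(* [w] majorizes [B x]: by the tail bound [y] from row [p] on, by [v] before. Coordinates of [v] are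
   at most [N * nrm (rc x)], the coefficient of [s] in the witness. *)
move: k; apply: (matmul_partial (w := fun k => if (p <= k)%N then y k else v k) bA bB).
  move=> k r; case: ifP => pk; last exact: hv.
  by have := hy k r; rewrite /mtail pk.
move=> r.
apply: (@le_trans _ _ (\sum_(0 <= k < r) (A i k * (if (p <= k)%N then 0 else N * nrm (rc x)) +
    A i k * y k))).
  apply: ler_sum => k _; rewrite -mulrDr ler_wpM2l//; case: ifP => pk; first by rewrite add0r.
  by rewrite -[leLHS]addr0 lerD// (le_trans (rc_ge0_le_nrm k Lv)).
rewrite big_split /=; apply: lerD; last first.
  by have := hz i r; rewrite /mtail (leq_trans _ qi)// leq_maxl.
have E k : mtail q A i k = A i k by rewrite /mtail qi.
rewrite /s mulr_sumr; under [leRHS]eq_bigr do rewrite E mulrC.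
elim: r => [|r IH].
  by rewrite big_nil sumr_ge0// => k _; rewrite mulr_ge0.
rewrite big_nat_recr //=; case: (leqP p r) => pr; first by rewrite mulr0 addr0.
rewrite [leRHS](big_cat_nat (n := r.+1))//= [X in _ <= X + _]big_nat_recr //= -[leRHS]addrA lerD//; last first.
  by rewrite lerDl sumr_ge0// => k _; rewrite mulr_ge0.
rewrite !big_nat; apply: ler_sum => k /andP[_ kr].
by rewrite leqNgt (ltn_trans kr pr).
Qed.

Lemma gam_mul A B M N : bnd A M -> bnd B N -> gam (matmul A B) <= gam A * gam B.
Proof.
move=> bA bB.
suff h (d : R) : 0 < d -> gam (matmul A B) <= (gam A + d) * (gam B + d).
  pose a (j : 'I_2) := if j == ord0 then gam A else gam B.
  have := @le_prod_addgt0 R 2 a (gam (matmul A B)).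
  rewrite big_ord_recl big_ord1 /a /=; apply => d d0.
  by rewrite big_ord_recl big_ord1 /=; exact: h.
move=> d0; apply/ler_addgt0Pr => c c0.
have [|n bn] := gam_lt bA (e := gam A + d); first by rewrite ltrDl.
have [|p bp] := gam_lt bB (e := gam B + d); first by rewrite ltrDl.
have [q bq] := bnd_tail_mul bA bB bn bp c0.
exact: gam_le bq.
Qed.

(** Closed form of the elements of [hprod_pow], as [hprod_powP] shows. *)
Definition hp (m : nat) (t : R) (B : nat -> mat R) : mat R :=
  fun i k => \prod_(j < m) powR (B j i k) t.

Lemma hp_ge0 m t (B : nat -> mat R) i k : 0 <= hp m t B i k.
Proof. by apply: prodr_ge0 => j _; exact: powR_ge0. Qed.

(* Entrywise AM-GM: after dividing each factor by its norm bound, a Hadamard mean is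
   dominated by the arithmetic mean. *)
Lemma bnd_hp m t (B : nat -> mat R) (M : nat -> R) : (0 < m)%N -> m%:R^-1 <= t ->
  (forall j, (j < m)%N -> 0 < M j /\ bnd (B j) (M j)) ->
  bnd (hp m t B) (\prod_(j < m) powR (M j) t).
Proof.
move=> m0 mt h.
have h0 (j : 'I_m) : 0 < M j by case: (h j (ltn_ord j)).
have hB (j : 'I_m) : bnd (B j) (M j) by case: (h j (ltn_ord j)).
pose P := powR (\prod_(j < m) M j) t.
have P0 : 0 <= P * m%:R^-1 by rewrite mulr_ge0 ?powR_ge0// invr_ge0.
have -> : \prod_(j < m) powR (M j) t = P * m%:R^-1 * \sum_(0 <= j < m) 1.
  rewrite prod_powR; last by move=> j; exact: ltW.
  by rewrite sumr_const_nat subn0 -mulrA mulVf ?mulr1// pnatr_eq0 -lt0n.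
pose D : mat R := fun i k => P * m%:R^-1 * \sum_(0 <= j < m) (M j)^-1 * B j i k.
apply: (@bnd_le _ X _ D) => [i k|].
  rewrite hp_ge0 /= /D big_mkord -mulrA.
  have -> : \sum_(i0 < m) (M i0)^-1 * B i0 i k = \sum_(i0 < m) B i0 i k / M i0.
    by apply: eq_bigr => j _; rewrite mulrC.
  apply: powR_prod_le_wmean => // j.
  by rewrite (bnd_ge0 _ _ (hB j)) (bnd_entry _ _ (hB j)).
apply: bnd_scale => //; apply: bnd_sum => j jm.
have [Mj bj] := h j jm; rewrite -[X in bnd _ X](@mulVf _ (M j)) ?gt_eqF//.
by apply: bnd_scale => //; rewrite invr_ge0 ltW.
Qed.

(** A zero row stays zero because there is at least one factor and 0 to a positive power is 0. *)
Lemma hp_tail m t n (B : nat -> mat R) : (0 < m)%N -> 0 < t ->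
  mtail n (hp m t B) = hp m t (fun j => mtail n (B j)).
Proof.
move=> m0 t0; apply/funext => i; apply/funext => k; rewrite /hp /mtail; case: ifP => // _.
by case: m m0 => // m _; rewrite big_ord_recl powR0 ?gt_eqF// mul0r.
Qed.

(** Row tails of a Hadamard mean are Hadamard means of row tails, so [bnd_hp] applies to tails from
    an index common to all factors. The slack [d] also makes their norm bounds positive, as [bnd_hp]
    demands. *)
Lemma gam_hp m t (B : nat -> mat R) (M : nat -> R) : (0 < m)%N -> m%:R^-1 <= t ->
  (forall j, (j < m)%N -> 0 < M j /\ bnd (B j) (M j)) ->
  gam (hp m t B) <= \prod_(j < m) powR (gam (B j)) t.
Proof.
move=> m0 mt h.
have t0 : 0 < t by rewrite (lt_le_trans _ mt)// invr_gt0 ltr0n.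
apply: le_powR_prod_addgt0 => //.
- exact: gam_ge0 (bnd_hp m0 mt h).
- by move=> j; case: (h j (ltn_ord j)) => _ /gam_ge0.
move=> d d0.
have g0 j : (j < m)%N -> 0 <= gam (B j) by move=> jm; case: (h j jm) => _ /gam_ge0.
suff [n hn] : exists n, forall j, (j < m)%N -> bnd (mtail n (B j)) (gam (B j) + d).
  apply: (@gam_le _ n); rewrite hp_tail//.
  apply: (@bnd_hp m t (fun j => mtail n (B j)) (fun j => gam (B j) + d)) => //.
  by move=> j jm; split; [rewrite ltr_wpDl ?g0|exact: hn].
have : forall j, (j < m)%N -> exists n, bnd (mtail n (B j)) (gam (B j) + d).
  by move=> j jm; have [_ bj] := h j jm; apply: gam_lt bj _; rewrite ltrDl.
have B0 j i k : (j < m)%N -> 0 <= B j i k by move=> jm; have [_ /bnd_ge0] := h j jm.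
elim: (m) B0 => [|p IH] B0 hn; first by exists 0%N.
have [n1 h1] := IH (fun j i k jp => B0 j i k (ltnW jp)) (fun j jp => hn j (ltnW jp)).
have [n2 h2] := hn p (ltnSn p); exists (maxn n1 n2) => j.
rewrite ltnS leq_eqVlt => /predU1P[->|jp].
  by apply: bnd_mtail_le h2 => //; [exact: leq_maxr|move=> i k; exact: B0].
by apply: bnd_mtail_le (h1 j jp) => //; [exact: leq_maxl|move=> i k; apply: B0; exact: ltnW].
Qed.

(** The summand at [l] is the product of the [t]-th powers of [A j i l * B j l k]; Hoelder's
    inequality over [l] is applied to each partial sum. *)
Lemma matmul_hp m t (A B : nat -> mat R) (M N : nat -> R) : (0 < m)%N -> m%:R^-1 <= t ->
  (forall j, (j < m)%N -> 0 < M j /\ bnd (A j) (M j)) ->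
  (forall j, (j < m)%N -> 0 < N j /\ bnd (B j) (N j)) ->
  forall i k, 0 <= matmul (hp m t A) (hp m t B) i k <= hp m t (fun j => matmul (A j) (B j)) i k.
Proof.
move=> m0 mt hA hB i k.
have t0 : 0 < t by rewrite (lt_le_trans _ mt)// invr_gt0 ltr0n.
have bA := bnd_hp m0 mt hA; have bB := bnd_hp m0 mt hB.
have bAj (j : 'I_m) : bnd (A j) (M j) by case: (hA j (ltn_ord j)).
have bBj (j : 'I_m) : bnd (B j) (N j) by case: (hB j (ltn_ord j)).
rewrite (matmul_ge0 _ _ bA bB) /=; apply: (matmul_le bA bB) => n.
have e l : hp m t A i l * hp m t B l k = \prod_(j < m) powR (A j i l * B j l k) t.
  rewrite /hp -big_split /=; apply: eq_bigr => j _.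
  by rewrite powRM// ?(bnd_ge0 _ _ (bAj j)) ?(bnd_ge0 _ _ (bBj j)).
under eq_bigr do rewrite e.
apply: (le_trans (@hoelder_sum R m n (fun l j => A j i l * B j l k) t m0 mt _)).
  by move=> l j; rewrite mulr_ge0 ?(bnd_ge0 _ _ (bAj j)) ?(bnd_ge0 _ _ (bBj j)).
apply: ler_prod => j _; rewrite powR_ge0 /=; apply: ge0_ler_powR; first exact: ltW.
- rewrite nnegrE sumr_ge0// => l _.
  by rewrite mulr_ge0 ?(bnd_ge0 _ _ (bAj j)) ?(bnd_ge0 _ _ (bBj j)).
- by rewrite nnegrE (matmul_ge0 _ _ (bAj j) (bBj j)).
exact: mul_series_le_mul (bAj j) (bBj j).
Qed.

End Gamma.

(** * Action of nonnegative matrices on complex sequences *)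

Section OperatorAction.
Variables (R : realType) (X : lspace R).
Local Notation C := R[i].
Local Notation L := (carrier X).
Local Notation nrm := (lnorm X).
Local Notation bnd := (bnd X).
Implicit Types (A B : mat R) (x y : cseq R) (u v : nat -> R).

Definition absq x : nat -> R := fun i => cabs (x i).

Lemma absq_ge0 x i : 0 <= absq x i. Proof. exact: cabs_ge0. Qed.

Lemma absq_L x : L x -> L (rc (absq x)) /\ nrm (rc (absq x)) = nrm x.
Proof.
move=> Lx; have [L1 n1] : L (rc (absq x)) /\ nrm (rc (absq x)) <= nrm x.
  apply: L_solid => // i; last by rewrite /rc cabs_ge0R ?absq_ge0.
  by move=> iR; rewrite /rc /absq (L_supp Lx iR) cabs0.
split => //; apply/eqP; rewrite eq_le n1 /=.
apply: (proj2 (L_solid _ L1 _)) => i; first exact: L_supp.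
by rewrite /rc cabs_ge0R ?absq_ge0.
Qed.

Lemma vapp_cvg_norm A M u v i : bnd A M -> L (rc v) -> (forall j, `|u j| <= v j) ->
  cvgn (series (fun j => A i j * u j)).
Proof.
move=> bA Lv uv; apply: normed_cvg.
apply: (@series_le_cvg _ _ (fun j => A i j * v j)) => [k|k|k|].
- exact: normr_ge0.
- by rewrite mulr_ge0 ?(bnd_ge0 _ _ bA)// (le_trans _ (uv k)).
- by rewrite /= normrM ger0_norm ?(bnd_ge0 _ _ bA)// ler_wpM2l// (bnd_ge0 _ _ bA).
- by apply: (@vapp_cvg _ X A M v i bA _ Lv) => j; rewrite (le_trans _ (uv j)).
Qed.

Lemma vapp_lin A M u v w (a b : R) i : bnd A M -> L (rc w) ->
  (forall j, `|u j| <= w j) -> (forall j, `|v j| <= w j) ->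
  vapp A (fun j => a * u j + b * v j) i = a * vapp A u i + b * vapp A v i.
Proof.
move=> bA Lw uw vw.
have cu := @vapp_cvg_norm A M u w i bA Lw uw; have cv := @vapp_cvg_norm A M v w i bA Lw vw.
rewrite /vapp; apply/cvg_lim => //.
rewrite (_ : series _ = (fun n => a * series (fun j => A i j * u j) n + b * series (fun j => A i j * v j) n)); last first.
  apply/funext => n; rewrite /series /= !mulr_sumr -big_split /=.
  by apply: eq_bigr => k _; ring.
by apply: cvgD; apply: cvgMr; [exact: cu|exact: cv].
Qed.

Lemma matapplyE A x i : matapply A x i =
  Complex (vapp A (fun j => complex.Re (x j)) i) (vapp A (fun j => complex.Im (x j)) i).
Proof. by []. Qed.

Lemma matapply_rc A u : matapply A (rc u) = rc (vapp A u).
Proof.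
apply/funext => i; rewrite matapplyE /rc; congr Complex; rewrite /vapp /=.
under eq_fun do rewrite mulr0.
by rewrite (@limn_series_single _ _ 0%N).
Qed.

Lemma matapply_add A M x y : bnd A M -> L x -> L y ->
  matapply A (fun i => x i + y i) = (fun i => matapply A x i + matapply A y i).
Proof.
move=> bA Lx Ly; apply/funext => i; rewrite !matapplyE.
have [Lax _] := absq_L Lx; have [Lay _] := absq_L Ly.
have [Lw _] := rc_add Lax Lay.
(* [F] stands for the real or the imaginary part. *)
have h (F : C -> R) (hF : forall z, `|F z| <= cabs z) (FD : forall z w, F (z + w) = F z + F w) :
    vapp A (fun j => F (x j + y j)) i = vapp A (fun j => F (x j)) i + vapp A (fun j => F (y j)) i.
  have -> : (fun j => F (x j + y j)) = (fun j => 1 * F (x j) + 1 * F (y j)).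
    by apply/funext => j; rewrite FD !mul1r.
  rewrite (vapp_lin 1 1 i bA Lw) ?mul1r// => j.
    by rewrite (le_trans (hF _))// lerDl cabs_ge0.
  by rewrite (le_trans (hF _))// lerDr cabs_ge0.
rewrite (h (@complex.Re R)); [|exact: cabs_Re|by case=> a b [c d]].
rewrite (h (@complex.Im R)); [|exact: cabs_Im|by case=> a b [c d]].
by [].
Qed.

Lemma matapply_scale A M c x : bnd A M -> L x ->
  matapply A (fun i => c * x i) = (fun i => c * matapply A x i).
Proof.
move=> bA Lx; apply/funext => i; rewrite !matapplyE.
have [Lw _] := absq_L Lx; case: c => a b.
have hR j : `|complex.Re (x j)| <= absq x j by exact: cabs_Re.
have hI j : `|complex.Im (x j)| <= absq x j by exact: cabs_Im.
have -> : (fun j => complex.Re (Complex a b * x j)) =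
    (fun j => a * complex.Re (x j) + (- b) * complex.Im (x j)).
  by apply/funext => j; case: (x j) => p q /=; rewrite mulNr.
have -> : (fun j => complex.Im (Complex a b * x j)) =
    (fun j => a * complex.Im (x j) + b * complex.Re (x j)).
  by apply/funext => j; case: (x j) => p q /=; rewrite (mulrC b).
rewrite (vapp_lin a (- b) i bA Lw hR hI) (vapp_lin a b i bA Lw hI hR).
by rewrite mulNr; apply/eqP; rewrite eq_complex /= eqxx /= (mulrC b).
Qed.

Lemma matapply_sub A M x y : bnd A M -> L x -> L y ->
  matapply A (fun i => x i - y i) = (fun i => matapply A x i - matapply A y i).
Proof.
move=> bA Lx Ly; have e (z : cseq R) : (fun i => - z i) = (fun i => (-1 : C) * z i).
  by apply/funext => i; rewrite mulN1r.
rewrite (matapply_add bA Lx (L_opp Ly)) (e y) (matapply_scale _ bA Ly).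
by apply/funext => i; rewrite mulN1r.
Qed.

Lemma matapply_sum A M n (f : nat -> cseq R) : bnd A M -> (forall k, (k < n)%N -> L (f k)) ->
  matapply A (fun i => \sum_(0 <= k < n) f k i) =
  (fun i => \sum_(0 <= k < n) matapply A (f k) i).
Proof.
move=> bA; elim: n => [_|n IH Lf].
  have -> : (fun i => \sum_(0 <= k < 0) f k i) = (fun i => 0 * @seq_zero R i).
    by apply/funext => i; rewrite big_nil mul0r.
  rewrite (matapply_scale _ bA (L_zero X)).
  by apply/funext => i; rewrite big_nil mul0r.
have Lf' k : (k < n)%N -> L (f k) by move=> kn; apply: Lf; exact: ltnW.
have -> : (fun i => \sum_(0 <= k < n.+1) f k i) =
    (fun i => (fun i => \sum_(0 <= k < n) f k i) i + f n i).
  by apply/funext => i; rewrite big_nat_recr.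
have [Ls _] := L_sum Lf'.
rewrite (matapply_add bA Ls (Lf n (ltnSn n))) (IH Lf').
by apply/funext => i; rewrite big_nat_recr.
Qed.

(** Real and imaginary parts of the image are separate limits, so the bound passes to the limit
    through the sum of their squares; the triangle inequality bounds each partial sum. *)
Lemma matapply_dom A M x i c : bnd A M -> L x ->
  (forall n, \sum_(0 <= j < n) A i j * cabs (x j) <= c) -> cabs (matapply A x i) <= c.
Proof.
move=> bA Lx h; have c0 : 0 <= c by have := h 0%N; rewrite big_nil.
have [Lw _] := absq_L Lx.
have cR := @vapp_cvg_norm A M (fun j => complex.Re (x j)) (absq x) i bA Lw (fun j => cabs_Re _).
have cI := @vapp_cvg_norm A M (fun j => complex.Im (x j)) (absq x) i bA Lw (fun j => cabs_Im _).
apply: cabs_le => //; rewrite matapplyE /=.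
have cv : (fun n => series (fun j => A i j * complex.Re (x j)) n ^+ 2 +
     series (fun j => A i j * complex.Im (x j)) n ^+ 2) @ \oo -->
     vapp A (fun j => complex.Re (x j)) i ^+ 2 + vapp A (fun j => complex.Im (x j)) i ^+ 2.
  by rewrite !expr2; apply: cvgD; apply: cvgM; [exact: cR|exact: cR|exact: cI|exact: cI].
rewrite -(cvg_lim _ cv)//; apply: limr_le; first by apply/cvg_ex; eexists; exact: cv.
near=> n; pose p := \sum_(0 <= j < n) (A i j)%:C * x j.
have -> : series (fun j => A i j * complex.Re (x j)) n = complex.Re p.
  rewrite /series /p /=; elim: (n) => [|k IH]; first by rewrite !big_nil.
  by rewrite !big_nat_recr //= {}IH; case: (\sum_(_ <= _ < k) _) (x k) => a b [c' d] /=; ring.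
have -> : series (fun j => A i j * complex.Im (x j)) n = complex.Im p.
  rewrite /series /p /=; elim: (n) => [|k IH]; first by rewrite !big_nil.
  by rewrite !big_nat_recr //= {}IH; case: (\sum_(_ <= _ < k) _) (x k) => a b [c' d] /=; ring.
rewrite -cabs_sqr ler_sqr ?nnegrE ?cabs_ge0//.
apply: (le_trans (cabs_sum _ _ _)); apply: le_trans (h n).
by apply: ler_sum => j _; rewrite cabsM cabs_ge0R// (bnd_ge0 _ _ bA).
Unshelve. all: by end_near. Qed.

Lemma matapply_L A M x : bnd A M -> L x ->
  L (matapply A x) /\ nrm (matapply A x) <= M * nrm x.
Proof.
move=> bA Lx; have [La na] := absq_L Lx.
have [y [Ly [y0 [ny hy]]]] := bnd_apply bA (absq_ge0 x) La.
have [||L1 n1] := @L_solid _ X (matapply A x) (rc y) _ Ly.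
- move=> i iR; rewrite matapplyE /vapp; under eq_fun do rewrite (bnd_supp bA) ?iR// mul0r.
  under [X in Complex _ (limn (series X))]eq_fun do rewrite (bnd_supp bA) ?iR// mul0r.
  by rewrite (@limn_series_single _ _ 0%N).
- move=> i; rewrite /rc cabs_ge0R//; exact: (matapply_dom bA Lx (hy i)).
by split=> //; apply: (le_trans n1); rewrite -na.
Qed.

Lemma ctail_matapply A n x : ctail n (matapply A x) = matapply (mtail n A) x.
Proof.
apply/funext => i; rewrite /ctail /mtail !matapplyE /vapp; case: ifP => // _.
under eq_fun do rewrite mul0r; under [X in Complex _ (limn (series X))]eq_fun do rewrite mul0r.
by rewrite (@limn_series_single _ _ 0%N).
Qed.

Lemma nrm_ctail_matapply A n (e : R) x : bnd (mtail n A) e -> L x ->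
  nrm (ctail n (matapply A x)) <= e * nrm x.
Proof. by move=> be Lx; rewrite ctail_matapply; case: (matapply_L be Lx). Qed.

(** With [q] = |x|, [p] = |x| + Re x and [r] = |x| + Im x all three are nonnegative and at most
    2|x|. Identities that are linear in [x] thus reduce to nonnegative real vectors. *)
Lemma pos_decomp x : L x -> exists p q r : nat -> R,
  [/\ forall i, 0 <= p i, forall i, 0 <= q i & forall i, 0 <= r i] /\
  [/\ L (rc p), L (rc q) & L (rc r)] /\
  x = fun i => rc p i - rc q i + 'i%C * (rc r i - rc q i).
Proof.
move=> Lx; have [La _] := absq_L Lx; have [L2 _] := rc_add La La.
have aux (u : nat -> R) : (forall i, `|u i| <= absq x i) ->
    (forall i, 0 <= absq x i + u i) /\ L (rc (fun i => absq x i + u i)).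
  move=> h; have h0 i : 0 <= absq x i + u i.
    by rewrite -lerBlDl sub0r; have := h i; rewrite ler_norml => /andP[].
  split=> //; apply: (proj1 (rc_mono h0 _ L2)) => i; rewrite lerD2l.
  by have := h i; rewrite ler_norml => /andP[].
have [p0 Lp] := aux (fun i => complex.Re (x i)) (fun i => cabs_Re _).
have [r0 Lr] := aux (fun i => complex.Im (x i)) (fun i => cabs_Im _).
exists (fun i => absq x i + complex.Re (x i)), (absq x), (fun i => absq x i + complex.Im (x i)).
split; first by split=> // i; exact: absq_ge0.
split=> //; apply/funext => i; rewrite {1}[x i]complexE /rc !rmorphD /=.
by rewrite ![_ + _ - (absq x i)%:C]addrAC !subrr !add0r.
Qed.

Lemma matapply_mul A B M N x : bnd A M -> bnd B N -> L x ->
  matapply (matmul A B) x = matapply A (matapply B x).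
Proof.
move=> bA bB Lx; have bAB := bnd_mul bA bB.
have [p [q [r [[p0 q0 r0] [[Lp Lq Lr] ->]]]]] := pos_decomp Lx.
have E D K : bnd D K -> forall p q r, L p -> L q -> L r ->
    matapply D (fun i => p i - q i + 'i%C * (r i - q i)) =
    (fun i => matapply D p i - matapply D q i + 'i%C * (matapply D r i - matapply D q i)).
  move=> bD f g h Lf Lg Lh.
  rewrite (matapply_add bD (L_sub Lf Lg) (L_scale _ (L_sub Lh Lg))).
  by rewrite (matapply_scale _ bD (L_sub Lh Lg)) !(matapply_sub bD).
rewrite (E _ _ bAB)// (E _ _ bB)// (E _ _ bA) ; try by apply: (proj1 (matapply_L bB _)).
by rewrite !matapply_rc !(vapp_mul bA bB).
Qed.

End OperatorAction.

(** * The Hausdorff measure of noncompactness equals [gam] *)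

Section HausdorffMeasure.
Variables (R : realType) (X : lspace R).
Local Notation C := R[i].
Local Notation L := (carrier X).
Local Notation nrm := (lnorm X).
Local Notation bnd := (bnd X).
Implicit Types (A B : mat R) (x y : cseq R).

Lemma real_net (K d : R) : 0 < d ->
  exists s : seq R, forall x : R, `|x| <= K -> exists2 y, y \in s & `|x - y| <= d.
Proof.
move=> d0; pose N := Num.truncn (2 * K / d).
exists (mkseq (fun k => - K + d * k%:R) N.+1) => x; rewrite ler_norml => /andP[x1 x2].
pose k := Num.truncn ((x + K) / d).
have xK : 0 <= (x + K) / d by rewrite divr_ge0 ?(ltW d0)// -lerBlDr sub0r.
have /andP[k1 k2] := truncn_itv xK.
exists (- K + d * k%:R).
  apply/mapP; exists k => //; rewrite mem_iota /= add0n ltnS.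
  apply: le_truncn; rewrite ler_pM2r ?invr_gt0//; lra.
move: k1 k2; rewrite ler_pdivlMr// ltr_pdivrMr// -natr1 => k1 k2.
rewrite ger0_norm; lra.
Qed.

Lemma complex_net (K d : R) : 0 < d ->
  exists s : seq C, forall z, cabs z <= K -> exists2 w, w \in s & cabs (z - w) <= d.
Proof.
move=> d0; have d2 : 0 < d / 2 by rewrite divr_gt0.
have [s hs] := real_net K d2.
exists [seq Complex a b | a <- s, b <- s] => z zK.
have [a aS ha] := hs (complex.Re z) (le_trans (cabs_Re z) zK).
have [b bS hb] := hs (complex.Im z) (le_trans (cabs_Im z) zK).
exists (Complex a b); first by apply/allpairsP; exists (a, b).
apply: (le_trans (cabs_ReIm _)); case: z ha hb {zK} => p q /= ha hb.
by rewrite [leRHS](splitr d) lerD.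
Qed.

(** Heads with bounded entries form a totally bounded set: each new coordinate costs [d / 2], since
    the unit vector has norm 1, and a coordinate outside the index set is 0. *)
Lemma head_net n (K d : R) : 0 < d ->
  exists s : seq (cseq R), (forall c, c \in s -> L c) /\
    forall x, L x -> (forall i, cabs (x i) <= K) ->
      exists2 c, c \in s & nrm (fun i => chead n x i - c i) <= d.
Proof.
elim: n d => [|n IH] d d0.
  exists [:: @seq_zero R]; split; first by move=> c; rewrite inE => /eqP ->; exact: L_zero.
  move=> x Lx _; exists (@seq_zero R); first exact: mem_head.
  have -> : (fun i => chead 0 x i - @seq_zero R i) = @seq_zero R.
    by apply/funext => i; rewrite /chead /= subr0.
  by rewrite nrm0 ltW.
have d2 : 0 < d / 2 by rewrite divr_gt0.
have [s [Ls hs]] := IH (d / 2) d2; have [t ht] := complex_net K d2.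
case: (boolP (inR (idx X) n)) => nR; last first.
  exists s; split=> // x Lx xK; have [c cS hc] := hs x Lx xK; exists c => //.
  have -> : chead n.+1 x = chead n x.
    apply/funext => i; rewrite /chead; case: ltngtP => // <-.
    by rewrite (L_supp Lx nR).
  by apply: (le_trans hc); rewrite ler_pdivrMr// ler_peMr ?(ltW d0)// ler1n.
exists [seq (fun i => c i + z * @unit_vec R n i) | c <- s, z <- t]; split.
  move=> c' /allpairsP[[c z] /= [cS zS ->]].
  by apply: L_add; [exact: Ls|apply: L_scale; exact: L_unit].
move=> x Lx xK; have [c cS hc] := hs x Lx xK; have [z zT hz] := ht (x n) (xK n).
exists (fun i => c i + z * @unit_vec R n i); first by apply/allpairsP; exists (c, z).
have Lc := Ls c cS; have Lu := L_unit nR; have [Lh _] := L_head n Lx.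
have -> : (fun i => chead n.+1 x i - (c i + z * @unit_vec R n i)) =
    (fun i => (chead n x i - c i) + (x n - z) * @unit_vec R n i).
  apply/funext => i; rewrite /chead /unit_vec; case: (ltngtP n i) => [ni|ni|<-].
  - by rewrite !mulr0 !addr0.
  - by rewrite !mulr0 !addr0.
  - by ring.
apply: (le_trans (nrm_add (L_sub Lh Lc) (L_scale _ Lu))).
by rewrite nrm_scale// nrm_unit// mulr1 [leRHS](splitr d) lerD.
Qed.

(** By homogeneity; the zero vector, which cannot be normalized, is treated apart. *)
Lemma bnd_of_ball A M n (f : R) : bnd A M -> 0 <= f ->
  (forall v : nat -> R, (forall i, 0 <= v i) -> L (rc v) -> nrm (rc v) <= 1 ->
     nrm (ctail n (matapply A (rc v))) <= f) ->
  bnd (mtail n A) f.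
Proof.
move=> bA f0 h; split; first by case: (bnd_mtail n bA).
split=> // x x0 Lx.
pose r := nrm (rc x); have r0 : 0 <= r by exact: nrm_ge0.
have := r0; rewrite le_eqVlt => /predU1P[r00|rp].
  have xz : x = fun _ => 0.
    apply/funext => i; have /(congr1 (fun f => f i)) := nrm_eq0 Lx (esym r00).
    by rewrite /rc /seq_zero => -[].
  exists x; split=> //; rewrite -/r -r00 mulr0; split=> // i k.
  by rewrite xz big1// => j _; rewrite mulr0.
pose v i := r^-1 * x i; have ri : 0 <= r^-1 by rewrite invr_ge0.
have [Lv nv] := rc_scale ri Lx; rewrite -/v -/r mulVf ?gt_eqF// in Lv nv.
have v0 i : 0 <= v i by rewrite mulr_ge0.
have nt : nrm (ctail n (matapply A (rc v))) <= f by apply: h => //; rewrite nv.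
have [LA _] := matapply_L bA Lv; have [Lt _] := L_tail n LA.
pose w i := if (n <= i)%N then vapp A v i else 0.
have ew : rc w = ctail n (matapply A (rc v)).
  by apply/funext => i; rewrite matapply_rc /rc /ctail /w; case: ifP.
have [L1 n1] := @rc_scale _ X r w r0 (eq_ind_r L Lt ew).
exists (fun i => r * w i); split=> //; split.
  by rewrite n1 ew mulrC ler_wpM2r.
move=> i p; rewrite /w /mtail; case: ifP => ni; last first.
  by rewrite mulr0 big1// => j _; rewrite mul0r.
have xv j : x j = r * v j by rewrite /v mulrA mulfV ?mul1r// gt_eqF.
under eq_bigr do rewrite xv mulrCA.
by rewrite -mulr_sumr ler_wpM2l//; exact: vapp_ge bA v0 Lv.
Qed.

(* Finite-rank heads are compact, and finitely many centers have uniformly small tails. *)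
Lemma gamma_op_gam A M : bnd A M -> gamma_op L nrm A = gam X A.
Proof.
move=> bA; have M0 := bnd_M0 bA.
rewrite /gamma_op /hausdorff_mnc.
set S := [set e : R | _].
have Sin n e d : bnd (mtail n A) e -> 0 < d -> S (e + d).
  move=> be d0; split; first by rewrite ltr_wpDl// (bnd_M0 be).
  have [s [Ls hs]] := head_net n M d0.
  exists s; split; first by move=> k kS; apply: Ls; exact: mem_nth.
  move=> _ [x [Lx x1] <-]; have [LA nA] := matapply_L bA Lx.
  have [|c cS hc] := hs (matapply A x) LA.
    move=> i; apply: (le_trans (cabs_le_nrm i LA)); apply: (le_trans nA).
    by rewrite ler_piMr.
  exists (index c s); rewrite index_mem nth_index//; split=> //.
  have Lc := Ls c cS; have [Lh _] := L_head n LA; have [Lt _] := L_tail n LA.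
  have -> : (fun i => matapply A x i - c i) =
      (fun i => ctail n (matapply A x) i + (chead n (matapply A x) i - c i)).
    by apply/funext => i; rewrite {1}[matapply A x i](chead_tail n); ring.
  apply: (le_trans (nrm_add Lt (L_sub Lh Lc))); rewrite lerD//.
  apply: (le_trans (nrm_ctail_matapply be Lx)).
  by rewrite ler_piMr// (bnd_M0 be).
have S0 : has_lbound S by exists 0 => e [/ltW].
apply/eqP; rewrite eq_le; apply/andP; split.
  apply/ler_addgt0Pr => d d0.
  have d2 : 0 < d / 2 by rewrite divr_gt0.
  have [|n bn] := gam_lt bA (e := gam X A + d / 2); first by rewrite ltrDl.
  by rewrite [in leRHS](splitr d) addrA; apply: ge_inf => //; exact: Sin bn d2.
apply: lb_le_inf; first by exists (M + 1); apply: (Sin 0%N).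
move=> e [e0 [s [Ls hs]]]; apply/ler_addgt0Pr => d d0.
have [n hn] := nrm_tail_small_fin Ls d0.
apply: (@gam_le _ _ _ n); apply: (bnd_of_ball bA) => [|v v0 Lv nv].
  by rewrite addr_ge0 ?ltW.
have [|k [ks hk]] := hs (matapply A (rc v)); first by exists (rc v).
have [LA _] := matapply_L bA Lv; have [Lt _] := L_tail n LA.
have Lk := Ls k ks; have [Ltk _] := L_tail n Lk.
apply: (le_trans (nrm_le_sub Lt Ltk)); rewrite addrC lerD ?(ltW (hn k n ks (leqnn n)))//.
have -> : (fun i => ctail n (matapply A (rc v)) i - ctail n (nth (@seq_zero R) s k) i) =
    ctail n (fun i => matapply A (rc v) i - nth (@seq_zero R) s k i).
  by apply/funext => i; rewrite /ctail; case: ifP; rewrite ?subr0.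
by apply: le_trans hk; case: (L_tail n (L_sub LA Lk)).
Qed.

End HausdorffMeasure.

(** * Bounded sets of matrices: products, domination, Hadamard means *)

Section MatrixSets.
Variables (R : realType) (X : lspace R).
Local Notation bnd := (bnd X).
Local Notation gam := (gam X).
Implicit Types (A B : mat R) (S T U : set (mat R)).

Definition bset S : Prop := exists M : R, 0 < M /\ forall A, S A -> bnd A M.

Lemma bset_sub S T : S `<=` T -> bset T -> bset S.
Proof. by move=> ST [M [M0 hM]]; exists M; split=> // A /ST /hM. Qed.

Lemma bset1 A M : bnd A M -> bset [set A].
Proof.
move=> bA; exists (M + 1); split; first by rewrite ltr_wpDl// (bnd_M0 bA).
by move=> _ ->; apply: bnd_weak bA; rewrite lerDl.
Qed.

Lemma bset_setmul S T : bset S -> bset T -> bset (setmul S T).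
Proof.
move=> [M [M0 hM]] [N [N0 hN]]; exists (M * N); split; first exact: mulr_gt0.
by move=> _ [A [B [SA [TB ->]]]]; apply: bnd_mul; [exact: hM|exact: hN].
Qed.

Lemma setmulA S T U : bset S -> bset T -> bset U ->
  setmul (setmul S T) U = setmul S (setmul T U).
Proof.
move=> [M [M0 hM]] [N [N0 hN]] [P [P0 hP]]; apply/seteqP; split=> D.
  move=> [_ [C [[A [B [SA [TB ->]]]] [UC ->]]]]; exists A, (matmul B C); split=> //.
  by split; [exists B, C|rewrite (matmulA (hM A SA) (hN B TB) (hP C UC))].
move=> [A [_ [SA [[B [C [TB [UC ->]]]] ->]]]]; exists (matmul A B), C.
by split; [exists A, B|split=> //; rewrite (matmulA (hM A SA) (hN B TB) (hP C UC))].
Qed.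

Lemma setmul1s S : bset S -> setmul [set idm X] S = S.
Proof.
move=> [M [M0 hM]]; apply/seteqP; split=> D.
  by move=> [_ [B [-> [SB ->]]]]; rewrite (matmul1m (hM B SB)).
by move=> SD; exists (idm X), D; rewrite (matmul1m (hM D SD)).
Qed.

Lemma setmuls1 S : bset S -> setmul S [set idm X] = S.
Proof.
move=> [M [M0 hM]]; apply/seteqP; split=> D.
  by move=> [B [_ [SB [-> ->]]]]; rewrite (matmulm1 (hM B SB)).
by move=> SD; exists D, (idm X); rewrite (matmulm1 (hM D SD)).
Qed.

(** Product of the [k] factors from [F 0] to [F k.-1]. Unlike [setprodn], whose argument is the last
    index, it starts from the identity, so exponents add and a zeroth power exists. *)
Fixpoint wprod (F : nat -> set (mat R)) (k : nat) : set (mat R) :=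
  if k is k'.+1 then setmul (wprod F k') (F k') else [set idm X].

Definition wd S k := wprod (fun=> S) k.

Lemma bset_wprod F n : (forall k, (k < n)%N -> bset (F k)) -> bset (wprod F n).
Proof.
elim: n => [_|n IH h] /=; first exact: bset1 (bnd_idm X).
by apply: bset_setmul; [apply: IH => k kn; apply: h; exact: ltnW|exact: h].
Qed.

Lemma bset_wd S n : bset S -> bset (wd S n).
Proof. by move=> bS; exact: bset_wprod. Qed.

Lemma setprodn_wprod F p : bset (F 0%N) -> setprodn F p = wprod F p.+1.
Proof. by move=> b0; elim: p => [|p IH]; [rewrite /= setmul1s|rewrite /= IH]. Qed.

Lemma setpown_wd S n : bset S -> (0 < n)%N -> setpown S n = wd S n.
Proof. by move=> bS; case: n => // n _; exact: setprodn_wprod. Qed.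

Lemma bset_setprodn F p : (forall k, (k <= p)%N -> bset (F k)) -> bset (setprodn F p).
Proof. by move=> h; rewrite setprodn_wprod; [exact: bset_wprod|exact: h]. Qed.

Lemma bset_setpown S n : bset S -> bset (setpown S n).
Proof. by move=> bS; exact: bset_setprodn. Qed.

Lemma setprodn_ext (F G : nat -> set (mat R)) p : (forall k, (k <= p)%N -> F k = G k) -> setprodn F p = setprodn G p.
Proof.
elim: p => [|p IH] h /=; first exact: h.
by rewrite IH ?h// => k kp; apply: h; exact: leqW.
Qed.

Lemma setprodn_recl F p : (forall k, (k <= p.+1)%N -> bset (F k)) ->
  setprodn F p.+1 = setmul (F 0%N) (setprodn (fun k => F k.+1) p).
Proof.
elim: p => [//|p IH] h.
rewrite [LHS]/= -/(setprodn F p.+1) IH; last by move=> k kp; apply: h; exact: leqW.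
rewrite setmulA//; [exact: h| |exact: h].
by apply: bset_setprodn => k kp; apply: h; rewrite ltnS leqW.
Qed.

Lemma wd0 S : wd S 0 = [set idm X]. Proof. by []. Qed.

Lemma wdS S k : wd S k.+1 = setmul (wd S k) S. Proof. by []. Qed.

Lemma wdD S k l : bset S -> wd S (k + l) = setmul (wd S k) (wd S l).
Proof.
move=> bS; elim: l => [|l IH]; first by rewrite addn0 wd0 setmuls1//; exact: bset_wd.
by rewrite addnS !wdS IH setmulA//; exact: bset_wd.
Qed.

Lemma wdM S n k : bset S -> wd (wd S n) k = wd S (n * k).
Proof.
move=> bS; elim: k => [|k IH]; first by rewrite muln0.
by rewrite wdS IH mulnS addnC wdD.
Qed.

Lemma wd_swap S T k : bset S -> bset T ->
  setmul (wd (setmul S T) k) S = setmul S (wd (setmul T S) k).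
Proof.
move=> bS bT; have bST := bset_setmul bS bT; have bTS := bset_setmul bT bS.
elim: k => [|k IH]; first by rewrite !wd0 setmul1s ?setmuls1.
have b1 := bset_wd k bST; have b2 := bset_wd k bTS.
by rewrite !wdS (setmulA b1)// (setmulA bS bT bS) -(setmulA b1 bS)// IH (setmulA bS b2).
Qed.

(** The relation under which the radii are monotone: inclusion up to entrywise domination, which is
    what Hoelder's inequality yields for products of Hadamard means. *)
Definition dom S T : Prop := forall A, S A -> exists B, T B /\ forall i j, 0 <= A i j <= B i j.

Lemma dom_refl S : bset S -> dom S S.
Proof. by move=> [M [_ hM]] A SA; exists A; split=> // i j; rewrite lexx andbT (bnd_ge0 _ _ (hM A SA)). Qed.

Lemma dom_trans S T U : dom S T -> dom T U -> dom S U.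
Proof.
move=> ST TU A /ST[B [/TU[C [UC BC]] AB]]; exists C; split=> // i j.
by have /andP[-> h] := AB i j; have /andP[_ h'] := BC i j; exact: le_trans h'.
Qed.

Lemma dom_bset S T : dom S T -> bset T -> bset S.
Proof. by move=> ST [M [M0 hM]]; exists M; split=> // A /ST[B [/hM bB AB]]; exact: bnd_le bB. Qed.

Lemma dom_setmul S T S' T' : bset S' -> bset T' -> dom S S' -> dom T T' ->
  dom (setmul S T) (setmul S' T').
Proof.
move=> [M [M0 hM]] [N [N0 hN]] SS TT _ [A [B [/SS[A' [SA hA]] [/TT[B' [TB hB]] ->]]]].
exists (matmul A' B'); split; first by exists A', B'.
exact: matmul_mono hA hB (hM _ SA) (hN _ TB).
Qed.

Lemma dom_wprod F G n : (forall k, (k < n)%N -> bset (G k)) ->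
  (forall k, (k < n)%N -> dom (F k) (G k)) -> dom (wprod F n) (wprod G n).
Proof.
elim: n => [_ _|n IH bG h] /=; first exact: dom_refl (bset1 (bnd_idm X)).
have bG' k : (k < n)%N -> bset (G k) by move=> kn; apply: bG; exact: ltnW.
apply: dom_setmul; [exact: bset_wprod|exact: bG| |exact: h].
by apply: IH => // k kn; apply: h; exact: ltnW.
Qed.

Lemma bset_fun m (F : nat -> set (mat R)) : (forall j, (j < m)%N -> bset (F j)) ->
  exists M : nat -> R, forall j, (j < m)%N -> 0 < M j /\ forall A, F j A -> bnd A (M j).
Proof.
move=> h; have /choice[M hM] : forall j, exists M : R,
    (j < m)%N -> 0 < M /\ forall A, F j A -> bnd A M.
  move=> j; case: (ltnP j m) => [/h[M hM]|]; [by exists M|by exists 0].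
by exists M.
Qed.

(** Turns membership in a nested Hadamard product into the choice of one matrix from each of the [m]
    sets. *)
Lemma hprod_powP (F : nat -> set (mat R)) m t D : (0 < m)%N ->
  hprod_pow F m t D <-> exists B : nat -> mat R, (forall j, (j < m)%N -> F j (B j)) /\ D = hp m t B.
Proof.
case: m => // p _; rewrite /hprod_pow /=.
elim: p D => [|p IH] D.
  split=> [[A [FA ->]]|[B [FB ->]]].
    exists (fun=> A); split; first by case.
    by apply/funext => i; apply/funext => k; rewrite /hp big_ord1.
  exists (B 0%N); split; first exact: FB.
  by apply/funext => i; apply/funext => k; rewrite /hp big_ord1.
split=> [[A [_ [/IH[B [FB ->]] [[A' [FA' ->]] ->]]]]|[B [FB ->]]].
  exists (fun j => if j == p.+1 then A' else B j); split=> [j|].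
    by case: eqVneq => [->//|jp]; rewrite ltnS leq_eqVlt (negbTE jp)/= => /FB.
  apply/funext => i; apply/funext => k; rewrite /hp /hmul [in RHS]big_ord_recr /= eqxx.
  by congr (_ * _); apply: eq_bigr => j _; rewrite ltn_eqF.
exists (hp p.+1 t B), (hpow (B p.+1) t); split.
  by apply/IH; exists B; split=> // j jp; apply: FB; exact: ltnW.
split; first by exists (B p.+1); split=> //; exact: FB.
by apply/funext => i; apply/funext => k; rewrite /hp /hmul /hpow big_ord_recr.
Qed.

Lemma bset_hprod_pow F m t : (0 < m)%N -> m%:R^-1 <= t ->
  (forall j, (j < m)%N -> bset (F j)) -> bset (hprod_pow F m t).
Proof.
move=> m0 mt /bset_fun[M hM]; exists (\prod_(j < m) powR (M j) t); split.
  by apply: prodr_gt0 => j _; rewrite powR_gt0//; case: (hM j (ltn_ord j)).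
move=> D /hprod_powP -/(_ m0)[B [FB ->]]; apply: bnd_hp => // j jm.
by case: (hM j jm) => ? h; split=> //; exact: h (FB j jm).
Qed.

Lemma dom_setmul_hprod F G m t : (0 < m)%N -> m%:R^-1 <= t ->
  (forall j, (j < m)%N -> bset (F j)) -> (forall j, (j < m)%N -> bset (G j)) ->
  dom (setmul (hprod_pow F m t) (hprod_pow G m t))
      (hprod_pow (fun j => setmul (F j) (G j)) m t).
Proof.
move=> m0 mt /bset_fun[M hM] /bset_fun[N hN].
move=> _ [_ [_ [/hprod_powP -/(_ m0)[A [FA ->]] [/hprod_powP -/(_ m0)[B [GB ->]] ->]]]].
exists (hp m t (fun j => matmul (A j) (B j))); split.
  apply/hprod_powP => //; exists (fun j => matmul (A j) (B j)); split=> // j jm.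
  by exists (A j), (B j); split; [exact: FA|split=> //; exact: GB].
apply: (matmul_hp (M := M) (N := N)) => // j jm.
  by case: (hM j jm) => ? h; split=> //; exact: h (FA j jm).
by case: (hN j jm) => ? h; split=> //; exact: h (GB j jm).
Qed.

(** In [F k j] the index [k] numbers the factors of the matrix product and [j] the slots of the
    Hadamard mean; Hoelder's inequality exchanges the two products up to domination. *)
Lemma dom_setprodn_hprod (F : nat -> nat -> set (mat R)) m t p : (0 < m)%N -> m%:R^-1 <= t ->
  (forall k j, (k <= p)%N -> (j < m)%N -> bset (F k j)) ->
  dom (setprodn (fun k => hprod_pow (F k) m t) p)
      (hprod_pow (fun j => setprodn (fun k => F k j) p) m t).
Proof.
move=> m0 mt; elim: p => [|p IH] bF.
  by apply: dom_refl; apply: bset_hprod_pow => // j jm; exact: bF.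
have bF' k j : (k <= p)%N -> (j < m)%N -> bset (F k j) by move=> kp; apply: bF; exact: leqW.
have b1 j : (j < m)%N -> bset (setprodn (fun k => F k j) p).
  by move=> jm; apply: bset_setprodn => k kp; exact: bF'.
have b2 j : (j < m)%N -> bset (F p.+1 j) by move=> jm; exact: bF.
apply: dom_trans (dom_setmul_hprod m0 mt b1 b2).
apply: dom_setmul; [exact: bset_hprod_pow|exact: bset_hprod_pow|exact: IH|].
by apply: dom_refl; exact: bset_hprod_pow.
Qed.

Lemma dom_setpown_hprod F m t n : (0 < m)%N -> m%:R^-1 <= t ->
  (forall j, (j < m)%N -> bset (F j)) ->
  dom (setpown (hprod_pow F m t) n) (hprod_pow (fun j => setpown (F j) n) m t).
Proof. by move=> m0 mt bF; apply: (@dom_setprodn_hprod (fun=> F)) => // k j _; exact: bF. Qed.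

End MatrixSets.

(** * Growth rates of [gam] on products *)

Section Rates.
Variables (R : realType) (X : lspace R).
Local Notation L := (carrier X).
Local Notation nrm := (lnorm X).
Local Notation bnd := (bnd X).
Local Notation gam := (gam X).
Local Notation wd := (wd X).
Local Notation bset := (bset X).
Implicit Types (A B : mat R) (S T : set (mat R)).

(** The constant absorbs short products, and a bound without k-th roots involves no supremum over a
    possibly empty set. *)
Definition rate S (e : R) : Prop :=
  0 < e /\ exists C : R, 0 < C /\ forall k A, wd S k A -> gam A <= C * e ^+ k.

(** For bounded sets this is [rho_hat_ess_set], by [rho_hat_rh]; on a singleton it is [rho_ess], by
    [rho_ess_rh]. *)
Definition rh S : R := inf [set e | rate S e].

Lemma wd_bnd S M k A : (forall A, S A -> bnd A M) -> wd S k A -> bnd A (M ^+ k).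
Proof.
move=> h; elim: k A => [|k IH] A; first by move=> ->; exact: bnd_idm.
by move=> [B [D [/IH bB [/h bD ->]]]]; rewrite exprSr; exact: bnd_mul.
Qed.

Lemma rate_bnd S M : 0 < M -> (forall A, S A -> bnd A M) -> rate S M.
Proof.
move=> M0 h; split=> //; exists 1; split=> // k A /(wd_bnd h) bA.
by rewrite mul1r; exact: gam_le_bnd bA.
Qed.

Lemma rate_mono S e f : e <= f -> rate S e -> rate S f.
Proof.
move=> ef [e0 [C [C0 h]]]; split; first exact: lt_le_trans ef.
exists C; split=> // k A /h hA; apply: (le_trans hA); rewrite ler_pM2l//.
by apply: lerXn2r; rewrite ?nnegrE ?(ltW e0)// (le_trans (ltW e0)).
Qed.

(* Fekete: submultiplicativity turns a bound at one exponent into a bound at all exponents. *)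
Lemma rate_one S n e : bset S -> (0 < n)%N -> 0 < e ->
  (forall A, wd S n A -> gam A <= e ^+ n) -> rate S e.
Proof.
move=> bS n0 e0 h; have [M [M0 hM]] := bS; split=> //.
(* As [D] is at least 1 and at least [M / e], a leftover product of fewer than [n] factors has [gam]
   at most [D ^+ n * e ^+ (k %% n)]. *)
pose D := Num.max 1 (M / e); have D1 : 1 <= D by rewrite le_max lexx.
exists (D ^+ n); split; first by rewrite exprn_gt0// (lt_le_trans ltr01).
move=> k A; rewrite {1}(divn_eq k n) mulnC wdD// => -[A1 [A2 [w1 [w2 ->]]]].
have b1 := wd_bnd hM w1; have b2 := wd_bnd hM w2.
have g1 : gam A1 <= e ^+ (n * (k %/ n)).
  rewrite -wdM// in w1; move: (k %/ n)%N A1 w1 {b1} => q.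
  elim: q => [|q IH] A1; first by move=> ->; rewrite muln0 expr0; exact: gam_le_bnd (bnd_idm X).
  move=> [B1 [B2 [v1 [v2 ->]]]].
  have [P [P0 hP]] := bset_wd n bS.
  have c1 := wd_bnd hP v1; have c2 := hP _ v2.
  apply: (le_trans (gam_mul c1 c2)); rewrite mulnS addnC exprD.
  by apply: ler_pM; [exact: gam_ge0 c1|exact: gam_ge0 c2|exact: IH|exact: h].
have g2 : gam A2 <= D ^+ n * e ^+ (k %% n).
  apply: (le_trans (gam_le_bnd b2)).
  have -> : M = M / e * e by rewrite divfK// gt_eqF.
  rewrite exprMn ler_wpM2r ?exprn_ge0 ?(ltW e0)//.
  apply: (@le_trans _ _ (D ^+ (k %% n))).
    apply: lerXn2r; rewrite ?nnegrE ?(le_trans ler01 D1)//.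
      by rewrite divr_ge0 ?ltW.
    by rewrite /D le_max lexx orbT.
  by apply: ler_weXn2l => //; apply: ltnW; rewrite ltn_mod.
apply: (le_trans (gam_mul b1 b2)).
rewrite [X in e ^+ X](divn_eq k n) exprD [(k %/ n * n)%N]mulnC mulrCA.
by apply: ler_pM => //; [exact: gam_ge0 b1|exact: gam_ge0 b2].
Qed.

Lemma rate_has_inf S : bset S -> has_inf [set e | rate S e].
Proof.
move=> [M [M0 hM]]; split; first by exists M; exact: rate_bnd.
by exists 0 => e [/ltW].
Qed.

Lemma rh_le S e : rate S e -> rh S <= e.
Proof. by move=> h; apply: ge_inf => //; exists 0 => f [/ltW]. Qed.

Lemma rh_ge0 S : bset S -> 0 <= rh S.
Proof. by move=> /rate_has_inf[h _]; apply: lb_le_inf => // e [/ltW]. Qed.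

Lemma rh_lt S e : bset S -> rh S < e -> rate S e.
Proof.
move=> bS; rewrite -subr_gt0 => h.
have [f rf fe] := inf_adherent h (rate_has_inf bS).
by apply: rate_mono rf; apply: ltW; rewrite addrC subrK in fe.
Qed.

Lemma rh_le_one S n c : bset S -> (0 < n)%N -> 0 <= c ->
  (forall A, wd S n A -> gam A <= c ^+ n) -> rh S <= c.
Proof.
move=> bS n0 c0 h; apply/ler_addgt0Pr => d d0; apply: rh_le.
have cd : 0 < c + d by rewrite ltr_wpDl.
apply: (rate_one bS n0 cd) => A /h hA; apply: (le_trans hA).
by apply: lerXn2r; rewrite ?nnegrE ?(ltW cd)// lerDl ltW.
Qed.

Lemma powR_inv_exprn (s : R) n : 0 <= s -> (0 < n)%N -> powR s (n%:R^-1) ^+ n = s.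
Proof.
by move=> s0 n0; rewrite -powR_mulrn ?powR_ge0// -powRrM mulVf ?powRr1// pnatr_eq0 -lt0n.
Qed.

Lemma exprn_powR_inv (s : R) n : 0 <= s -> (0 < n)%N -> powR (s ^+ n) (n%:R^-1) = s.
Proof.
by move=> s0 n0; rewrite -powR_mulrn// -powRrM mulfV ?powRr1// pnatr_eq0 -lt0n.
Qed.

Lemma powR_inv_cvg1 (c : R) : 0 < c -> (fun n : nat => powR c (n.+1%:R^-1)) @ \oo --> (1 : R).
Proof.
move=> c0; have -> : (fun n : nat => powR c (n.+1%:R^-1)) = (fun n : nat => expR (n.+1%:R^-1 * ln c)).
  by apply/funext => n; rewrite /powR gt_eqF.
rewrite -[X in _ --> X](@expR0 R); apply: continuous_cvg; first exact: continuous_expR.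
rewrite -[X in _ --> X](mul0r (ln c)); apply: cvgMl; exact: cvg_harmonic.
Qed.

(** Every term of the sequence is at least [rh S] by [rh_le_one]. A rate [f] above [rh S] with
    constant [C] bounds the terms by [f] times a root of [C] that tends to 1. The supremum over an
    empty set of products is 0. *)
Lemma rho_hat_rh S : bset S -> rho_hat_ess_set L nrm S = rh S.
Proof.
move=> bS; have [M [M0 hM]] := bS.
have sE k : [set gamma_op L nrm A | A in setpown S k.+1] = [set gam A | A in wd S k.+1].
  rewrite (setpown_wd bS)//; apply/seteqP; split=> _ [A wA <-]; exists A => //;
  by rewrite (gamma_op_gam (wd_bnd hM wA)).
rewrite /rho_hat_ess_set; under eq_fun do rewrite sE.
set s := fun k => sup [set gam A | A in wd S k.+1].
have hub k : has_ubound [set gam A | A in wd S k.+1].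
  by exists (M ^+ k.+1) => _ [A wA <-]; exact: gam_le_bnd (wd_bnd hM wA).
have s0 k : 0 <= s k.
  have [w0|/set0P[A wA]] := eqVneq (wd S k.+1) set0; first by rewrite /s w0 image_set0 sup0.
  apply: (@le_trans _ _ (gam A)); first exact: gam_ge0 (wd_bnd hM wA).
  by apply: ub_le_sup => //; exists A.
have low k : rh S <= powR (s k) (k.+1%:R^-1).
  apply: (rh_le_one bS (ltn0Sn k)); first exact: powR_ge0.
  by move=> A wA; rewrite powR_inv_exprn//; apply: ub_le_sup => //; exists A.
apply/cvg_lim => //; apply/cvgrPdist_le => e e0.
have e2 : 0 < e / 2 by rewrite divr_gt0.
have hf : rh S < rh S + e / 2 by rewrite ltrDl.
have [f0 [C [C0 hC]]] := rh_lt bS hf; set f := rh S + e / 2 in hf f0 hC.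
have cv : (fun n : nat => powR C (n.+1%:R^-1) * f) @ \oo --> f.
  by rewrite -[X in _ --> X]mul1r; apply: cvgMl; exact: powR_inv_cvg1.
have fe : f < f + e / 2 by rewrite ltrDl.
have nb : \forall n \near \oo, powR C (n.+1%:R^-1) * f <= f + e / 2 by exact: (cvgr_le _ cv).
near=> n.
have up : powR (s n) (n.+1%:R^-1) <= powR C (n.+1%:R^-1) * f.
  have -> : powR C (n.+1%:R^-1) * f = powR (C * f ^+ n.+1) (n.+1%:R^-1).
    by rewrite powRM ?exprn_ge0 ?(ltW C0) ?(ltW f0)// exprn_powR_inv// ltW.
  have Cf : 0 <= C * f ^+ n.+1 by rewrite mulr_ge0 ?exprn_ge0 ?(ltW C0) ?(ltW f0).
  apply: ge0_ler_powR; rewrite ?invr_ge0 ?nnegrE//.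
  have [w0|/set0P[A wA]] := eqVneq (wd S n.+1) set0; first by rewrite /s w0 image_set0 sup0.
  by apply: ge_sup; [exists (gam A), A|move=> _ [B wB <-]; exact: hC].
have h : powR C (n.+1%:R^-1) * f <= f + e / 2 by near: n.
rewrite -/(s n) distrC ger0_norm ?subr_ge0// lerBlDr (le_trans up)// (le_trans h)//.
by rewrite /f -addrA -splitr addrC.
Unshelve. all: by end_near. Qed.

Lemma rh_dom S T : bset T -> dom S T -> rh S <= rh T.
Proof.
move=> bT ST; apply/ler_addgt0Pr => d d0.
have [|e0 [C [C0 hC]]] := @rh_lt T (rh T + d) bT; first by rewrite ltrDl.
apply: rh_le; split=> //; exists C; split=> // k A wA.
have [B [wB AB]] := dom_wprod (fun k _ => bT) (fun k _ => ST) wA.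
have [P [P0 hP]] := bset_wd k bT.
by apply: (le_trans (gam_mono AB (hP _ wB))); exact: hC.
Qed.

(** Powers of [wd S n] are the powers of [S] with exponent divisible by [n]; the other exponents are
    reached by division with remainder, at the cost of a constant. *)
Lemma rh_wd S n : bset S -> (0 < n)%N -> rh (wd S n) = rh S ^+ n.
Proof.
move=> bS n0; have bW := bset_wd n bS; have r0 := rh_ge0 bS; have r1 := rh_ge0 bW.
apply/eqP; rewrite eq_le; apply/andP; split.
  pose a (j : 'I_n) := rh S.
  have := @le_prod_addgt0 R n a (rh (wd S n)); rewrite /a.
  rewrite prodr_const cardT size_enum_ord; apply => d d0.
  rewrite prodr_const cardT size_enum_ord.
  have [|e0 [C [C0 hC]]] := @rh_lt S (rh S + d) bS; first by rewrite ltrDl.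
  apply: rh_le; split; first by rewrite exprn_gt0.
  by exists C; split=> // k A; rewrite wdM// -exprM; exact: hC.
apply/ler_addgt0Pr => d d0; set e := _ + d.
have [|e0 [C [C0 hC]]] := @rh_lt (wd S n) e bW; first by rewrite ltrDl.
pose f := powR e (n%:R^-1).
have f0 : 0 < f by rewrite powR_gt0.
have fe : f ^+ n = e by rewrite powR_inv_exprn// ltW.
rewrite -fe; apply: lerXn2r; rewrite ?nnegrE ?(ltW f0)//.
have [M [M0 hM]] := bS; apply: rh_le; split=> //.
pose D := Num.max 1 (M / f); have D1 : 1 <= D by rewrite le_max lexx.
exists (C * D ^+ n); split; first by rewrite mulr_gt0// exprn_gt0// (lt_le_trans ltr01).
move=> k A; rewrite {1}(divn_eq k n) mulnC wdD// => -[A1 [A2 [w1 [w2 ->]]]].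
have b1 := wd_bnd hM w1; have b2 := wd_bnd hM w2.
rewrite -wdM// in w1; have g1 := hC _ _ w1.
have g2 : gam A2 <= D ^+ n * f ^+ (k %% n).
  apply: (le_trans (gam_le_bnd b2)).
  have -> : M = M / f * f by rewrite divfK// gt_eqF.
  rewrite exprMn ler_wpM2r ?exprn_ge0 ?(ltW f0)//.
  apply: (@le_trans _ _ (D ^+ (k %% n))).
    apply: lerXn2r; rewrite ?nnegrE ?(le_trans ler01 D1)//.
      by rewrite divr_ge0 ?ltW.
    by rewrite /D le_max lexx orbT.
  by apply: ler_weXn2l => //; apply: ltnW; rewrite ltn_mod.
apply: (le_trans (gam_mul b1 b2)).
rewrite [X in f ^+ X](divn_eq k n) exprD [(k %/ n * n)%N]mulnC exprM fe mulrACA.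
by apply: ler_pM => //; [exact: gam_ge0 b1|exact: gam_ge0 b2].
Qed.

(** An element of the [k]-th power of the mean is dominated by the mean of elements of the [k]-th
    powers of the [F j], and [gam_hp] multiplies their rates. *)
Lemma rh_hprod F m t : (0 < m)%N -> m%:R^-1 <= t -> (forall j, (j < m)%N -> bset (F j)) ->
  rh (hprod_pow F m t) <= \prod_(j < m) powR (rh (F j)) t.
Proof.
move=> m0 mt bF; have t0 : 0 < t by rewrite (lt_le_trans _ mt)// invr_gt0 ltr0n.
apply: le_powR_prod_addgt0 => //.
- exact: rh_ge0 (bset_hprod_pow m0 mt bF).
- by move=> j; exact: rh_ge0 (bF j (ltn_ord j)).
move=> d d0.
have rt (j : 'I_m) : rate (F j) (rh (F j) + d) by apply: rh_lt; [exact: bF|rewrite ltrDl].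
have /choice[C hC] : forall j : 'I_m, exists C : R, 0 < C /\
    forall k A, wd (F j) k A -> gam A <= C * (rh (F j) + d) ^+ k.
  by move=> j; case: (rt j) => _ [C hC]; exists C.
have e0 (j : 'I_m) : 0 < rh (F j) + d by case: (rt j).
apply: rh_le; split; first by apply: prodr_gt0 => j _; exact: powR_gt0.
(* The 1 is for [k = 0], where the product is the identity; [setpown] describes positive powers
   only. *)
exists (Num.max 1 (\prod_(j < m) powR (C j) t)); split; first by rewrite lt_max ltr01.
case=> [A ->|k A].
  by rewrite expr0 mulr1 (le_trans (gam_le_bnd (bnd_idm X)))// le_max lexx.
have bH := bset_hprod_pow m0 mt bF.
rewrite -setpown_wd// => /(dom_setpown_hprod m0 mt bF)[_ [/hprod_powP -/(_ m0)[B [FB ->]] AB]].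
have wB (j : 'I_m) : wd (F j) k.+1 (B j) by rewrite -setpown_wd//; [exact: FB|exact: bF].
have /bset_fun[M hM] : forall j, (j < m)%N -> bset (setpown (F j) k.+1).
  by move=> j jm; apply: bset_setpown (bF j jm).
have hB j : (j < m)%N -> 0 < M j /\ bnd (B j) (M j).
  by move=> jm; have [? h] := hM j jm; split=> //; exact: h (FB j jm).
apply: (le_trans (gam_mono AB (bnd_hp m0 mt hB))).
apply: (le_trans (gam_hp m0 mt hB)).
apply: (@le_trans _ _ (\prod_(j < m) powR (C j) t * (\prod_(j < m) powR (rh (F j) + d) t) ^+ k.+1)); last first.
  rewrite ler_wpM2r// ?le_max ?lexx ?orbT//.
  by apply: exprn_ge0; apply: prodr_ge0 => j _; exact: powR_ge0.
rewrite -prodrXl -big_split /=; apply: ler_prod => j _; rewrite powR_ge0 /=.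
have [C0 {}hC] := hC j.
rewrite -powR_mulrn ?powR_ge0// powRAC powR_mulrn ?(ltW (e0 j))//.
rewrite -powRM ?(ltW C0) ?exprn_ge0 ?(ltW (e0 j))//.
apply: ge0_ler_powR; [exact: ltW| | |exact: hC].
  by rewrite nnegrE; case: (hB j (ltn_ord j)) => _ /gam_ge0.
by rewrite nnegrE mulr_ge0 ?exprn_ge0 ?(ltW C0) ?(ltW (e0 j)).
Qed.

(** The power [(S T)^(k+1)] equals [S (T S)^k T]; the outer factors and the missing power of [e] go
    into the constant. *)
Lemma rh_swap S T : bset S -> bset T -> rh (setmul S T) <= rh (setmul T S).
Proof.
move=> bS bT; have bST := bset_setmul bS bT; have bTS := bset_setmul bT bS.
apply/ler_addgt0Pr => d d0; set e := _ + d.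
have [|e0 [C [C0 hC]]] := @rh_lt (setmul T S) e bTS; first by rewrite ltrDl.
have [M [M0 hM]] := bS; have [N [N0 hN]] := bT.
apply: rh_le; split=> //; exists (Num.max 1 (M * C * N / e)); split; first by rewrite lt_max ltr01.
case=> [A ->|k A].
  by rewrite expr0 mulr1 (le_trans (gam_le_bnd (bnd_idm X)))// le_max lexx.
rewrite wdS -(setmulA (bset_wd k bST) bS bT) wd_swap//.
move=> [_ [B [[D [W [SD [wW ->]]]] [TB ->]]]].
have [P [P0 hP]] := bset_wd k bTS.
have bD := hM D SD; have bW := hP W wW; have bB := hN B TB.
have bDW := bnd_mul bD bW.
apply: (le_trans (gam_mul bDW bB)).
apply: (@le_trans _ _ (M * (C * e ^+ k) * N)).
  apply: ler_pM; [exact: gam_ge0 bDW|exact: gam_ge0 bB| |exact: gam_le_bnd].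
  apply: (le_trans (gam_mul bD bW)).
  by apply: ler_pM; [exact: gam_ge0 bD|exact: gam_ge0 bW|exact: gam_le_bnd|exact: hC].
have -> : M * (C * e ^+ k) * N = M * C * N / e * e ^+ k.+1.
  by rewrite exprS; field; rewrite gt_eqF.
by rewrite ler_wpM2r ?exprn_ge0 ?(ltW e0)// le_max lexx orbT.
Qed.

End Rates.

(** * Fredholmness outside the disc of radius [rh] *)

Section Powers.
Variables (R : realType) (X : lspace R).
Local Notation C := R[i].
Local Notation L := (carrier X).
Local Notation nrm := (lnorm X).
Local Notation bnd := (bnd X).
Local Notation gam := (gam X).
Implicit Types (A B : mat R) (x y : cseq R).

Fixpoint mpow A k : mat R := if k is k'.+1 then matmul (mpow A k') A else idm X.

Lemma wd_set1 A k : wd X [set A] k = [set mpow A k].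
Proof.
elim: k => [//|k IH]; rewrite wdS IH; apply/seteqP; split=> D.
  by move=> [_ [_ [-> [-> ->]]]].
by move=> ->; exists (mpow A k), A.
Qed.

Lemma bnd_mpow A M k : bnd A M -> bnd (mpow A k) (M ^+ k).
Proof.
move=> bA; elim: k => [|k IH]; first exact: bnd_idm.
by rewrite exprSr; exact: bnd_mul.
Qed.

Lemma matapply_idm x : L x -> matapply (idm X) x = x.
Proof.
move=> Lx; have e (u : nat -> R) i : (~~ inR (idx X) i -> u i = 0) -> vapp (idm X) u i = u i.
  move=> ui; rewrite /vapp; apply/cvg_lim => //; apply: cvg_near_cst.
  exists i.+1 => // n /= ni; rewrite /series /= (bigD1_seq i) ?mem_index_iota ?iota_uniq//=.
  rewrite big1 => [|j ji]; last by rewrite /idm eq_sym (negbTE ji) mul0r.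
  rewrite /idm eqxx /= addr0; case: (boolP (inR _ _)) => iR; first by rewrite mul1r.
  by rewrite mul0r ui.
apply/funext => i; rewrite matapplyE !e; first by case: (x i).
  by move=> iR; rewrite (L_supp Lx iR).
by move=> iR; rewrite (L_supp Lx iR).
Qed.

Lemma matapply_mpowS A M k x : bnd A M -> L x ->
  matapply (mpow A k.+1) x = matapply (mpow A k) (matapply A x).
Proof. by move=> bA Lx; exact: matapply_mul (bnd_mpow k bA) bA Lx. Qed.

Lemma matapply_mpowSl A M k x : bnd A M -> L x ->
  matapply (mpow A k.+1) x = matapply A (matapply (mpow A k) x).
Proof.
move=> bA; elim: k x => [|k IH] x Lx.
  by rewrite (matapply_mpowS _ bA)// !matapply_idm//; case: (matapply_L bA Lx).
have [LA _] := matapply_L bA Lx.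
by rewrite (matapply_mpowS _ bA)// IH// (matapply_mpowS _ bA).
Qed.

(** Fixed-point iteration of [y + S x] from 0: differences shrink by the factor [q], and the
    iterates stay in the ball whose radius solves [K = nrm y + q * K]. *)
Lemma neumann (S : cseq R -> cseq R) (q : R) : 0 <= q < 1 ->
  (forall x, L x -> L (S x) /\ nrm (S x) <= q * nrm x) ->
  (forall x y, L x -> L y -> S (fun i => x i - y i) = (fun i => S x i - S y i)) ->
  forall y, L y -> exists x, L x /\ forall i, x i - S x i = y i.
Proof.
move=> /andP[q0 q1] hS Ssub y Ly.
pose u k := iter k (fun x i => y i + S x i) (@seq_zero R).
have Lu k : L (u k).
  by elim: k => [|k IH] /=; [exact: L_zero|apply: L_add => //; case: (hS _ IH)].
pose K := nrm y / (1 - q).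
have q1' : 0 < 1 - q by rewrite subr_gt0.
have K0 : 0 <= K by rewrite divr_ge0 ?nrm_ge0 ?ltW.
have hK k : nrm (u k) <= K.
  elim: k => [|k IH] /=; first by rewrite nrm0.
  have [LS nS] := hS _ (Lu k); apply: (le_trans (nrm_add Ly LS)).
  have -> : K = nrm y + q * K by rewrite /K; field; rewrite gt_eqF.
  by rewrite lerD2l (le_trans nS)// ler_wpM2l.
have hd p j : nrm (fun i => u (p + j)%N i - u p i) <= q ^+ p * nrm (u j).
  elim: p => [|p IH].
    rewrite add0n expr0 mul1r; have -> // : (fun i => u j i - u 0%N i) = u j.
    by apply/funext => i; rewrite subr0.
  have -> : (fun i => u (p.+1 + j)%N i - u p.+1 i) = S (fun i => u (p + j)%N i - u p i).
    rewrite (Ssub _ _ (Lu _) (Lu _)) addSn; apply/funext => i; rewrite /u /=; ring.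
  have [_ nS] := hS _ (L_sub (Lu (p + j)%N) (Lu p)).
  by apply: (le_trans nS); rewrite exprS -mulrA ler_wpM2l.
have small e : 0 < e -> exists N, q ^+ N * K < e.
  move=> e0; have cv : (fun n => q ^+ n * K) @ \oo --> (0 : R).
    by rewrite -[X in _ --> X](mul0r K); apply: cvgMl; apply: cvg_expr; rewrite ger0_norm.
  have : \forall n \near \oo, q ^+ n * K < e by exact: (cvgr_lt _ cv).
  by case=> N _ hN; exists N; apply: hN => /=.
have [|x [Lx hx]] := L_complete Lu.
  move=> e e0; have [N hN] := small e e0; exists N.
  have aux p r : (N <= p)%N -> (p <= r)%N -> nrm (fun i => u r i - u p i) < e.
    move=> Np pr; rewrite -(subnKC pr); apply: (le_lt_trans (hd _ _)); apply: le_lt_trans hN.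
    apply: ler_pM; rewrite ?exprn_ge0 ?nrm_ge0//.
    by apply: ler_wiXn2l => //; exact: ltW.
  move=> p r Np Nr; case: (leqP p r) => [|/ltnW] h; last exact: aux.
  by rewrite nrm_subC//; exact: aux.
exists x; split=> // i; have [LSx _] := hS x Lx.
pose d := fun i => (x i - S x i) - y i.
have Ld : L d by apply: L_sub => //; exact: L_sub.
suff /(congr1 (fun f => f i)) : d = @seq_zero R by rewrite /d => /eqP; rewrite subr_eq0 => /eqP.
apply: (nrm_eq0 Ld); apply/eqP; rewrite eq_le nrm_ge0// andbT.
apply/ler_addgt0Pr => e e0; rewrite add0r.
have e2 : 0 < e / 2 by rewrite divr_gt0.
have [N hN] := hx _ e2; have h1 := hN N.+1 (leqnSn N); have h2 := hN N (leqnn N).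
have [LS nS] := hS _ (L_sub (Lu N) Lx).
have -> : d = (fun i => S (fun i => u N i - x i) i - (u N.+1 i - x i)).
  by rewrite (Ssub _ _ (Lu N) Lx); apply/funext => j; rewrite /d /u /=; ring.
apply: (le_trans (nrm_sub LS (L_sub (Lu N.+1) Lx))).
rewrite [leRHS](splitr e) lerD//; last exact: ltW.
apply: (le_trans nS); apply: le_trans (ltW h2).
by rewrite ler_piMl ?nrm_ge0 ?ltW//; exact: L_sub.
Qed.

Lemma geometric_lt (e l c : R) : 0 <= e -> e < l -> 0 < c ->
  exists k, (0 < k)%N /\ c * e ^+ k < l ^+ k.
Proof.
move=> e0 el c0; have l0 : 0 < l by exact: le_lt_trans el.
have cv : (fun n => c * (e / l) ^+ n) @ \oo --> (0 : R).
  rewrite -[X in _ --> X](mulr0 c); apply: cvgMr; apply: cvg_expr.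
  by rewrite ger0_norm ?divr_ge0 ?(ltW l0)// ltr_pdivrMr// mul1r.
have : \forall n \near \oo, c * (e / l) ^+ n < 1 by exact: (cvgr_lt _ cv).
case=> N _ hN; exists N.+1; split=> //; have := hN N.+1 (leqnSn N).
by rewrite /= expr_div_n mulrA ltr_pdivrMr ?exprn_gt0// mul1r.
Qed.

(** The witness is the truncated Neumann series, the sum over [j < k] of [lam ^- j.+1] times
    [A^j x]. *)
Lemma telescope_resolvent A M (lam : C) k x : bnd A M -> lam != 0 -> L x ->
  exists y, L y /\ forall i,
    lam * y i - matapply A y i = x i - lam ^- k * matapply (mpow A k) x i.
Proof.
move=> bA l0 Lx; elim: k => [|k [y [Ly hy]]].
  exists (fun i => 0 * x i); split; first exact: L_scale.
  move=> i; rewrite (matapply_scale _ bA Lx) /= matapply_idm// invr1; ring.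
have [Lk _] := matapply_L (bnd_mpow k bA) Lx.
have Lz := L_scale (lam ^- k.+1) Lk.
exists (fun i => y i + lam ^- k.+1 * matapply (mpow A k) x i); split; first exact: L_add.
move=> i; rewrite (matapply_add bA Ly Lz) (matapply_scale _ bA Lk).
rewrite -(matapply_mpowSl k bA Lx) mulrDr opprD addrACA hy exprS invfM.
have lk : lam ^+ k != 0 by exact: expf_neq0.
by field; rewrite lk l0.
Qed.

(** Set to 0 outside the index set, so that it lies in L for every [k] and spans the heads whatever
    the index set is. *)
Definition ebas k : cseq R := fun i => if inR (idx X) k then @unit_vec R k i else 0.

Lemma L_ebas k : L (ebas k).
Proof.
case: (boolP (inR (idx X) k)) => kR.
  have -> : ebas k = @unit_vec R k by apply/funext => i; rewrite /ebas kR.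
  exact: L_unit.
have -> : ebas k = @seq_zero R by apply/funext => i; rewrite /ebas (negbTE kR).
exact: L_zero.
Qed.

Lemma sum_unit_chead n x : L x ->
  chead n x = (fun i => \sum_(0 <= k < n) x k * ebas k i).
Proof.
move=> Lx; apply/funext => i; rewrite /chead /ebas; case: (leqP n i) => ni.
  rewrite big_nat big1// => k /andP[_ kn]; case: ifP => _; rewrite ?mulr0//.
  by rewrite /unit_vec gtn_eqF ?mulr0// (leq_trans kn).
rewrite (bigD1_seq i) ?mem_index_iota ?iota_uniq//= big1 => [|k ki].
  rewrite addr0; case: (boolP (inR _ _)) => iR; first by rewrite /unit_vec eqxx mulr1.
  by rewrite mulr0 (L_supp Lx iR).
by case: ifP => _; rewrite /unit_vec ?mulr0// eq_sym (negbTE ki) mulr0.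
Qed.

Lemma in_span_mkseq (f : nat -> cseq R) (c : nat -> C) n y :
  (forall i, y i = \sum_(0 <= k < n) c k * f k i) -> in_span (mkseq f n) y.
Proof.
move=> h; exists c => i; rewrite h size_mkseq big_mkord; apply: eq_bigr => k _.
by rewrite nth_mkseq.
Qed.

(* Outside the disc of radius rh A, some power of A is, up to a finite-rank matrix, a strict
   contraction after rescaling, so lam - A divides an operator of the form invertible - finite rank. *)
Lemma fredholm_of_gt A M (lam : C) : bnd A M -> rh X [set A] < cabs lam ->
  fredholm L (fun x i => lam * x i - matapply A x i).
Proof.
move=> bA hl; have bS := bset1 bA; have r0 := rh_ge0 bS.
pose e := (rh X [set A] + cabs lam) / 2.
have [e1 e2] : rh X [set A] < e /\ e < cabs lam by rewrite /e; split; lra.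
have [e0 [D [D0 hD]]] := rh_lt bS e1.
have l0 : 0 < cabs lam by exact: lt_trans e2.
have lN : lam != 0 by apply: contraTneq l0 => ->; rewrite cabs0 ltxx.
have [k [k0 hk]] := geometric_lt (ltW e0) e2 D0.
have bk := bnd_mpow k bA.
(* The midpoint of [D * e ^+ k] and [cabs lam ^+ k] becomes a norm bound for a row tail of the
   [k]-th power. *)
have [|n bn] := gam_lt bk (e := D * e ^+ k + (cabs lam ^+ k - D * e ^+ k) / 2).
  apply: (@le_lt_trans _ _ (D * e ^+ k)); first by apply: hD; rewrite wd_set1.
  by rewrite ltrDl divr_gt0// subr_gt0.
set f := D * e ^+ k + _ in bn.
have fl : f < cabs lam ^+ k by rewrite /f; lra.
have f0 := bnd_M0 bn.
pose S x i := lam ^- k * matapply (mtail n (mpow A k)) x i.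
have cl : cabs (lam ^- k) = (cabs lam ^+ k)^-1.
  rewrite /cabs Normc.normcV; congr (_^-1); elim: (k) => [|p IH].
    by rewrite !expr0 Normc.normc1.
  by rewrite !exprS Normc.normcM IH.
have cp : 0 < cabs lam ^+ k by rewrite exprn_gt0.
pose q := f / cabs lam ^+ k.
have q01 : 0 <= q < 1 by rewrite /q divr_ge0 ?(ltW cp)//= ltr_pdivrMr// mul1r.
have hS x : L x -> L (S x) /\ nrm (S x) <= q * nrm x.
  move=> Lx; have [LB nB] := matapply_L bn Lx; split; first exact: L_scale.
  rewrite /S nrm_scale// cl /q mulrAC mulrC ler_wpM2r// invr_ge0 ltW//.
have Ssub x y : L x -> L y -> S (fun i => x i - y i) = (fun i => S x i - S y i).
  by move=> Lx Ly; rewrite /S (matapply_sub bn)//; apply/funext => i; rewrite mulrBr.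
have Sinj x : L x -> (forall i, x i = S x i) -> x = @seq_zero R.
  move=> Lx h; apply: (nrm_eq0 Lx); apply/eqP; rewrite eq_le nrm_ge0// andbT.
  have [_] := hS x Lx; have <- : x = S x by exact/funext.
  case/andP: q01 => q0 q1 nq; have x0 := nrm_ge0 Lx; nra.
have Sk x : L x -> S x = ctail n (fun i => lam ^- k * matapply (mpow A k) x i).
  move=> Lx; rewrite /S -ctail_matapply; apply/funext => i; rewrite /ctail.
  by case: ifP => //; rewrite mulr0.
have inv := neumann q01 hS Ssub.
split.
  (* Kernel: if [lam x = A x], then [lam ^- k] times [A^k x] is [x], so [x - S x] is a head of [x],
     and [x] is a combination of the preimages [g j] of the unit vectors under [1 - S]. *)
  have /choice[g hg] : forall j, exists g, L g /\ forall i, g i - S g i = ebas j i.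
    by move=> j; exact: inv (L_ebas j).
  have Lg j : L (g j) by case: (hg j).
  exists (mkseq g n); split.
    by move=> j; rewrite size_mkseq => jn; rewrite nth_mkseq.
  move=> x Lx hx.
  have Ax j : matapply (mpow A j) x = fun i => lam ^+ j * x i.
    elim: j => [|j IH]; first by rewrite /= matapply_idm//; apply/funext => i; rewrite mul1r.
    rewrite (matapply_mpowSl j bA Lx) IH (matapply_scale _ bA Lx); apply/funext => i.
    by rewrite exprSr -mulrA; congr (_ * _); apply/eqP; rewrite eq_sym -subr_eq0 hx.
  have Sx : S x = ctail n x.
    rewrite (Sk x Lx) Ax; apply/funext => i; rewrite /ctail; case: ifP => // _.
    by rewrite mulKf// expf_neq0.
  pose y i := \sum_(0 <= j < n) x j * g j i.
  have [Ly _] : L y /\ _ := @L_sum _ X n (fun j i => x j * g j i) (fun j _ => L_scale (x j) (Lg j)).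
  have Sy : S y = fun i => \sum_(0 <= j < n) x j * S (g j) i.
    rewrite /S /y (@matapply_sum _ X _ f n (fun j i => x j * g j i) bn); last first.
      by move=> j _; exact: L_scale.
    apply/funext => i; rewrite mulr_sumr; apply: eq_bigr => j _.
    by rewrite (matapply_scale _ bn (Lg j)) mulrCA.
  apply: (in_span_mkseq (c := x)) => i.
  suff /(congr1 (fun h => h i)) : (fun i => x i - y i) = @seq_zero R.
    by rewrite /seq_zero => /eqP; rewrite subr_eq0 => /eqP.
  apply: Sinj (L_sub Lx Ly) _ => {}i.
  rewrite (Ssub _ _ Lx Ly) Sx Sy /y.
  apply/eqP; rewrite -subr_eq0; apply/eqP.
  rewrite {1}[x i](chead_tail n) (sum_unit_chead n Lx).
  rewrite (_ : \sum_(0 <= j < n) x j * ebas j i =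
     \sum_(0 <= j < n) x j * g j i - \sum_(0 <= j < n) x j * S (g j) i); first by ring.
  rewrite -sumrB; apply: eq_bigr => j _; rewrite -mulrBr.
  by case: (hg j) => _ <-.
exists (mkseq ebas n); split.
  by move=> j; rewrite size_mkseq => jn; rewrite nth_mkseq//; exact: L_ebas.
(* Range: with [y = x - S x], the truncated Neumann series at [x] is mapped to [x] minus [lam ^- k]
   times [A^k x], which differs from [y] by a head. *)
move=> y Ly; have [x [Lx hx]] := inv y Ly.
have [z [Lz hz]] := telescope_resolvent k bA lN Lx.
have [Lk _] := matapply_L bk Lx.
have Lw := L_scale (lam ^- k) Lk.
exists z, (chead n (fun i => lam ^- k * matapply (mpow A k) x i)); split=> //; split.
  apply: (in_span_mkseq (c := fun i => lam ^- k * matapply (mpow A k) x i)) => i.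
  by rewrite (sum_unit_chead n Lw).
move=> i; rewrite hz -hx (Sk x Lx).
by rewrite [lam ^- k * matapply _ x i](chead_tail n (fun i => lam ^- k * matapply (mpow A k) x i)); ring.
Qed.

End Powers.

(** * Finite-dimensional sets of sequences *)

Section FiniteDim.
Variables (R : realType) (X : lspace R).
Local Notation C := R[i].
Local Notation L := (carrier X).
Local Notation nrm := (lnorm X).
Implicit Types (x y w : cseq R) (b : nat -> cseq R).

Definition crep n b w : cseq R := fun i => \sum_(0 <= k < n) w k * b k i.

(* A finite-dimensional set of sequences is recovered linearly from finitely many coordinates;
   this replaces the equivalence of norms on finite-dimensional spaces. *)
Definition findim (W : set (cseq R)) : Prop :=
  exists n b, (forall k, L (b k)) /\ forall w, W w -> w = crep n b w.

Lemma crep_L n b w : (forall k, L (b k)) -> L (crep n b w) /\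
  nrm (crep n b w) <= \sum_(0 <= k < n) cabs (w k) * nrm (b k).
Proof.
move=> Lb; have Lwb k : (k < n)%N -> L (fun i => w k * b k i) by move=> _; exact: L_scale.
have [L1 n1] := L_sum Lwb; split=> //; apply: (le_trans n1).
by apply: ler_sum => k _; rewrite nrm_scale.
Qed.

Lemma findim_sub (V W : set (cseq R)) : V `<=` W -> findim W -> findim V.
Proof. by move=> VW [n [b [Lb h]]]; exists n, b; split=> // w /VW /h. Qed.

(** If [crep n b] does not recover [v], the defect [v' = v - crep n b v] is nonzero at some [j]. The
    defect of [w + c v] is [c v'], so its value at [j] determines [c] and the defect can be added
    back. *)
Lemma findim_extend W v : findim W -> L v ->
  findim [set u | exists w (c : C), W w /\ u = (fun i => w i + c * v i)].
Proof.
move=> [n [b [Lb h]]] Lv.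
have coordD w (c : C) i : crep n b (fun i => w i + c * v i) i = crep n b w i + c * crep n b v i.
  rewrite /crep mulr_sumr -big_split /=; apply: eq_bigr => k _; ring.
pose v' i := v i - crep n b v i.
have Lv' : L v' by apply: L_sub => //; case: (crep_L n v Lb).
have [v0|/existsNP[j /eqP vj]] := pselect (forall i, v' i = 0).
  exists n, b; split=> // _ [w [c [Ww ->]]]; apply/funext => i; rewrite coordD -(h w Ww).
  by congr (_ + _ * _); apply/eqP; rewrite -subr_eq0; apply/eqP; exact: v0.
(* Chosen so that the new representation of [u] is [crep n b u] plus the multiple of [v'] that
   matches the defect of [u] at [j]. Since [j] may be below [n], the two corrections are added. *)
pose b' k i := (if (k < n)%N then b k i - b k j / v' j * v' i else 0) +
               (if k == j then (v' j)^-1 * v' i else 0).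
exists (maxn n j.+1), b'; split.
  move=> k; apply: L_add.
    by case: (k < n)%N; [apply: L_sub => //; exact: L_scale|exact: L_zero].
  by case: (k == j); [exact: L_scale|exact: L_zero].
have E' u i : crep (maxn n j.+1) b' u i =
    crep n b u i + (u j - crep n b u j) / v' j * v' i.
  rewrite /crep /b'; under eq_bigr do rewrite mulrDr.
  rewrite big_split /=.
  have -> : \sum_(0 <= k < maxn n j.+1) u k * (if k == j then (v' j)^-1 * v' i else 0) =
      u j / v' j * v' i.
    rewrite (bigD1_seq j) ?mem_index_iota ?iota_uniq ?leq_maxr//= eqxx.
    by rewrite big1 ?addr0 ?mulrA// => k /negbTE ->; rewrite mulr0.
  rewrite (big_cat_nat (n := n)) ?leq_maxl//=.
  have -> : \sum_(n <= k < maxn n j.+1) u k *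
      (if (k < n)%N then b k i - b k j / v' j * v' i else 0) = 0.
    by rewrite big_nat big1// => k /andP[nk _]; rewrite ltnNge nk mulr0.
  rewrite addr0.
  rewrite (eq_big_nat _ _ (F2 := fun k => u k * b k i - u k * b k j / v' j * v' i)); last first.
    by move=> k /andP[_ ->]; ring.
  rewrite sumrB mulrBl mulrBl -[X in _ - X + _]mulr_suml -[X in _ - X * _ + _]mulr_suml; ring.
move=> _ [w [c [Ww ->]]]; apply/funext => i; rewrite E' !coordD -!(h w Ww).
have -> : w j + c * v j - (w j + c * crep n b v j) = c * v' j by rewrite /v'; ring.
by rewrite mulfK// /v'; ring.
Qed.

Lemma in_span_nil y : in_span [::] y -> y = @seq_zero R.
Proof. by move=> [c h]; apply/funext => i; rewrite h big_ord0. Qed.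

Lemma in_span_cons v s y : in_span (v :: s) y ->
  exists w (c : C), in_span s w /\ y = (fun i => w i + c * v i).
Proof.
move=> [c h]; exists (fun i => \sum_(k < size s) c k.+1 * nth (@seq_zero R) s k i), (c 0%N).
split; first by exists (fun k => c k.+1).
by apply/funext => i; rewrite h big_ord_recl addrC.
Qed.

Lemma findim_span (s : seq (cseq R)) : (forall k, (k < size s)%N -> L (nth (@seq_zero R) s k)) ->
  findim (in_span s).
Proof.
elim: s => [_|v s IH Ls].
  exists 0%N, (fun=> @seq_zero R); split; first by move=> _; exact: L_zero.
  by move=> w /in_span_nil ->; apply/funext => i; rewrite /crep big_nil.
have fs : findim (in_span s) by apply: IH => k ks; exact: (Ls k.+1).
apply: findim_sub (findim_extend fs (Ls 0%N isT)) => y /in_span_cons[w [c [sw ->]]].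
by exists w, c.
Qed.

(** Induction on the spanning list: if some [x0] is mapped with a nonzero component along the new
    vector [v], subtracting a multiple of [x0] brings any [x] back to the smaller preimage;
    otherwise the preimage does not grow. *)
Lemma findim_preimage (T : cseq R -> cseq R) (s : seq (cseq R)) :
  (forall x y, L x -> L y -> T (fun i => x i + y i) = (fun i => T x i + T y i)) ->
  (forall c x, L x -> T (fun i => c * x i) = (fun i => c * T x i)) ->
  findim [set x | L x /\ forall i, T x i = 0] ->
  findim [set x | L x /\ in_span s (T x)].
Proof.
move=> TD TZ hker; elim: s => [|v s IH].
  apply: findim_sub hker => x [Lx /in_span_nil Tx]; split=> // i.
  by rewrite Tx.
have [[x0 [c0 [w0 [Lx0 [c0N [sw0 Tx0]]]]]]|no] := pselect (exists x0 (c0 : C) w0,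
    L x0 /\ c0 != 0 /\ in_span s w0 /\ T x0 = fun i => w0 i + c0 * v i).
  apply: findim_sub (findim_extend IH Lx0) => x [Lx /in_span_cons[w [c [sw Tx]]]].
  exists (fun i => x i + (- (c / c0)) * x0 i), (c / c0); split.
    split; first by apply: L_add => //; exact: L_scale.
    rewrite TD ?TZ//; last exact: L_scale.
    case: sw sw0 => e he [f hf]; exists (fun k => e k - c / c0 * f k) => i.
    rewrite Tx Tx0 (_ : w i + c * v i + - (c / c0) * (w0 i + c0 * v i) = w i - c / c0 * w0 i).
      by rewrite he hf mulr_sumr -sumrB; apply: eq_bigr => k _; ring.
    by field.
  by apply/funext => i; ring.
apply: findim_sub IH => x [Lx /in_span_cons[w [c [sw Tx]]]]; split=> //.
have [c0|cN] := eqVneq c 0; last by exfalso; apply: no; exists x, c, w.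
have -> // : T x = w by rewrite Tx; apply/funext => i; rewrite c0 mul0r addr0.
Qed.

(** Coordinates of elements of [W] are bounded by [K], so their tails are combinations, with bounded
    coefficients, of the tails of finitely many [b k]. *)
Lemma findim_tail_small W K (e : R) : findim W -> (forall w, W w -> L w /\ nrm w <= K) ->
  0 < e -> exists N, forall p w, (N <= p)%N -> W w -> nrm (ctail p w) <= e.
Proof.
move=> [n [b [Lb h]]] hW e0.
(* The two added units keep the denominator positive when [K] or [n] is 0; the absolute value covers
   negative [K]. *)
pose d := e / ((`|K| + 1) * n.+1%:R).
have P0 : 0 < (`|K| + 1) * n.+1%:R by rewrite mulr_gt0// ltr_wpDl.
have d0 : 0 < d by rewrite divr_gt0.
have [N hN] := nrm_tail_small_fin (fun k (_ : (k < n)%N) => Lb k) d0.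
exists N => p w Np Ww; have [Lw nw] := hW w Ww.
have Lt k : L (ctail p (b k)) by case: (L_tail p (Lb k)).
have -> : ctail p w = crep n (fun k => ctail p (b k)) w.
  apply/funext => i; rewrite /ctail [in LHS](h w Ww) /crep; case: ifP => // _.
  by rewrite big1// => k _; rewrite mulr0.
have [_ n1] := crep_L n w Lt; apply: (le_trans n1).
apply: (@le_trans _ _ (\sum_(0 <= k < n) `|K| * d)).
  rewrite big_nat [leRHS]big_nat; apply: ler_sum => k /andP[_ kn].
  apply: ler_pM; rewrite ?cabs_ge0 ?nrm_ge0//; last by apply: ltW; exact: hN.
  by apply: (le_trans (cabs_le_nrm k Lw)); apply: (le_trans nw); exact: ler_norm.
rewrite sumr_const_nat subn0 -[_ *+ _]mulr_natr /d.
have -> : `|K| * (e / ((`|K| + 1) * n.+1%:R)) * n%:R =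
    e * ((`|K| * n%:R) / ((`|K| + 1) * n.+1%:R)).
  by field; rewrite !gt_eqF// ?ltr_wpDl// ltr0n.
rewrite ger_pMr// ler_pdivrMr// mul1r; apply: ler_pM => //; first by rewrite lerDl.
by rewrite ler_nat.
Qed.

End FiniteDim.

(** * Baire's theorem and the open mapping theorem modulo finite dimension *)

Section OpenMapping.
Variables (R : realType) (X : lspace R).
Local Notation C := R[i].
Local Notation L := (carrier X).
Local Notation nrm := (lnorm X).
Implicit Types (x y z w : cseq R).

(** Steps bounded by decrements of [h] telescope. In Baire's argument [h] is the sequence of radii,
    in the open mapping theorem a geometric sequence. *)
Lemma cauchy_telescope (a : nat -> cseq R) (h : nat -> R) : (forall k, L (a k)) ->
  (forall k, 0 <= h k) -> (forall e : R, 0 < e -> exists N, h N < e) ->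
  (forall k, nrm (fun i => a k.+1 i - a k i) <= h k - h k.+1) ->
  exists l, L l /\ forall k, nrm (fun i => a k i - l i) <= h k.
Proof.
move=> La h0 small aS.
have ball k j : nrm (fun i => a (k + j)%N i - a k i) <= h k - h (k + j)%N.
  elim: j => [|j IH].
    rewrite addn0 subrr; have -> : (fun i => a k i - a k i) = @seq_zero R.
      by apply/funext => i; rewrite subrr.
    by rewrite nrm0.
  rewrite addnS; apply: (le_trans (nrm_sub_trans (La _) (La (k + j)%N) (La k))).
  by have := aS (k + j)%N; lra.
have [|l [Ll hl]] := L_complete La.
  move=> e e0; have e2 : 0 < e / 2 by rewrite divr_gt0.
  have [N hN] := small (e / 2) e2.
  exists N => p q Np Nq.
  apply: (le_lt_trans (nrm_sub_trans (La p) (La N) (La q))).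
  have h1 := ball N (p - N)%N; have h2 := ball N (q - N)%N; rewrite !subnKC// in h1 h2.
  rewrite (nrm_subC (La N) (La q)); have := h0 p; have := h0 q; lra.
exists l; split=> // k; apply/ler_addgt0Pr => e e0; have [N hN] := hl e e0.
apply: (le_trans (nrm_sub_trans (La k) (La (k + N)%N) Ll)).
rewrite (nrm_subC (La k) (La _)); have := ball k N; have := h0 (k + N)%N.
have := hN (k + N)%N (leq_addl _ _); lra.
Qed.

Lemma half_expr_small (c e : R) : 0 < e -> exists N, c * 2^-1 ^+ N < e.
Proof.
move=> e0; have cv : (fun n : nat => c * (2^-1 : R) ^+ n) @ \oo --> (0 : R).
  rewrite -[X in _ --> X](mulr0 c); apply: cvgMr.
  by apply: cvg_expr; rewrite ger0_norm// invf_lt1// ltr1n.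
have : \forall n \near \oo, c * (2^-1 : R) ^+ n < e by exact: (cvgr_lt _ cv).
by case=> N _ hN; exists N; exact: (hN N (leqnn N)).
Qed.

(** Otherwise every ball contains a smaller one that avoids the next [V k], and the limit of the
    centers lies in no [V k]. The conclusion says that [V k] is dense in some ball. *)
Lemma baire (V : nat -> set (cseq R)) : (forall y, L y -> exists k, V k y) ->
  exists k a (r : R), L a /\ 0 < r /\ forall y, L y -> nrm (fun i => y i - a i) < r ->
    forall e : R, 0 < e -> exists v, V k v /\ L v /\ nrm (fun i => y i - v i) < e.
Proof.
move=> cover; apply: contrapT => hno.
have step (k : nat) a (r : R) : L a -> 0 < r -> exists a' (r' : R),
    L a' /\ 0 < r' /\ r' <= r / 2 /\ nrm (fun i => a' i - a i) <= r / 2 /\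
    forall v, V k v -> L v -> r' < nrm (fun i => a' i - v i).
  move=> La r0; have r2 : 0 < r / 2 by rewrite divr_gt0.
  apply: contrapT => hn; apply: hno; exists k, a, (r / 2); split=> //; split=> // y Ly ya e e0.
  (* Elements of [V k] keep distance [e] from [y], so half of it gives a ball missing them; [r / 2]
     makes the centers converge. *)
  apply: contrapT => hv; apply: hn; exists y, (Num.min (r / 2) (e / 2)); split=> //.
  have e2 : 0 < e / 2 by rewrite divr_gt0.
  split; first by rewrite lt_min r2.
  split; first by rewrite ge_min lexx.
  split; first exact: ltW.
  move=> v Vv Lv; rewrite gt_min; apply/orP; right.
  apply: (@lt_le_trans _ _ e); first by rewrite ltr_pdivrMr// ltr_pMr// ltr1n.
  by rewrite leNgt; apply/negP => ve; apply: hv; exists v.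
pose St : Type := {p : cseq R * R | L p.1 /\ 0 < p.2}.
have /choice[f hf] : forall q : nat * St, exists q' : St,
    (sval q').2 <= (sval q.2).2 / 2 /\
    nrm (fun i => (sval q').1 i - (sval q.2).1 i) <= (sval q.2).2 / 2 /\
    forall v, V q.1 v -> L v -> (sval q').2 < nrm (fun i => (sval q').1 i - v i).
  move=> [k [[a r] [/= La r0]]]; have [a' [r' [La' [r'0 h]]]] := step k a r La r0.
  by exists (exist _ (a', r') (conj La' r'0)).
pose s0 : St := exist _ (@seq_zero R, 1 : R) (conj (L_zero X) ltr01).
pose s := fix s k : St := if k is k'.+1 then f (k', s k') else s0.
pose a k := (sval (s k)).1; pose r k := (sval (s k)).2.
have La k : L (a k) by case: (svalP (s k)).
have r0 k : 0 < r k by case: (svalP (s k)).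
have rS k : r k.+1 <= r k / 2 by case: (hf (k, s k)).
have aS k : nrm (fun i => a k.+1 i - a k i) <= r k / 2 by case: (hf (k, s k)) => _ [].
have aV k v : V k v -> L v -> r k.+1 < nrm (fun i => a k.+1 i - v i).
  by case: (hf (k, s k)) => _ [_ h]; exact: h.
have rk k : r k <= 2^-1 ^+ k.
  elim: k => [|k IH]; first by rewrite expr0.
  by apply: (le_trans (rS k)); rewrite exprSr ler_wpM2r.
have small e : 0 < e -> exists N, r N < e.
  move=> /(half_expr_small 1)[N]; rewrite mul1r => hN.
  by exists N; exact: (le_lt_trans (rk N)).
have [|||l [Ll lim]] := cauchy_telescope La (h := r) => //.
- by move=> k; exact: ltW.
- by move=> k; have := aS k; have := rS k; lra.
have [k Vl] := cover l Ll; have := aV k l Vl Ll; have := lim k.+1; lra.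
Qed.

(** Baire's theorem is applied to the images of the balls of radius [k] modulo the space Z of all
    [z] with [z = crep n b z]. Differences of two approximations in a dense ball approximate any [y]
    up to half its norm with a controlled preimage; iteration removes the error. Z is closed because
    [crep] involves finitely many coordinates. *)
Lemma open_mapping (T : cseq R -> cseq R) (K : R) n (b : nat -> cseq R) :
  (forall x, L x -> L (T x) /\ nrm (T x) <= K * nrm x) ->
  (forall x y, L x -> L y -> T (fun i => x i + y i) = (fun i => T x i + T y i)) ->
  (forall c x, L x -> T (fun i => c * x i) = (fun i => c * T x i)) ->
  (forall k, L (b k)) ->
  (forall y, L y -> exists x z, L x /\ z = crep n b z /\ forall i, y i = T x i + z i) ->
  exists M : R, 0 < M /\ forall y, L y -> exists x, L x /\ nrm x <= M * nrm y /\
    (fun i => y i - T x i) = crep n b (fun i => y i - T x i).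
Proof.
move=> hT TD TZ Lb surj.
pose Z z := z = crep n b z.
have ZD z w (c : C) : Z z -> Z w -> Z (fun i => z i + c * w i).
  rewrite /Z => zE wE; apply/funext => i; rewrite {1}zE {1}wE /crep mulr_sumr -big_split /=.
  by apply: eq_bigr => k _; ring.
have TB x y (c : C) : L x -> L y -> T (fun i => x i + c * y i) = (fun i => T x i + c * T y i).
  by move=> Lx Ly; rewrite TD ?TZ//; exact: L_scale.
pose V k := [set y | L y /\ exists x, L x /\ nrm x <= k%:R /\ Z (fun i => y i - T x i)].
have [y Ly|k [a [r [La [r0 ha]]]]] := @baire V.
  have [x [z [Lx [Zz yE]]]] := surj y Ly; exists (Num.truncn (nrm x)).+1; split=> //.
  exists x; split=> //; split; first by apply: ltW; exact: truncnS_gt.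
  have -> // : (fun i => y i - T x i) = z by apply/funext => i; rewrite yE; ring.
(* [y] is scaled by [t = r / (2 * nrm y)]; preimages of norm at most [k] differ by at most [2 * k],
   and division by [t] gives [4 * k / r] times [nrm y]. *)
pose c := 4 * k%:R / r.
have c0 : 0 <= c by rewrite divr_ge0 ?mulr_ge0 ?(ltW r0).
have approx y : L y -> exists x v, L x /\ L v /\ Z (fun i => v i - T x i) /\
    nrm x <= c * nrm y /\ nrm (fun i => y i - v i) <= nrm y / 2.
  move=> Ly; have := nrm_ge0 Ly; rewrite le_eqVlt => /predU1P[y0|yp].
    exists (fun i => 0 * y i), (fun i => 0 * y i).
    have Lz := L_scale 0 Ly; split=> //; split=> //; split.
      rewrite TZ// /Z /crep; apply/funext => i; rewrite big1 ?mul0r ?subrr// => j _.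
      by rewrite !mul0r subrr mul0r.
    rewrite -y0 !nrm_scale// cabs0 !mul0r mulr0; split=> //.
    have -> : (fun i => y i - 0 * y i) = y by apply/funext => i; rewrite mul0r subr0.
    by rewrite -y0.
  pose t := r / (2 * nrm y).
  have t0 : 0 < t by rewrite divr_gt0// mulr_gt0.
  have tN : t%:C != 0 by rewrite -(rmorph0 (real_complex R)) (inj_eq (@complexI R)) gt_eqF.
  pose y' i := t%:C * y i.
  have Ly' : L y' by exact: L_scale.
  have ny' : nrm y' = r / 2.
    by rewrite nrm_scale// cabs_ge0R ?(ltW t0)// /t; field; rewrite gt_eqF.
  (* Two errors of this size, divided by [t], add up to [nrm y / 2]. *)
  pose e := t * nrm y / 4.
  have e0 : 0 < e by rewrite divr_gt0// mulr_gt0.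
  have [||v1 [[_ [x1 [Lx1 [nx1 Z1]]]] [Lv1 nv1]]] := ha (fun i => a i + y' i) _ _ e e0.
  - exact: L_add.
  - have -> : (fun i => a i + y' i - a i) = y' by apply/funext => i; ring.
    by rewrite ny' ltr_pdivrMr// ltr_pMr// ltr1n.
  have [|v2 [[_ [x2 [Lx2 [nx2 Z2]]]] [Lv2 nv2]]] := ha a La _ e e0.
    have -> : (fun i => a i - a i) = @seq_zero R by apply/funext => i; rewrite subrr.
    by rewrite nrm0.
  have Lx := L_sub Lx1 Lx2; have Lv := L_sub Lv1 Lv2.
  exists (fun i => t%:C^-1 * (x1 i - x2 i)), (fun i => t%:C^-1 * (v1 i - v2 i)).
  have ct : cabs t%:C^-1 = t^-1 by rewrite -(fmorphV (real_complex R)) cabs_ge0R// invr_ge0 ltW.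
  split; first exact: L_scale.
  split; first exact: L_scale.
  have Tx : T (fun i => x1 i - x2 i) = fun i => T x1 i - T x2 i.
    have -> : (fun i => x1 i - x2 i) = (fun i => x1 i + (-1) * x2 i).
      by apply/funext => i; ring.
    by rewrite TB//; apply/funext => i; ring.
  split.
    rewrite TZ// Tx.
    have Z0 : Z (fun i => 0 * a i).
      by apply/funext => i; rewrite /crep big1 ?mul0r// => j _; rewrite !mul0r.
    have -> : (fun i => t%:C^-1 * (v1 i - v2 i) - t%:C^-1 * (T x1 i - T x2 i)) =
        (fun i => 0 * a i + t%:C^-1 * ((v1 i - T x1 i) + (-1) * (v2 i - T x2 i))).
      by apply/funext => i; ring.
    exact: (ZD _ _ _ Z0 (ZD _ _ _ Z1 Z2)).
  split.
    rewrite nrm_scale// ct; apply: (@le_trans _ _ (t^-1 * (k%:R + k%:R))).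
      rewrite ler_wpM2l ?invr_ge0 ?(ltW t0)//.
      by apply: (le_trans (nrm_sub Lx1 Lx2)); exact: lerD.
    rewrite /c /t le_eqVlt; apply/orP; left; apply/eqP; field; rewrite !gt_eqF//.
  have -> : (fun i => y i - t%:C^-1 * (v1 i - v2 i)) =
     (fun i => t%:C^-1 * ((a i + y' i - v1 i) - (a i - v2 i))).
    by apply/funext => i; rewrite /y'; field.
  have L1 := L_sub (L_add La Ly') Lv1; have L2 := L_sub La Lv2.
  rewrite nrm_scale ?ct; last exact: L_sub.
  apply: (@le_trans _ _ (t^-1 * (e + e))).
    rewrite ler_wpM2l ?invr_ge0 ?(ltW t0)//.
    by apply: (le_trans (nrm_sub L1 L2)); apply: lerD; exact: ltW.
  by rewrite /e le_eqVlt; apply/orP; left; apply/eqP; field; rewrite gt_eqF.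
(* Preimages of the successive errors have norm at most [c * nrm y / 2^k], with sum [2 * c * nrm y];
   the 1 makes the constant positive. *)
exists (2 * c + 1); split; first by rewrite ltr_wpDl// mulr_ge0.
move=> y Ly; clearbody c; clear ha La r0 a r V k.
have /choice[F hF] : forall y, exists p : cseq R * cseq R, L y -> L p.1 /\ L p.2 /\
    Z (fun i => p.2 i - T p.1 i) /\ nrm p.1 <= c * nrm y /\ nrm (fun i => y i - p.2 i) <= nrm y / 2.
  move=> z; have [Lz|nLz] := pselect (L z); last by exists (z, z).
  by have [x [v h]] := approx z Lz; exists (x, v).
pose Y k := iter k (fun z i => z i - (F z).2 i) y.
have LY k : L (Y k).
  by elim: k => [//|k IH] /=; apply: L_sub => //; have [_ []] := hF _ IH.
have nY k : nrm (Y k) <= nrm y * 2^-1 ^+ k.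
  elim: k => [|k IH]; first by rewrite expr0 mulr1.
  have [_ [_ [_ [_ h]]]] := hF _ (LY k); apply: (le_trans h).
  by rewrite exprSr mulrA ler_wpM2r// invr_ge0.
have Lx k : L (F (Y k)).1 by have [] := hF _ (LY k).
pose S k i := \sum_(0 <= j < k) (F (Y j)).1 i.
have LS k : L (S k) by case: (@L_sum _ X k (fun j => (F (Y j)).1) (fun j _ => Lx j)).
pose h k := 2 * c * nrm y * 2^-1 ^+ k.
have y0 := nrm_ge0 Ly.
have [|||x [Lx0 hx]] := cauchy_telescope LS (h := h).
- by move=> k; rewrite /h !mulr_ge0// exprn_ge0.
- by move=> e e0; exact: half_expr_small.
- move=> k; have -> : (fun i => S k.+1 i - S k i) = (F (Y k)).1.
    by apply/funext => i; rewrite /S big_nat_recr //= addrAC subrr add0r.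
  have [_ [_ [_ [nx _]]]] := hF _ (LY k); apply: (le_trans nx).
  have -> : h k - h k.+1 = c * (nrm y * 2^-1 ^+ k) by rewrite /h exprS; field.
  exact: ler_wpM2l.
exists x; split=> //; split.
  have := hx 0%N; rewrite nrm_subC// /h expr0 mulr1.
  have -> : (fun i => x i - S 0%N i) = x by apply/funext => i; rewrite /S big_nil subr0.
  by move=> nx; rewrite mulrDl mul1r (le_trans nx)// lerDl.
have ZS k : Z (fun i => y i - Y k i - T (S k) i).
  elim: k => [|k IH].
    have -> : S 0%N = (fun i => 0 * y i).
      by apply/funext => i; rewrite /S big_nil mul0r.
    rewrite /Y /= TZ// /Z /crep; apply/funext => i.
    by rewrite big1 => [|j _]; rewrite !subrr !mul0r ?subrr ?mul0r.
  have [_ [Lv [Zv _]]] := hF _ (LY k).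
  have -> : (fun i => y i - Y k.+1 i - T (S k.+1) i) =
      (fun i => (y i - Y k i - T (S k) i) + 1 * ((F (Y k)).2 i - T (F (Y k)).1 i)).
    have -> : S k.+1 = (fun i => S k i + (F (Y k)).1 i).
      by apply/funext => i; rewrite /S big_nat_recr.
    by rewrite TD//; apply/funext => i; rewrite /Y /=; ring.
  exact: ZD.
have [LTx _] := hT x Lx0.
(* It remains that [w] is in Z. It differs from an element of Z by [u], which is small, and
   [1 - crep n b] is bounded with constant [1 + B]. *)
pose w i := y i - T x i; have Lw : L w by exact: L_sub.
have [Lc _] := crep_L n w Lb.
suff /(congr1 (fun f => f _)) E : (fun i => w i - crep n b w i) = @seq_zero R.
  by apply/funext => i; apply/eqP; rewrite -subr_eq0; apply/eqP; exact: (E i).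
apply: (nrm_eq0 (L_sub Lw Lc)); apply/eqP; rewrite eq_le nrm_ge0 ?andbT; last exact: L_sub.
apply/ler_addgt0Pr => e e0; rewrite add0r.
pose B := \sum_(0 <= k < n) nrm (b k).
have B0 : 0 <= B by apply: sumr_ge0 => k _; exact: nrm_ge0.
have [N hN] := half_expr_small ((1 + B) * (nrm y + `|K| * (2 * c * nrm y))) e0.
pose u i := w i - (y i - Y N i - T (S N) i).
have [LTS _] := hT (S N) (LS N).
have Lu : L u by apply: L_sub => //; apply: L_sub => //; exact: L_sub.
have nu : nrm u <= (nrm y + `|K| * (2 * c * nrm y)) * 2^-1 ^+ N.
  have -> : u = (fun i => Y N i + T (fun i => S N i + (-1) * x i) i).
    by rewrite TB//; apply/funext => i; rewrite /u /w; ring.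
  have Ld : L (fun i => S N i + -1 * x i) by apply: L_add => //; exact: L_scale.
  have [LTd nTd] := hT _ Ld; apply: (le_trans (nrm_add (LY N) LTd)).
  rewrite mulrDl lerD//; apply: (le_trans nTd); rewrite -[leRHS]mulrA.
  apply: (@le_trans _ _ (`|K| * nrm (fun i => S N i + -1 * x i))).
    by rewrite ler_wpM2r ?nrm_ge0// ler_norm.
  rewrite ler_wpM2l//; apply: le_trans (hx N).
  rewrite le_eqVlt; apply/orP; left; apply/eqP; congr nrm; apply/funext => i; ring.
have -> : (fun i => w i - crep n b w i) = (fun i => u i - crep n b u i).
  apply/funext => i; have /(congr1 (fun f => f i)) := ZS N; rewrite /u /crep => zE.
  rewrite {1}zE /crep.
  rewrite (_ : \sum_(0 <= k < n) (w k - (y k - Y N k - T (S N) k)) * b k i =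
    \sum_(0 <= k < n) w k * b k i - \sum_(0 <= k < n) (y k - Y N k - T (S N) k) * b k i); first by ring.
  by rewrite -sumrB; apply: eq_bigr => k _; rewrite mulrBl.
have [Lcu ncu] := crep_L n u Lb.
apply: (le_trans (nrm_sub Lu Lcu)); apply: le_trans (ltW hN).
apply: (@le_trans _ _ ((1 + B) * nrm u)); last by rewrite -mulrA ler_wpM2l// addr_ge0.
rewrite mulrDl mul1r lerD2l; apply: (le_trans ncu); rewrite /B mulr_suml.
by apply: ler_sum => k _; rewrite mulrC ler_wpM2l ?nrm_ge0// cabs_le_nrm.
Qed.

End OpenMapping.

(** * Nussbaum's formula *)

Section EssentialRadius.
Variables (R : realType) (X : lspace R).
Local Notation C := R[i].
Local Notation L := (carrier X).
Local Notation nrm := (lnorm X).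
Local Notation bnd := (bnd X).
Local Notation gam := (gam X).
Local Notation mpow := (mpow X).
Implicit Types (A B : mat R) (x y z : cseq R).

Lemma in_span_cat (s t : seq (cseq R)) y z : in_span s y -> in_span t z ->
  in_span (s ++ t) (fun i => y i + z i).
Proof.
move=> [c hc] [d hd]; exists (fun k => if (k < size s)%N then c k else d (k - size s)%N) => i.
rewrite size_cat big_split_ord /= hc hd; congr (_ + _); apply: eq_bigr => k _.
  by rewrite ltn_ord nth_cat ltn_ord.
by rewrite nth_cat ltnNge leq_addr /= addKn.
Qed.

(* If lam - A is Fredholm, then u is controlled, up to vectors of a fixed finite-dimensional
   space, by the tail of (lam - A) u. *)
Lemma fredholm_tail A M0 (lam : C) : bnd A M0 ->
  fredholm L (fun x i => lam * x i - matapply A x i) ->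
  exists M : R, 0 < M /\ forall (D : set (cseq R)) N (c K : R), 0 <= c ->
    (forall u, D u -> L u /\ nrm u <= K /\
       nrm (ctail N (fun i => lam * u i - matapply A u i)) <= c) ->
    forall e : R, 0 < e -> exists N', forall u, D u -> nrm (ctail N' u) <= M * c + e.
Proof.
move=> bA; set T := fun x i => _; move=> [[s1 [Ls1 hs1]] [s2 [Ls2 hs2]]].
have TD x y : L x -> L y -> T (fun i => x i + y i) = (fun i => T x i + T y i).
  by move=> Lx Ly; rewrite /T (matapply_add bA Lx Ly); apply/funext => i; ring.
have TZ c x : L x -> T (fun i => c * x i) = (fun i => c * T x i).
  by move=> Lx; rewrite /T (matapply_scale _ bA Lx); apply/funext => i; ring.
have hT x : L x -> L (T x) /\ nrm (T x) <= (cabs lam + M0) * nrm x.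
  move=> Lx; have [LA nA] := matapply_L bA Lx; have Ll := L_scale lam Lx.
  split; first exact: L_sub.
  by apply: (le_trans (nrm_sub Ll LA)); rewrite nrm_scale// mulrDl lerD2l.
have [n [b [Lb hb]]] := findim_span Ls2.
have surj y : L y -> exists x z, L x /\ z = crep n b z /\ forall i, y i = T x i + z i.
  move=> Ly; have [x [z [Lx [sz yE]]]] := hs2 y Ly.
  by exists x, z; split=> //; split=> //; exact: hb.
have [M [M1 hM]] := open_mapping hT TD TZ Lb surj.
exists M; split=> // D N c K c0 hD e e0.
have fker : findim X [set x | L x /\ forall i, T x i = 0].
  by apply: findim_sub (findim_span Ls1) => x [Lx Tx]; exact: hs1.
(* [u] splits into a preimage [x], modulo the span of [b], of the tail of [T u], with norm at most
   [M * c], and a rest that [T] maps into the span of [s]. The rests form a bounded subset of a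
   finite-dimensional space, so their tails are uniformly small. *)
pose s := mkseq (ebas X) N ++ mkseq b n.
have fW := @findim_preimage _ X T s TD TZ fker.
pose W := [set w | L w /\ in_span s (T w) /\ nrm w <= K + M * c].
have fW' : findim X W by apply: findim_sub fW => w [Lw [sw _]].
have hW w : W w -> L w /\ nrm w <= K + M * c by case=> ? [].
have [N' hN'] := findim_tail_small fW' hW e0.
exists N' => u Du; have [Lu [nu nT]] := hD u Du.
have [LTu _] := hT u Lu; have [Lt _] := L_tail N LTu.
have [x [Lx [nx xz]]] := hM _ Lt.
have nx' : nrm x <= M * c by apply: (le_trans nx); rewrite ler_pM2l.
have Lw := L_sub Lu Lx.
have Ww : W (fun i => u i - x i).
  split=> //; split; last first.
    by apply: (le_trans (nrm_sub Lu Lx)); exact: lerD.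
  have -> : T (fun i => u i - x i) =
      (fun i => chead N (T u) i + (ctail N (T u) i - T x i)).
    have -> : (fun i => u i - x i) = (fun i => u i + (-1) * x i).
      by apply/funext => i; ring.
    rewrite TD//; last exact: L_scale.
    by rewrite TZ//; apply/funext => i; rewrite {1}[T u i](chead_tail N); ring.
  apply: in_span_cat.
    by apply: (in_span_mkseq (c := T u)) => i; rewrite (sum_unit_chead N LTu).
  apply: (in_span_mkseq (c := fun i => ctail N (T u) i - T x i)) => i.
  by move/(congr1 (fun f => f i)): xz.
have [Ltx ntx] := L_tail N' Lx; have [Ltw _] := L_tail N' Lw.
have -> : ctail N' u = (fun i => ctail N' x i + ctail N' (fun i => u i - x i) i).
  by apply/funext => i; rewrite /ctail; case: ifP; rewrite ?addr0// addrC subrK.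
apply: (le_trans (nrm_add Ltx Ltw)); apply: lerD; first exact: le_trans nx'.
exact: hN' (leqnn _) Ww.
Qed.

Definition pmat (c : nat -> R) A K : mat R :=
  fun i j => \sum_(0 <= k < K) c k * mpow A k i j.

Lemma bnd_pmat c A M K : (forall k, 0 <= c k) -> bnd A M ->
  bnd (pmat c A K) (\sum_(0 <= k < K) c k * M ^+ k).
Proof.
move=> c0 bA; apply: (@bnd_sum _ X K (fun k i j => c k * mpow A k i j) (fun k => c k * M ^+ k)).
by move=> k _; apply: bnd_scale => //; exact: bnd_mpow.
Qed.

Lemma matapply_pmat c A M K (x : nat -> R) : bnd A M -> (forall j, 0 <= x j) -> L (rc x) ->
  matapply (pmat c A K) (rc x) =
  (fun i => \sum_(0 <= k < K) (c k)%:C * matapply (mpow A k) (rc x) i).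
Proof.
move=> bA x0 Lx; rewrite matapply_rc; apply/funext => i; rewrite /rc.
under eq_bigr do rewrite matapply_rc /rc -rmorphM mulrC.
rewrite -rmorph_sum; congr (_%:C).
have cv := @sum_series_cvg R (fun k j => mpow A k i j * x j) c K
  (fun k => @vapp_cvg R X (mpow A k) _ x i (bnd_mpow k bA) x0 Lx).
rewrite /vapp -[RHS](cvg_lim _ cv)//; congr (limn _); apply/funext => p.
rewrite /series /pmat /=; under eq_bigr do rewrite mulr_suml.
rewrite exchange_big /=; apply: eq_bigr => k _.
by rewrite mulr_suml; apply: eq_bigr => j _; ring.
Qed.

Lemma resolvent_pmat (c d : nat -> R) (lam : R) A M K (x : nat -> R) :
  bnd A M -> (forall j, 0 <= x j) -> L (rc x) ->
  lam * c 0%N = d 0%N -> (forall k, lam * c k.+1 - c k = d k.+1) ->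
  let U := matapply (pmat c A K.+1) (rc x) in
  forall i, lam%:C * U i - matapply A U i =
    matapply (pmat d A K.+1) (rc x) i - (c K)%:C * matapply (mpow A K.+1) (rc x) i.
Proof.
move=> bA x0 Lx e0 eS U i; rewrite /U !(matapply_pmat _ _ bA x0 Lx).
have Ly k : L (matapply (mpow A k) (rc x)) by case: (matapply_L (bnd_mpow k bA) Lx).
rewrite (@matapply_sum _ X A M K.+1 (fun k i => (c k)%:C * matapply (mpow A k) (rc x) i) bA); last first.
  by move=> k _; exact: L_scale.
have E k : matapply A (fun i => (c k)%:C * matapply (mpow A k) (rc x) i) i =
    (c k)%:C * matapply (mpow A k.+1) (rc x) i.
  by rewrite (matapply_scale _ bA (Ly k)) (matapply_mpowSl k bA Lx).
under [X in _ - X = _]eq_bigr do rewrite E.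
elim: K {U} => [|K IH]; first by rewrite !big_nat1 -e0 rmorphM; ring.
rewrite big_nat_recr //= [X in _ - X]big_nat_recr //= [in RHS]big_nat_recr //=.
move: IH; set a := \sum_(0 <= _ < _) _; set a' := \sum_(0 <= _ < _) _.
set a'' := \sum_(0 <= _ < _) _; set y1 := matapply (mpow A K.+1) _ _.
set y2 := matapply _ _ _ => IH.
by rewrite mulrDr opprD addrACA IH -eS rmorphB rmorphM; ring.
Qed.

Lemma gam_scale_le c A M : 0 < c -> bnd A M -> c * gam A <= gam (fun i j => c * A i j).
Proof.
move=> c0 bA; have bc := bnd_scale (ltW c0) bA.
apply/ler_addgt0Pr => d d0.
have [|n bn] := gam_lt bc (e := gam (fun i j => c * A i j) + d); first by rewrite ltrDl.
rewrite mulrC -ler_pdivlMr//; apply: (@gam_le _ _ _ n).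
have ci : 0 <= c^-1 by rewrite invr_ge0 ltW.
rewrite mulrC; have := bnd_scale ci bn.
have -> // : (fun i j => c^-1 * mtail n (fun i j => c * A i j) i j) = mtail n A.
apply/funext => i; apply/funext => j; rewrite /mtail; case: ifP; rewrite ?mulr0// => _.
by rewrite mulKf// gt_eqF.
Qed.

(** A sum of nonnegative matrices dominates each summand entrywise; positivity of [A] excludes
    cancellation. *)
Lemma gam_pmat_ge c A M K k : (forall k, 0 <= c k) -> 0 < c k -> bnd A M -> (k < K)%N ->
  c k * gam (mpow A k) <= gam (pmat c A K).
Proof.
move=> c0 ck bA kK; apply: (le_trans (gam_scale_le ck (bnd_mpow k bA))).
apply: (@gam_mono _ X _ _ (\sum_(0 <= k < K) c k * M ^+ k)); last exact: bnd_pmat.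
move=> i j; have m0 l : 0 <= c l * mpow A l i j.
  by rewrite mulr_ge0// (bnd_ge0 _ _ (bnd_mpow l bA)).
rewrite m0 /= /pmat (bigD1_seq k) ?mem_index_iota ?iota_uniq//= lerDl.
by apply: sumr_ge0 => l _.
Qed.

(** For the midpoint [p] of [q] and 1 one has [q <= p ^+ 2]. One factor [p ^+ n] outweighs [n], by
    an inequality of Bernoulli type, and the other tends to 0. *)
Lemma nat_expr_small (q D e : R) k : 0 < q < 1 -> 0 < D -> 0 < e ->
  exists K, (k <= K)%N /\ K.+1%:R * D * q ^+ K.+1 <= e.
Proof.
move=> /andP[q0 q1] D0 e0; pose p := (1 + q) / 2.
have [p0 p1] : 0 < p /\ p < 1 by rewrite /p; split; lra.
have qp : q <= p ^+ 2 by rewrite /p; nra.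
have bern n : n%:R * (1 - p) * p ^+ n <= 1 - p ^+ n.
  elim: n => [|n IH]; first by rewrite !mul0r expr0 subrr.
  have pn : 0 <= p ^+ n by rewrite exprn_ge0// ltW.
  have pn1 : p ^+ n <= 1 by rewrite exprn_ile1// ltW.
  rewrite -natr1 exprS; have h1 := ler_wpM2l (ltW p0) IH.
  have h2 : 0 <= (1 - p) * (1 - p * p ^+ n).
    by rewrite mulr_ge0 ?subr_ge0 ?(ltW p1)// mulr_ile1// ltW.
  lra.
have cv : (fun n : nat => D / (1 - p) * p ^+ n) @ \oo --> (0 : R).
  rewrite -[X in _ --> X](mulr0 (D / (1 - p))); apply: cvgMr.
  by apply: cvg_expr; rewrite ger0_norm ?ltW.
have : \forall n \near \oo, D / (1 - p) * p ^+ n < e by exact: (cvgr_lt _ cv).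
case=> N _ hN; exists (maxn k N); split; first exact: leq_maxl.
set n := (maxn k N).+1; have nN : (N <= n)%N by rewrite leqW// leq_maxr.
have {}hN := hN n nN; rewrite /= in hN; apply: le_trans (ltW hN).
have pn : 0 <= p ^+ n by rewrite exprn_ge0// ltW.
apply: (@le_trans _ _ (n%:R * D * (p ^+ n * p ^+ n))).
  rewrite ler_wpM2l ?mulr_ge0 ?(ltW D0)// -exprD addnn -mul2n exprM.
  by apply: lerXn2r; rewrite ?nnegrE ?exprn_ge0 ?(ltW q0) ?(ltW p0).
have p1' : 0 < 1 - p by rewrite subr_gt0.
have -> : n%:R * D * (p ^+ n * p ^+ n) = D / (1 - p) * p ^+ n * (n%:R * (1 - p) * p ^+ n).
  by field; rewrite gt_eqF.
rewrite ler_piMr ?mulr_ge0 ?invr_ge0 ?(ltW D0) ?(ltW p1')//.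
by apply: (le_trans (bern n)); rewrite lerBlDr lerDl.
Qed.

(* The coefficients c of U resolve those of V: (lam - A) U = V up to the last term. *)
Lemma gam_resolvent A M0 (s M : R) : bnd A M0 ->
  (0 < M /\ forall (D : set (cseq R)) N (c K : R), 0 <= c ->
    (forall u, D u -> L u /\ nrm u <= K /\
       nrm (ctail N (fun i => s%:C * u i - matapply A u i)) <= c) ->
    forall e : R, 0 < e -> exists N', forall u, D u -> nrm (ctail N' u) <= M * c + e) ->
  forall (c d : nat -> R) (lam : R) K, s <= lam -> (forall k, 0 <= c k) -> (forall k, 0 <= d k) ->
  lam * c 0%N = d 0%N -> (forall k, lam * c k.+1 - c k = d k.+1) ->
  gam (pmat c A K.+1) <= M * ((lam - s) * gam (pmat c A K.+1) + gam (pmat d A K.+1) +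
                              c K * gam (mpow A K.+1)).
Proof.
move=> bA [M_gt0 hM] c d lam K slam c0 d0 e0 eS.
have bU := bnd_pmat K.+1 c0 bA; have bV := bnd_pmat K.+1 d0 bA.
have bP := bnd_mpow K.+1 bA.
have h0 : 0 <= lam - s by rewrite subr_ge0.
apply/ler_addgt0Pr => e e_gt0.
(* [Q] collects the coefficients of the slack [dl] in the final bound. *)
pose Q := M * (lam - s + 1 + c K) + 1.
have Q0 : 0 < Q by rewrite /Q ltr_wpDl// mulr_ge0 ?(ltW M_gt0)// addr_ge0// addr_ge0.
pose dl := e / Q; have dl0 : 0 < dl by rewrite divr_gt0.
have [|n1 b1] := gam_lt bU (e := gam (pmat c A K.+1) + dl); first by rewrite ltrDl.
have [|n2 b2] := gam_lt bV (e := gam (pmat d A K.+1) + dl); first by rewrite ltrDl.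
have [|n3 b3] := gam_lt bP (e := gam (mpow A K.+1) + dl); first by rewrite ltrDl.
pose N := maxn n1 (maxn n2 n3).
have {}b1 := bnd_mtail_le (leq_maxl n1 (maxn n2 n3)) (fun i j => bnd_ge0 i j bU) b1.
have {}b2 := bnd_mtail_le (leq_trans (leq_maxl n2 n3) (leq_maxr n1 _)) (fun i j => bnd_ge0 i j bV) b2.
have {}b3 := bnd_mtail_le (leq_trans (leq_maxr n2 n3) (leq_maxr n1 _)) (fun i j => bnd_ge0 i j bP) b3.
rewrite -/N in b1 b2 b3.
pose cc := (lam - s) * (gam (pmat c A K.+1) + dl) + (gam (pmat d A K.+1) + dl) +
   c K * (gam (mpow A K.+1) + dl).
have cc0 : 0 <= cc.
  have m1 := mulr_ge0 h0 (bnd_M0 b1); have m3 := mulr_ge0 (c0 K) (bnd_M0 b3).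
  exact: (addr_ge0 (addr_ge0 m1 (bnd_M0 b2)) m3).
(* Images under U of the nonnegative vectors of the unit ball. Since (s - A) U = V - c_K A^(K+1) -
   (lam - s) U, the tails of (s - A) u are bounded by [cc]. *)
pose D := [set u | exists x : nat -> R, [/\ forall j, 0 <= x j, L (rc x), nrm (rc x) <= 1 &
   u = matapply (pmat c A K.+1) (rc x)]].
have [|N' hN'] := hM D N cc (\sum_(0 <= k < K.+1) c k * M0 ^+ k) cc0 _ dl dl0.
  move=> u [x [x0 Lx nx ->]]; have [LU nU] := matapply_L bU Lx.
  split=> //; split; first by apply: (le_trans nU); rewrite ler_piMr// (bnd_M0 bU).
  have [LV _] := matapply_L bV Lx; have [LP _] := matapply_L bP Lx.
  have -> : ctail N (fun i => s%:C * matapply (pmat c A K.+1) (rc x) i -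
        matapply A (matapply (pmat c A K.+1) (rc x)) i) =
      (fun i => ctail N (matapply (pmat d A K.+1) (rc x)) i -
       ((c K)%:C * ctail N (matapply (mpow A K.+1) (rc x)) i +
       (lam - s)%:C * ctail N (matapply (pmat c A K.+1) (rc x)) i)).
    apply/funext => i; rewrite /ctail; case: ifP => _; last by rewrite !mulr0; ring.
    have := resolvent_pmat K bA x0 Lx e0 eS i => /= /eqP; rewrite subr_eq => /eqP E.
    apply/eqP; rewrite subr_eq; apply/eqP.
    have -> : s%:C = lam%:C - (lam - s)%:C :> C by rewrite rmorphB; ring.
    by rewrite mulrBl E; ring.
  have [L1 _] := L_tail N LU; have [L2 _] := L_tail N LV; have [L3 _] := L_tail N LP.
  have L4 := L_scale (c K)%:C L3; have L5 := L_scale (lam - s)%:C L1.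
  apply: (le_trans (nrm_sub L2 (L_add L4 L5))).
  have h4 := nrm_add L4 L5; rewrite !nrm_scale// !cabs_ge0R// in h4.
  have aux B (f : R) : bnd (mtail N B) f -> nrm (ctail N (matapply B (rc x))) <= f.
    move=> bf; apply: (le_trans (nrm_ctail_matapply bf Lx)).
    by rewrite ler_piMr// (bnd_M0 bf).
  apply: (le_trans (lerD (aux _ _ b2) h4)).
  have a1 := ler_wpM2l h0 (aux _ _ b1); have a3 := ler_wpM2l (c0 K) (aux _ _ b3).
  by apply: (le_trans (lerD (lexx _) (lerD a3 a1))); rewrite /cc addrA addrC addrA.
have bf : bnd (mtail N' (pmat c A K.+1)) (M * cc + dl).
  apply: (bnd_of_ball bU); first exact: addr_ge0 (mulr_ge0 (ltW M_gt0) cc0) (ltW dl0).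
  by move=> v v0 Lv nv; apply: hN'; exists v.
apply: (le_trans (gam_le bf)).
have -> : M * cc + dl = M * ((lam - s) * gam (pmat c A K.+1) + gam (pmat d A K.+1) +
   c K * gam (mpow A K.+1)) + dl * Q by rewrite /cc /Q; ring.
by rewrite lerD2l /dl divfK// gt_eqF.
Qed.

Lemma rh_le_gam_pow A M k : bnd A M -> (0 < k)%N -> rh X [set A] ^+ k <= gam (mpow A k).
Proof.
move=> bA k0; have bS := bset1 bA; have bk := bnd_mpow k bA.
have g0 := gam_ge0 bk; have r0 := rh_ge0 bS.
rewrite -[leRHS](powR_inv_exprn g0 k0); apply: lerXn2r; rewrite ?nnegrE ?powR_ge0//.
apply: (rh_le_one bS k0); first exact: powR_ge0.
by move=> B; rewrite wd_set1 => ->; rewrite powR_inv_exprn.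
Qed.

(* The radius rh A is itself in the essential spectrum. Otherwise the truncated resolvents
   sum (k+1) lam^(-k-2) A^k, lam > rh A, would have uniformly bounded measure of
   noncompactness, whereas gam (A^k) >= (rh A)^k makes them blow up as lam decreases to rh A. *)
Lemma not_fredholm_rh A M0 : bnd A M0 -> 0 < rh X [set A] ->
  ~ fredholm L (fun x i => (rh X [set A])%:C * x i - matapply A x i).
Proof.
move=> bA; set s := rh X [set A] => s0 fr.
have bS := bset1 bA.
have [M hM] := fredholm_tail bA fr; have [M_gt0 _] := hM.
have key := gam_resolvent bA hM.
(* Bound for the square of the resolvent: [4 * M] comes from the resolvent, one 1 from the
   truncation error, the other is slack. *)
pose B := 2 * M * (4 * M + 1 + 1).
have B0 : 0 < B by rewrite /B; nra.
(* For [lam - s] at most [(2 * M)^-1], the term with [lam - s] in [gam_resolvent] is at most half of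
   the left side and is absorbed; [M] does not depend on [lam]. *)
have main k (lam : R) : s < lam -> lam <= s + (2 * M)^-1 ->
    k.+1%:R * gam (mpow A k) <= B * lam ^+ k.+2.
  move=> sl lM; have l0 : 0 < lam by exact: lt_trans sl.
  have lN : lam != 0 by rewrite gt_eqF.
  pose e := (s + lam) / 2; have [se el] : s < e /\ e < lam by rewrite /e; split; lra.
  have [e0 [D [D0 hD]]] := rh_lt bS se.
  have q01 : 0 < e / lam < 1 by rewrite divr_gt0//= ltr_pdivrMr// mul1r.
  (* The bound 1 controls the truncation error of the resolvent, the bound [lam] that of its square,
     whose last coefficient carries one more inverse power of [lam]. *)
  have m0 : 0 < Num.min 1 lam by rewrite lt_min ltr01.
  have [K [kK hK]] := nat_expr_small k q01 D0 m0.
  have gK : K.+1%:R * gam (mpow A K.+1) <= Num.min 1 lam * lam ^+ K.+1.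
    have g := hD K.+1 (mpow A K.+1); rewrite wd_set1 in g.
    apply: (@le_trans _ _ (K.+1%:R * (D * e ^+ K.+1))); first by rewrite ler_wpM2l// g.
    have -> : K.+1%:R * (D * e ^+ K.+1) = K.+1%:R * D * (e / lam) ^+ K.+1 * lam ^+ K.+1.
      by rewrite -[RHS]mulrA -exprMn divfK// mulrA.
    by rewrite ler_wpM2r// exprn_ge0// ltW.
  have gK0 := gam_ge0 (bnd_mpow K.+1 bA).
  (* [c1], [d1] and [c2] are the coefficients, in powers of [A], of the resolvent, the identity and
     the square of the resolvent. *)
  pose c1 j : R := lam ^- j.+1; pose d1 j : R := (j == 0%N)%:R.
  pose c2 j : R := j.+1%:R * lam ^- j.+2.
  have c1p j : 0 < c1 j by rewrite invr_gt0 exprn_gt0.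
  have c2p j : 0 < c2 j by rewrite mulr_gt0// invr_gt0 exprn_gt0.
  have d10 j : 0 <= d1 j by rewrite ler0n.
  have half U V W : 0 <= U -> U <= M * ((lam - s) * U + V + W) -> U <= 2 * M * (V + W).
    move=> U0 h; have : M * (lam - s) <= 2^-1.
      have -> : 2^-1 = M * (2 * M)^-1 :> R by field; rewrite gt_eqF.
      by rewrite ler_pM2l// lerBlDr addrC.
    move: h; rewrite -[(lam - s) * U + V + W]addrA mulrDr mulrA; nra.
  have h1 := key c1 d1 lam K (ltW sl) (fun j => ltW (c1p j)) d10.
  have h2 := key c2 c1 lam K (ltW sl) (fun j => ltW (c2p j)) (fun j => ltW (c1p j)).
  have bU1 := bnd_pmat K.+1 (fun j => ltW (c1p j)) bA.
  have bU2 := bnd_pmat K.+1 (fun j => ltW (c2p j)) bA.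
  have {}h1 : gam (pmat c1 A K.+1) <= 2 * M * (1 + 1).
    apply: le_trans (half _ _ _ (gam_ge0 bU1) (h1 _ _)) _.
    - by rewrite /c1 /d1 expr1 mulfV.
    - by move=> j; rewrite /c1 /d1 /= exprS; field; rewrite expf_neq0.
    rewrite ler_wpM2l ?mulr_ge0 ?(ltW M_gt0)//; apply: lerD.
      have -> : pmat d1 A K.+1 = idm X.
        apply/funext => i; apply/funext => j; rewrite /pmat big_nat_recl //= /d1 mul1r.
        by rewrite big1 ?addr0// => l _; rewrite mul0r.
      exact: gam_le_bnd (bnd_idm X).
    rewrite /c1 mulrC ler_pdivrMr ?exprn_gt0// mul1r.
    apply: (@le_trans _ _ (K.+1%:R * gam (mpow A K.+1))).
      by rewrite ler_peMl// ler1n.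
    apply: (le_trans gK); rewrite ler_piMl ?exprn_ge0 ?(ltW l0)//.
    by rewrite ge_min lexx.
  have {}h2 : gam (pmat c2 A K.+1) <= B.
    apply: le_trans (half _ _ _ (gam_ge0 bU2) (h2 _ _)) _.
    - by rewrite /c1 /c2 mul1r exprS; field.
    - by move=> j; rewrite /c1 /c2 -[j.+2%:R]natr1 !exprS; field; rewrite expf_neq0.
    rewrite /B ler_wpM2l ?mulr_ge0 ?(ltW M_gt0)//; apply: lerD.
      by apply: (le_trans h1); lra.
    rewrite /c2 mulrAC ler_pdivrMr ?exprn_gt0// mul1r; apply: (le_trans gK).
    rewrite [leRHS]exprS ler_wpM2r ?exprn_ge0 ?(ltW l0)//.
    by rewrite ge_min lexx orbT.
  have := le_trans (gam_pmat_ge (fun j => ltW (c2p j)) (c2p k) bA (leq_ltn_trans kK (ltnSn K))) h2.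
  by rewrite /c2 mulrAC ler_pdivrMr ?exprn_gt0.
(* Here [lam] decreases to [s]; the limit is [le_prod_addgt0] with [k.+2] equal factors. *)
have lower k : (0 < k)%N -> k.+1%:R * s ^+ k <= B * s ^+ k.+2.
  move=> k0; pose a (j : 'I_k.+2) := s.
  have sk : 0 <= s ^+ k by rewrite exprn_ge0// ltW.
  suff : k.+1%:R * s ^+ k / B <= s ^+ k.+2 by move=> h; rewrite [leRHS]mulrC -ler_pdivrMr.
  have := @le_prod_addgt0 R k.+2 a (k.+1%:R * s ^+ k / B).
  rewrite /a prodr_const cardT size_enum_ord; apply => d d0.
  rewrite prodr_const cardT size_enum_ord ler_pdivrMr// [leRHS]mulrC.
  pose dd := Num.min d (2 * M)^-1.
  have dd0 : 0 < dd by rewrite lt_min d0 invr_gt0 mulr_gt0.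
  apply: (@le_trans _ _ (B * (s + dd) ^+ k.+2)).
    apply: le_trans (main k (s + dd) _ _); rewrite ?ltrDl ?lerD2l ?ge_min ?lexx ?orbT//.
    by rewrite ler_wpM2l// (rh_le_gam_pow bA k0).
  rewrite ler_wpM2l ?(ltW B0)//; apply: lerXn2r; rewrite ?nnegrE ?addr_ge0 ?(ltW s0) ?(ltW dd0) ?(ltW d0)//.
  by rewrite lerD2l ge_min lexx.
have [k k0 hk] : exists2 k, (0 < k)%N & B * s ^+ 2 < k.+1%:R.
  exists (Num.truncn (B * s ^+ 2)).+1 => //.
  by apply: (lt_trans (truncnS_gt _)); rewrite ltr_nat.
have sk : 0 < s ^+ k by rewrite exprn_gt0.
have := lower k k0; rewrite -addn2 exprD [s ^+ k * _]mulrC mulrA ler_pM2r//.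
by rewrite leNgt hk.
Qed.

Lemma rho_ess_rh A M : bnd A M -> rho_ess L A = rh X [set A].
Proof.
move=> bA; rewrite /rho_ess; have r0 := rh_ge0 (bset1 bA).
set E := [set cabs lam | lam in _].
have ub : ubound E (rh X [set A]).
  move=> _ [lam nf <-]; rewrite leNgt; apply/negP => h; apply: nf.
  exact: fredholm_of_gt bA h.
have hub : has_ubound E by exists (rh X [set A]).
(* If [rh] is 0, no spectral point has to be exhibited: the supremum is 0 by default on the empty
   set, and otherwise lies between 0 and the upper bound 0. *)
move: r0; rewrite le_eqVlt => /predU1P[r0|rp].
  have [E0|/set0P[e Ee]] := eqVneq E set0; first by rewrite E0 sup0.
  apply/eqP; rewrite eq_le; apply/andP; split; first by apply: ge_sup => //; exists e.
  rewrite -r0; apply: le_trans (ub_le_sup hub Ee).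
  by case: Ee => lam _ <-; exact: cabs_ge0.
have Ein : E (rh X [set A]).
  by exists (rh X [set A])%:C; [exact: not_fredholm_rh bA rp|rewrite cabs_ge0R ?ltW].
apply/eqP; rewrite eq_le; apply/andP; split; last exact: ub_le_sup.
by apply: ge_sup => //; exists (rh X [set A]).
Qed.

End EssentialRadius.

(** * Roots and exponents *)

Section RootInequalities.
Variable R : realType.
Implicit Types (x y p t : R) (m n : nat).

Lemma powR_le x y t : 0 <= t -> 0 <= x -> x <= y -> powR x t <= powR y t.
Proof. by move=> t0 x0 xy; apply: ge0_ler_powR => //; rewrite nnegrE// (le_trans x0). Qed.

Lemma le_powR_inv x y n : (0 < n)%N -> 0 <= x -> x ^+ n <= y -> x <= powR y (n%:R^-1).
Proof.
move=> n0 x0 h; rewrite -[leLHS](exprn_powR_inv x0 n0); apply: powR_le => //.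
exact: exprn_ge0.
Qed.

Lemma le_exprn_inv x y n : (0 < n)%N -> 0 <= x -> 0 <= y ->
  x <= powR y (n%:R^-1) -> x ^+ n <= y.
Proof.
move=> n0 x0 y0 h; rewrite -[leRHS](powR_inv_exprn y0 n0).
by apply: lerXn2r => //; rewrite nnegrE powR_ge0.
Qed.

Lemma powR_inv_le_powR_inv x y m n : (0 < n)%N -> 0 <= x -> x ^+ n <= y ->
  powR x (m%:R^-1) <= powR y ((m * n)%:R^-1).
Proof.
move=> n0 x0 h; rewrite natrM invfM [_ * n%:R^-1]mulrC powRrM.
by apply: powR_le; rewrite ?invr_ge0//; exact: le_powR_inv.
Qed.

Lemma le_powR_of_powR x y t m n : (0 < m)%N -> (0 < n)%N -> 0 <= x -> 0 <= y ->
  y <= powR (x ^+ n) t ^+ m -> powR y ((m * n)%:R^-1) <= powR x t.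
Proof.
move=> m0 n0 x0 y0 h; have mN : m%:R != 0 :> R by rewrite pnatr_eq0 -lt0n.
have nN : n%:R != 0 :> R by rewrite pnatr_eq0 -lt0n.
have -> : powR x t = powR (powR (x ^+ n) t ^+ m) ((m * n)%:R^-1).
  rewrite -!powR_mulrn ?powR_ge0// -!powRrM; congr powR.
  by rewrite natrM; field; rewrite mN nN.
by apply: powR_le; rewrite ?invr_ge0.
Qed.

Lemma le_powR_of_powR1 x y t m n : (0 < m)%N -> (0 < n)%N -> 0 <= x -> 0 <= y ->
  y <= powR (x ^+ n) t -> powR y ((n * m)%:R^-1) <= powR x (t / m%:R).
Proof.
move=> m0 n0 x0 y0 h; have mN : m%:R != 0 :> R by rewrite pnatr_eq0 -lt0n.
have nN : n%:R != 0 :> R by rewrite pnatr_eq0 -lt0n.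
have -> : powR x (t / m%:R) = powR (powR (x ^+ n) t) ((n * m)%:R^-1).
  rewrite -!powR_mulrn// -!powRrM; congr powR.
  by rewrite natrM; field; rewrite mN nN.
by apply: powR_le; rewrite ?invr_ge0.
Qed.

Lemma powR_prod_split (z : nat -> R) y t m n : (0 < m)%N -> (0 < n)%N -> 0 <= y ->
  (forall j, 0 <= z j) -> y <= \prod_(j < m) powR (z j) (t / m%:R) ->
  powR y ((m * n)%:R^-1) <= powR (\prod_(j < m) z j) (t / (m ^ 2 * n)%:R).
Proof.
move=> m0 n0 y0 z0 h; have mN : m%:R != 0 :> R by rewrite pnatr_eq0 -lt0n.
have nN : n%:R != 0 :> R by rewrite pnatr_eq0 -lt0n.
have -> : t / (m ^ 2 * n)%:R = (t / m%:R) * (m * n)%:R^-1.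
  by rewrite !natrM; field; rewrite mN nN.
by rewrite powRrM -prod_powR//; apply: powR_le; rewrite ?invr_ge0.
Qed.

Lemma powR_prod_le (z : nat -> R) x t m n : (0 < m)%N -> (0 < n)%N -> 0 <= t -> 0 <= x ->
  (forall j, 0 <= z j) -> (forall j, (j < m)%N -> z j <= powR (x ^+ n) m%:R) ->
  powR (\prod_(j < m) z j) (t / (m ^ 2 * n)%:R) <= powR x t.
Proof.
move=> m0 n0 t0 x0 z0 h; have mN : m%:R != 0 :> R by rewrite pnatr_eq0 -lt0n.
have nN : n%:R != 0 :> R by rewrite pnatr_eq0 -lt0n.
have -> : powR x t = powR (powR (x ^+ n) m%:R ^+ m) (t / (m ^ 2 * n)%:R).
  rewrite -!powR_mulrn ?powR_ge0// -!powRrM; congr powR.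
  by rewrite !natrM; field; rewrite mN nN.
apply: powR_le; [by rewrite divr_ge0|by apply: prodr_ge0|].
rewrite -[X in _ ^+ X]card_ord -prodr_const; apply: ler_prod => j _.
by rewrite z0 h.
Qed.

End RootInequalities.

(** * Properties common to both joint radii *)

Section JointRadii.
Variables (R : realType) (X : lspace R).
Local Notation L := (carrier X).
Local Notation nrm := (lnorm X).
Local Notation bnd := (bnd X).
Local Notation bset := (bset X).
Local Notation wd := (wd X).
Local Notation rh := (rh X).
Local Notation dom := (@dom R).
Implicit Types (A B : mat R) (S T : set (mat R)) (F : nat -> set (mat R)).

Lemma rh_set1_le_bnd A M : 0 < M -> bnd A M -> rh [set A] <= M.
Proof. by move=> M0 bA; apply: rh_le; apply: rate_bnd => // B ->. Qed.

Lemma rho_ess_set_sup S k : bset S -> (0 < k)%N ->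
  [set rho_ess L A | A in setpown S k] = [set rh [set A] | A in wd S k].
Proof.
move=> [M [M0 hM]] k0; rewrite (@setpown_wd _ X)//; last by exists M.
by apply/seteqP; split=> _ [A wA <-]; exists A => //; rewrite (rho_ess_rh (wd_bnd hM wA)).
Qed.

Lemma rho_ess_set_ge0 S : 0 <= rho_ess_set L S.
Proof.
rewrite /rho_ess_set; set E := [set _ | _ in _].
have [hE|hE] := pselect (has_sup E); last by rewrite sup_out.
case: hE => -[e Ee] hub; apply: le_trans (ub_le_sup hub Ee).
by case: Ee => k _ <-; exact: powR_ge0.
Qed.

(** With [rho_ess_set_le] this makes the radius the least [c >= 0] such that [rh [set A] <= c ^+ k]
    for all products [A] of [k > 0] factors. The norm bound [M] keeps the suprema finite; an
    unbounded one would be 0 by default. *)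
Lemma rho_ess_set_ge S k A : bset S -> (0 < k)%N -> wd S k A ->
  rh [set A] <= rho_ess_set L S ^+ k.
Proof.
move=> bS k0 wA; have [M [M0 hM]] := bS.
have hub l : has_ubound [set rh [set A] | A in wd S l].
  exists (M ^+ l) => _ [B wB <-]; apply: rh_set1_le_bnd; first by rewrite exprn_gt0.
  exact: wd_bnd hM wB.
have s0 l B : wd S l B -> 0 <= rh [set B].
  by move=> wB; exact: rh_ge0 (bset1 (wd_bnd hM wB)).
have sA : rh [set A] <= sup [set rh [set A] | A in wd S k] by apply: ub_le_sup => //; exists A.
have sk0 := le_trans (s0 k A wA) sA.
apply: (le_trans sA); rewrite -[leLHS](powR_inv_exprn sk0 k0).
apply: lerXn2r; rewrite ?nnegrE ?powR_ge0 ?rho_ess_set_ge0//.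
apply: ub_le_sup; last by exists k => //; rewrite (rho_ess_set_sup bS k0).
exists M => _ [l l0 <-]; rewrite rho_ess_set_sup//.
have [w0|/set0P[B wB]] := eqVneq (wd S l) set0.
  rewrite w0 image_set0 sup0 powR0 ?(ltW M0)// invr_eq0 pnatr_eq0 -lt0n//.
rewrite -[leRHS](exprn_powR_inv (ltW M0) l0); apply: ge0_ler_powR.
- by rewrite invr_ge0.
- rewrite nnegrE; apply: (le_trans (s0 l B wB)); apply: ub_le_sup => //; by exists B.
- by rewrite nnegrE exprn_ge0// ltW.
apply: ge_sup; first by exists (rh [set B]), B.
move=> _ [D wD <-]; apply: rh_set1_le_bnd; first by rewrite exprn_gt0.
exact: wd_bnd hM wD.
Qed.

Lemma rho_ess_set_le S c : bset S -> 0 <= c ->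
  (forall k A, (0 < k)%N -> wd S k A -> rh [set A] <= c ^+ k) -> rho_ess_set L S <= c.
Proof.
move=> bS c0 h; apply: ge_sup.
  by exists (powR (sup [set rho_ess L A | A in setpown S 1]) (1%:R^-1)), 1%N.
move=> _ [k k0 <-]; rewrite rho_ess_set_sup//.
have [w0|/set0P[B wB]] := eqVneq (wd S k) set0.
  by rewrite w0 image_set0 sup0 powR0// invr_eq0 pnatr_eq0 -lt0n.
have [M [M0 hM]] := bS.
rewrite -[leRHS](exprn_powR_inv c0 k0); apply: ge0_ler_powR.
- by rewrite invr_ge0.
- rewrite nnegrE; apply: (@le_trans _ _ (rh [set B])).
    exact: rh_ge0 (bset1 (wd_bnd hM wB)).
  by apply: ub_le_sup; [exists (c ^+ k) => _ [D wD <-]; exact: h|exists B].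
- by rewrite nnegrE exprn_ge0.
by apply: ge_sup; [exists (rh [set B]), B|move=> _ [D wD <-]; exact: h].
Qed.

Variable b : bool.
Local Notation r := (jr b L nrm).

Lemma jr_ge0 S : bset S -> 0 <= r S.
Proof.
by move=> bS; rewrite /jr; case: b; [exact: rho_ess_set_ge0|rewrite rho_hat_rh// rh_ge0].
Qed.

Lemma jr_dom S T : bset T -> dom S T -> r S <= r T.
Proof.
move=> bT ST; have bS := dom_bset ST bT; rewrite /jr; case: b; last first.
  by rewrite !rho_hat_rh//; exact: rh_dom.
apply: rho_ess_set_le => //; first exact: rho_ess_set_ge0.
move=> k A k0 wA; have [B [wB AB]] := dom_wprod (fun k _ => bT) (fun k _ => ST) wA.
apply: le_trans (rho_ess_set_ge bT k0 wB).
have [M [M0 hM]] := bset_wd k bT.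
by apply: rh_dom; [exact: bset1 (hM B wB)|move=> _ ->; exists B].
Qed.

Lemma wd_sub S T k : S `<=` T -> wd S k `<=` wd T k.
Proof.
move=> ST; elim: k => [//|k IH] A [B [D [/IH wB [/ST TD ->]]]].
by exists B, D.
Qed.

(** For [rho_ess] the lower bound goes through single operators: if [A] is in [S^k], then [A^n] is
    in [(S^n)^k], and [rh] of the singleton of [A^n] is the [n]-th power of that of [A]. *)
Lemma jr_setpown S n : bset S -> (0 < n)%N -> r (setpown S n) = r S ^+ n.
Proof.
move=> bS n0; rewrite (setpown_wd bS n0); have bW := bset_wd n bS.
rewrite /jr; case: b; last by rewrite !rho_hat_rh// rh_wd.
have r0 := rho_ess_set_ge0 S; have r1 := rho_ess_set_ge0 (wd S n).
apply/eqP; rewrite eq_le; apply/andP; split.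
  apply: (rho_ess_set_le bW (exprn_ge0 _ r0)) => k A k0; rewrite (wdM _ _ bS) => wA.
  by rewrite -exprM; apply: (rho_ess_set_ge bS _ wA); rewrite muln_gt0 n0.
apply: (le_exprn_inv n0 r0 r1); apply: (rho_ess_set_le bS (powR_ge0 _ _)) => k A k0 wA.
have [M [M0 hM]] := bset_wd k bS; have bA := hM A wA; have b1 := bset1 bA.
have := rh_wd b1 n0; rewrite wd_set1 => E.
have rA : rh [set A] \is Num.nneg by rewrite nnegrE; exact: rh_ge0 b1.
have rd : powR (rho_ess_set L (wd S n)) n%:R^-1 ^+ k \is Num.nneg.
  by rewrite nnegrE; apply: exprn_ge0; exact: powR_ge0.
rewrite -(ler_pXn2r n0 rA rd) -E exprAC (powR_inv_exprn r1 n0).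
apply: (rho_ess_set_ge bW k0); rewrite (wdM _ _ bS) mulnC -(wdM _ _ bS).
have Ain : [set A] `<=` wd S k by move=> _ ->.
by apply: (wd_sub Ain); rewrite wd_set1.
Qed.

(** For [rho_ess] a product is dominated by a mean of single matrices [B j], and [rh_hprod] is
    applied to their singletons. *)
Lemma jr_hprod F m t : (0 < m)%N -> m%:R^-1 <= t -> (forall j, (j < m)%N -> bset (F j)) ->
  r (hprod_pow F m t) <= \prod_(j < m) powR (r (F j)) t.
Proof.
move=> m0 mt bF; have t0 : 0 < t by rewrite (lt_le_trans _ mt)// invr_gt0 ltr0n.
have bH := bset_hprod_pow m0 mt bF.
rewrite /jr; case: b; last first.
  rewrite rho_hat_rh//; apply: (le_trans (rh_hprod m0 mt bF)).
  rewrite le_eqVlt; apply/orP; left; apply/eqP; apply: eq_bigr => j _.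
  by rewrite (rho_hat_rh (bF j (ltn_ord j))).
apply: rho_ess_set_le => //; first by apply: prodr_ge0 => j _; exact: powR_ge0.
move=> k A k0; rewrite -setpown_wd// => /(dom_setpown_hprod m0 mt bF)[_ [/hprod_powP -/(_ m0)[B [FB ->]] AB]].
have bB j : (j < m)%N -> bset [set B j].
  by move=> jm; apply: bset_sub (bset_setpown k (bF j jm)) => _ ->; exact: FB.
have bHB := bset_hprod_pow m0 mt bB.
apply: (@le_trans _ _ (rh (hprod_pow (fun j => [set B j]) m t))).
  apply: rh_dom => // _ ->; exists (hp m t B); split=> //.
  by apply/hprod_powP => //; exists B.
apply: (le_trans (rh_hprod m0 mt bB)); rewrite -prodrXl.
apply: ler_prod => j _; rewrite powR_ge0 /=.
rewrite -powR_mulrn ?powR_ge0// powRAC powR_mulrn ?rho_ess_set_ge0//.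
apply: ge0_ler_powR; first exact: ltW.
- by rewrite nnegrE; exact: rh_ge0 (bB j (ltn_ord j)).
- by rewrite nnegrE exprn_ge0// rho_ess_set_ge0.
apply: rho_ess_set_ge => //; first exact: bF.
by rewrite -setpown_wd//; [exact: FB|exact: bF].
Qed.

(** For [rho_ess], an element of [(S T)^(k+1)] is [D W] with [D] in [S] and [W] in [(T S)^k T]; its
    radius is at most that of [W D], which belongs to [(T S)^(k+1)]. *)
Lemma jr_swap S T : bset S -> bset T -> r (setmul S T) <= r (setmul T S).
Proof.
move=> bS bT; have bST := bset_setmul bS bT; have bTS := bset_setmul bT bS.
rewrite /jr; case: b; last by rewrite !rho_hat_rh//; exact: rh_swap.
apply: rho_ess_set_le => //; first exact: rho_ess_set_ge0.
case=> // k A _; have b1 := bset_wd k bST; have b2 := bset_wd k bTS.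
rewrite wdS -(setmulA b1 bS bT) wd_swap// (setmulA bS b2 bT).
move=> [D [W [SD [wW ->]]]].
have [M [M0 hM]] := bS; have [N [N0 hN]] := bset_setmul b2 bT.
have bD := hM D SD; have bW := hN W wW.
have E (U V : mat R) : setmul [set U] [set V] = [set matmul U V].
  by apply/seteqP; split=> [_ [_ [_ [-> [-> ->]]]]//|_ ->]; exists U, V.
apply: (@le_trans _ _ (rh [set matmul W D])).
  by rewrite -!E; apply: rh_swap; [exact: bset1 bD|exact: bset1 bW].
apply: rho_ess_set_ge => //; rewrite wdS -(setmulA b2 bT bS).
by exists W, D.
Qed.

(** A Hadamard power is a Hadamard mean with one factor, for which the condition on the exponent
    reads [1 <= t]. *)
Lemma bset_setpow S t : 1 <= t -> bset S -> bset (setpow S t).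
Proof.
by move=> t1 bS; apply: (@bset_hprod_pow _ X (fun=> S) 1 t) => //; rewrite invr1.
Qed.

Lemma jr_setpow S t : 1 <= t -> bset S -> r (setpow S t) <= powR (r S) t.
Proof.
move=> t1 bS; have := @jr_hprod (fun=> S) 1 t isT _ (fun _ _ => bS).
by rewrite big_ord1 invr1; exact.
Qed.

Lemma hprod_pow_pow F m s t : (0 < m)%N ->
  hprod_pow (fun j => setpow (F j) s) m t = hprod_pow F m (s * t).
Proof.
move=> m0; apply/seteqP; split=> D /hprod_powP -/(_ m0)[B [FB ->]]; apply/hprod_powP => //.
  have /choice[E hE] : forall j, exists E, (j < m)%N -> F j E /\ B j = hpow E s.
    move=> j; case: (ltnP j m) => [/FB[E hE]|_]; [by exists E|by exists (B j)].
  exists E; split=> [j /hE[]//|]; apply/funext => i; apply/funext => k.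
  by apply: eq_bigr => j _; have [_ ->] := hE j (ltn_ord j); rewrite /hpow powRrM.
exists (fun j => hpow (B j) s); split=> [j jm|].
  by exists (B j); split=> //; exact: FB.
by apply/funext => i; apply/funext => k; apply: eq_bigr => j _; rewrite /hpow powRrM.
Qed.

(** By commutativity of the Hadamard product the same matrix belongs to both sets. *)
Lemma dom_hprod_rot F m t k : (0 < m)%N -> m%:R^-1 <= t ->
  (forall j, (j < m)%N -> bset (F j)) ->
  dom (hprod_pow F m t) (hprod_pow (fun j => F ((j + k) %% m)%N) m t).
Proof.
move=> m0 mt bF D /[dup] hD /hprod_powP -/(_ m0)[B [FB E]].
exists D; split; last first.
  have [M [_ hM]] := bset_hprod_pow m0 mt bF.
  by move=> i j; rewrite lexx andbT (bnd_ge0 _ _ (hM D hD)).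
apply/hprod_powP => //; exists (fun j => B ((j + k) %% m)%N); split.
  by move=> j _; apply: FB; rewrite ltn_pmod.
rewrite E; apply/funext => i; apply/funext => l; rewrite /hp.
pose h (j : 'I_m) : 'I_m := Ordinal (ltn_pmod (j + k) m0).
rewrite (@reindex_inj _ _ _ _ h)//= => a c /(congr1 val) /= /eqP.
by rewrite eqn_modDr !modn_small// => /eqP /val_inj.
Qed.

Lemma cyc_prod0 F m : (0 < m)%N -> cyc_prod F m 0 = setprodn F m.-1.
Proof.
move=> m0; apply: setprodn_ext => k km; rewrite add0n modn_small//.
by rewrite -(prednK m0) ltnS.
Qed.

Lemma bset_cyc F m j : (0 < m)%N -> (forall k, (k < m)%N -> bset (F k)) -> bset (cyc_prod F m j).
Proof. by move=> m0 bF; apply: bset_setprodn => k _; apply: bF; rewrite ltn_pmod. Qed.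

(** Each step moves the first factor to the end by [jr_swap]; a step exists only for at least two
    factors, hence [p.+2]. *)
Lemma jr_cyc F m j : (0 < m)%N -> (forall k, (k < m)%N -> bset (F k)) -> (j < m)%N ->
  r (cyc_prod F m j) <= r (setprodn F m.-1).
Proof.
move=> m0 bF; elim: j => [_|j IH jm]; first by rewrite cyc_prod0.
have jm' : (j < m)%N by exact: ltnW.
apply: le_trans (IH jm').
have [p mE] : exists p, m = p.+2 by case: m jm {m0 bF jm' IH} => [|[|p]]// _; exists p.
have bG k : bset (F (k %% m)%N) by apply: bF; rewrite ltn_pmod.
pose G k := F ((j.+1 + k) %% m)%N.
have E1 : cyc_prod F m j.+1 = setmul (setprodn G p) (F j).
  rewrite /cyc_prod {2}mE /=; congr setmul; congr F.
  by rewrite addSnnS -mE modnDr modn_small.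
have E2 : cyc_prod F m j = setmul (F j) (setprodn G p).
  rewrite /cyc_prod {2}mE /= -/(setprodn (fun k => F ((j + k) %% m)%N) p.+1).
  rewrite (@setprodn_recl _ X); last by move=> k _; exact: bG.
  rewrite addn0 modn_small//; congr setmul.
  by apply: setprodn_ext => k _; rewrite /G addSnnS.
rewrite E1 E2; apply: jr_swap; last exact: bF.
by apply: bset_setprodn => k _; exact: bG.
Qed.

(** * Inequalities for the cyclic products *)

Section Chains.
Variables (Psi : nat -> set (mat R)) (m n : nat) (alpha : R).
Hypotheses (m0 : (0 < m)%N) (n0 : (0 < n)%N) (mal : m%:R^-1 <= alpha).
Hypothesis bPsi : forall k, (k < m)%N -> bset (Psi k).

Let a0 : 0 < alpha. Proof. by rewrite (lt_le_trans _ mal)// invr_gt0 ltr0n. Qed.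
Let mN : m%:R != 0 :> R. Proof. by rewrite pnatr_eq0 -lt0n. Qed.
Let nN : n%:R != 0 :> R. Proof. by rewrite pnatr_eq0 -lt0n. Qed.
Let bPhi j : bset (cyc_prod Psi m j). Proof. exact: bset_cyc. Qed.
Let bP : bset (setprodn Psi m.-1). Proof. by rewrite -cyc_prod0. Qed.
Let bPhin j : bset (setpown (cyc_prod Psi m j) n). Proof. exact: bset_setpown. Qed.
Let bHn : bset (hprod_pow (fun j => setpown (cyc_prod Psi m j) n) m alpha).
Proof. by apply: bset_hprod_pow => // j _. Qed.

Lemma jr_Phin_le j : (j < m)%N ->
  r (setpown (cyc_prod Psi m j) n) <= r (setprodn Psi m.-1) ^+ n.
Proof.
move=> jm; rewrite (jr_setpown (bPhi j) n0); apply: lerXn2r.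
- by rewrite nnegrE; exact: jr_ge0 (bPhi j).
- by rewrite nnegrE; exact: jr_ge0 bP.
- exact: jr_cyc m0 bPsi jm.
Qed.

(** In the [k]-th factor of the [m]-th power the slots are rotated by [k]. Slot [j] then runs
    through the sets in cyclic order from [Psi j] on, and Hoelder's inequality collects them into
    [cyc_prod Psi m j]. *)
Lemma jr_hadamard_le_cyc : r (hprod_pow Psi m alpha) <=
  powR (r (hprod_pow (cyc_prod Psi m) m alpha)) (m%:R^-1).
Proof.
have bH := bset_hprod_pow m0 mal bPsi.
have bH' := bset_hprod_pow m0 mal (fun j _ => bPhi j).
apply: (le_powR_inv m0 (jr_ge0 bH)); rewrite -(jr_setpown bH m0).
apply: (jr_dom bH').
have bF k j : bset (Psi ((j + k) %% m)%N) by apply: bPsi; rewrite ltn_pmod.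
have bHF k : bset (hprod_pow (fun j => Psi ((j + k) %% m)%N) m alpha).
  exact: bset_hprod_pow m0 mal (fun j _ => bF k j).
apply: (dom_trans (T := setprodn (fun k => hprod_pow (fun j => Psi ((j + k) %% m)%N) m alpha) m.-1)).
  rewrite (setpown_wd bH m0) (setprodn_wprod _ (bHF 0%N)) (prednK m0).
  apply: (dom_wprod (fun k _ => bHF k)) => k _; exact: dom_hprod_rot.
exact: (dom_setprodn_hprod (F := fun k j => Psi ((j + k) %% m)%N) m0 mal (fun k j _ _ => bF k j)).
Qed.

Lemma jr_hadamard_cyc_le_pow : powR (r (hprod_pow (cyc_prod Psi m) m alpha)) (m%:R^-1) <=
  powR (r (hprod_pow (fun j => setpown (cyc_prod Psi m j) n) m alpha)) ((m * n)%:R^-1).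
Proof.
have bH' := bset_hprod_pow m0 mal (fun j _ => bPhi j).
apply: (powR_inv_le_powR_inv m n0 (jr_ge0 bH')).
rewrite -(jr_setpown bH' n0); apply: (jr_dom bHn).
exact: dom_setpown_hprod m0 mal (fun j _ => bPhi j).
Qed.

(** Each of the [m] slots contributes at most the radius of the full product to the power
    [n * alpha]; the root of order [m * n] leaves [alpha]. *)
Lemma jr_hadamard_pow_le :
  powR (r (hprod_pow (fun j => setpown (cyc_prod Psi m j) n) m alpha)) ((m * n)%:R^-1) <=
  powR (r (setprodn Psi m.-1)) alpha.
Proof.
apply: (le_powR_of_powR m0 n0 (jr_ge0 bP) (jr_ge0 bHn)).
apply: (le_trans (jr_hprod m0 mal (fun j _ => bPhin j))).
rewrite -[X in _ ^+ X]card_ord -prodr_const; apply: ler_prod => j _.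
rewrite powR_ge0 /=; apply: powR_le; [exact: ltW|exact: jr_ge0 (bPhin j)|].
exact: jr_Phin_le (ltn_ord j).
Qed.

(** The mean with exponent [alpha] is the mean with exponent [alpha / m] of the [m]-th Hadamard
    powers; for [1 <= alpha] this exponent is still at least [m^-1]. *)
Lemma jr_hadamard_pow_le_prod : 1 <= alpha ->
  powR (r (hprod_pow (fun j => setpown (cyc_prod Psi m j) n) m alpha)) ((m * n)%:R^-1) <=
  powR (\prod_(j < m) r (setpow (setpown (cyc_prod Psi m j) n) m%:R)) (alpha / (m ^ 2 * n)%:R).
Proof.
move=> a1; have m1 : 1 <= m%:R :> R by rewrite ler1n.
have bS j : bset (setpow (setpown (cyc_prod Psi m j) n) m%:R) := bset_setpow m1 (bPhin j).
apply: (powR_prod_split m0 n0 (jr_ge0 bHn) (fun j => jr_ge0 (bS j))).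
have -> : hprod_pow (fun j => setpown (cyc_prod Psi m j) n) m alpha =
    hprod_pow (fun j => setpow (setpown (cyc_prod Psi m j) n) m%:R) m (alpha / m%:R).
  by rewrite (hprod_pow_pow _ _ _ m0) mulrC divfK.
apply: (jr_hprod m0 _ (fun j _ => bS j)).
by rewrite ler_pdivlMr ?ltr0n// mulVf.
Qed.

Lemma prod_jr_setpow_le : 1 <= alpha ->
  powR (\prod_(j < m) r (setpow (setpown (cyc_prod Psi m j) n) m%:R)) (alpha / (m ^ 2 * n)%:R) <=
  powR (r (setprodn Psi m.-1)) alpha.
Proof.
move=> a1; have m1 : 1 <= m%:R :> R by rewrite ler1n.
have bS j : bset (setpow (setpown (cyc_prod Psi m j) n) m%:R) := bset_setpow m1 (bPhin j).
apply: (powR_prod_le m0 n0 (ltW a0) (jr_ge0 bP) (fun j => jr_ge0 (bS j))) => j jm.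
apply: (le_trans (jr_setpow m1 (bPhin j))).
by apply: powR_le; [|exact: jr_ge0 (bPhin j)|exact: jr_Phin_le jm].
Qed.

End Chains.

(** * Inequalities for Hadamard powers of products *)

Section PowerChains.
Variables (Psi : nat -> set (mat R)) (m n : nat) (beta : R).
Hypotheses (m0 : (0 < m)%N) (n0 : (0 < n)%N) (b1 : 1 <= beta).
Hypothesis bPsi : forall k, (k < m)%N -> bset (Psi k).

Let bP : bset (setprodn Psi m.-1). Proof. by rewrite -cyc_prod0//; exact: bset_cyc. Qed.
Let mN : m%:R != 0 :> R. Proof. by rewrite pnatr_eq0 -lt0n. Qed.
Let nN : n%:R != 0 :> R. Proof. by rewrite pnatr_eq0 -lt0n. Qed.

(** Hoelder's inequality with a single slot: a product of Hadamard powers is dominated by the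
    Hadamard power of the product. *)
Lemma jr_setprod_pow_le : r (cyc_prod_pow Psi m 0 beta) <= r (setpow (setprodn Psi m.-1) beta).
Proof.
apply: (jr_dom (bset_setpow b1 bP)).
have -> : cyc_prod_pow Psi m 0 beta = setprodn (fun k => setpow (Psi k) beta) m.-1.
  exact: (@cyc_prod0 (fun k => setpow (Psi k) beta)).
have b1' : 1%:R^-1 <= beta by rewrite invr1.
apply: (dom_setprodn_hprod (F := fun k _ => Psi k) (ltn0Sn 0) b1') => k _ km _.
by apply: bPsi; rewrite -(prednK m0) ltnS.
Qed.

Lemma jr_setpow_le_setpown : powR (r (setpow (setprodn Psi m.-1) beta)) (m%:R^-1) <=
  powR (r (setpow (setpown (setprodn Psi m.-1) n) beta)) ((n * m)%:R^-1).
Proof.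
have bS := bset_setpow b1 bP; have bPn := bset_setpown n bP.
rewrite mulnC; apply: (powR_inv_le_powR_inv m n0 (jr_ge0 bS)); rewrite -(jr_setpown bS n0).
apply: (jr_dom (bset_setpow b1 bPn)).
have b1' : 1%:R^-1 <= beta by rewrite invr1.
exact: (dom_setpown_hprod (F := fun=> setprodn Psi m.-1) (ltn0Sn 0) b1' (fun _ _ => bP)).
Qed.

Lemma jr_setpow_setpown_le : powR (r (setpow (setpown (setprodn Psi m.-1) n) beta)) ((n * m)%:R^-1) <=
  powR (r (setprodn Psi m.-1)) (beta / m%:R).
Proof.
have bPn := bset_setpown n bP.
apply: (le_powR_of_powR1 m0 n0 (jr_ge0 bP) (jr_ge0 (bset_setpow b1 bPn))).
by rewrite -(jr_setpown bP n0); exact: jr_setpow.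
Qed.

End PowerChains.

End JointRadii.

(** * From bounded sets of operators to the chains of inequalities *)

Lemma bset_operators (R : realType) (X : lspace R) (S : set (mat R)) :
  (forall A, S A -> nonneg_mat (idx X) A /\ defines_op (carrier X) A) ->
  bounded_matset (carrier X) (lnorm X) S -> bset X S.
Proof.
(* [M] may be negative or 0, while [bset] asks for a positive bound. *)
move=> hS [M hM]; exists (`|M| + 1); split; first by rewrite ltr_wpDl.
move=> A SA; have [nA dA] := hS A SA; split=> //; split; first by rewrite addr_ge0.
move=> x x0 Lx; have [cv] := dA _ Lx; rewrite matapply_rc => LA.
exists (vapp A x); split=> //; split.
  have := hM A SA _ Lx; rewrite matapply_rc => h; apply: (le_trans h).
  by rewrite ler_wpM2r ?nrm_ge0// (le_trans (ler_norm M))// lerDl.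
move=> i n; have {}cv : cvgn (series (fun j => A i j * x j)).
  by have := cv i; under eq_fun do rewrite /rc cabs_ge0R//.
apply: (nondecreasing_cvgn_le _ cv n); apply: series_nondecreasing => j.
by rewrite mulr_ge0//; case: (nA i j).
Qed.

Theorem theorem4p6 (R : realType) (Nopt : option nat)
  (L : set (cseq R)) (nrm : cseq R -> R)
  (hL : in_class_L Nopt L nrm)
  (hoc : order_continuous L nrm)
  (hocd : dual_order_continuous L nrm)
  (m : nat) (hm : (0 < m)%N)
  (Psi : nat -> set (mat R))
  (hPsi : forall k, (k < m)%N ->
     (forall A, Psi k A -> nonneg_mat Nopt A /\ defines_op L A) /\
     bounded_matset L nrm (Psi k))
  (alpha : R) (halpha : m%:R^-1 <= alpha)
  (n : nat) (hn : (0 < n)%N)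
  (b : bool) :
  (* P = Psi_1 ... Psi_m ;  Phi_j = cyc_prod Psi m j ;
     Sigma_j = cyc_prod_pow Psi m j (alpha * m) *)
  (jr b L nrm (hprod_pow Psi m alpha)
     <= powR (jr b L nrm (hprod_pow (cyc_prod Psi m) m alpha)) (m%:R^-1)
   /\ powR (jr b L nrm (hprod_pow (cyc_prod Psi m) m alpha)) (m%:R^-1)
     <= powR (jr b L nrm (hprod_pow (fun j => setpown (cyc_prod Psi m j) n) m alpha))
             ((m * n)%:R^-1)
   /\ powR (jr b L nrm (hprod_pow (fun j => setpown (cyc_prod Psi m j) n) m alpha))
             ((m * n)%:R^-1)
     <= powR (jr b L nrm (setprodn Psi m.-1)) alpha)
  /\
  (jr b L nrm (hprod_pow Psi m alpha)
     <= powR (jr b L nrm (cyc_prod_pow Psi m 0 (alpha * m%:R))) (m%:R^-1)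
   /\ powR (jr b L nrm (cyc_prod_pow Psi m 0 (alpha * m%:R))) (m%:R^-1)
     <= powR (jr b L nrm (setpow (setprodn Psi m.-1) (alpha * m%:R))) (m%:R^-1)
   /\ powR (jr b L nrm (setpow (setprodn Psi m.-1) (alpha * m%:R))) (m%:R^-1)
     <= powR (jr b L nrm (setpow (setpown (setprodn Psi m.-1) n) (alpha * m%:R)))
             ((n * m)%:R^-1)
   /\ powR (jr b L nrm (setpow (setpown (setprodn Psi m.-1) n) (alpha * m%:R)))
             ((n * m)%:R^-1)
     <= powR (jr b L nrm (setprodn Psi m.-1)) alpha)
  /\
  (1 <= alpha ->
   (jr b L nrm (hprod_pow Psi m alpha)
      <= powR (jr b L nrm (hprod_pow (cyc_prod Psi m) m alpha)) (m%:R^-1)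
    /\ powR (jr b L nrm (hprod_pow (cyc_prod Psi m) m alpha)) (m%:R^-1)
      <= powR (jr b L nrm (hprod_pow (fun j => setpown (cyc_prod Psi m j) n) m alpha))
              ((m * n)%:R^-1)
    /\ powR (jr b L nrm (hprod_pow (fun j => setpown (cyc_prod Psi m j) n) m alpha))
              ((m * n)%:R^-1)
      <= powR (\prod_(j < m)
                 jr b L nrm (setpow (setpown (cyc_prod Psi m j) n) m%:R))
              (alpha / (m ^ 2 * n)%:R)
    /\ powR (\prod_(j < m)
                 jr b L nrm (setpow (setpown (cyc_prod Psi m j) n) m%:R))
              (alpha / (m ^ 2 * n)%:R)
      <= powR (jr b L nrm (setprodn Psi m.-1)) alpha)
   /\
   (jr b L nrm (hprod_pow Psi m alpha)
      <= powR (jr b L nrm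
                 (hprod_pow (fun j => cyc_prod_pow Psi m j (alpha * m%:R)) m (m%:R^-1)))
              (m%:R^-1)
    /\ powR (jr b L nrm
                 (hprod_pow (fun j => cyc_prod_pow Psi m j (alpha * m%:R)) m (m%:R^-1)))
              (m%:R^-1)
      <= powR (jr b L nrm
                 (hprod_pow (fun j => setpown (cyc_prod_pow Psi m j (alpha * m%:R)) n)
                    m (m%:R^-1)))
              ((m * n)%:R^-1)
    /\ powR (jr b L nrm
                 (hprod_pow (fun j => setpown (cyc_prod_pow Psi m j (alpha * m%:R)) n)
                    m (m%:R^-1)))
              ((m * n)%:R^-1)
      <= powR (jr b L nrm (cyc_prod_pow Psi m 0 (alpha * m%:R))) (m%:R^-1)
    /\ powR (jr b L nrm (cyc_prod_pow Psi m 0 (alpha * m%:R))) (m%:R^-1)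
      <= powR (jr b L nrm (setpow (setprodn Psi m.-1) (alpha * m%:R))) (m%:R^-1)
    /\ powR (jr b L nrm (setpow (setprodn Psi m.-1) (alpha * m%:R))) (m%:R^-1)
      <= powR (jr b L nrm (setpow (setpown (setprodn Psi m.-1) n) (alpha * m%:R)))
              ((n * m)%:R^-1)
    /\ powR (jr b L nrm (setpow (setpown (setprodn Psi m.-1) n) (alpha * m%:R)))
              ((n * m)%:R^-1)
      <= powR (jr b L nrm (setprodn Psi m.-1)) alpha)).
Proof.
pose X := LSpace hL hoc.
have bPsi k : (k < m)%N -> bset X (Psi k).
  by move=> km; have [h1 h2] := hPsi k km; exact: (@bset_operators R X).
have mR : 0 < m%:R :> R by rewrite ltr0n.
pose beta := alpha * m%:R.
have b1 : 1 <= beta by rewrite /beta -ler_pdivrMr// div1r.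
pose Psi' k := setpow (Psi k) beta.
have bPsi' k : (k < m)%N -> bset X (Psi' k) by move=> km; apply: bset_setpow => //; exact: bPsi.
have bm : beta / m%:R = alpha by rewrite /beta mulfK// gt_eqF.
have EH : hprod_pow Psi m alpha = hprod_pow Psi' m (m%:R^-1).
  by rewrite hprod_pow_pow// bm.
have mm : m%:R^-1 <= m%:R^-1 :> R by [].
have bC : bset X (cyc_prod Psi' m 0) by exact: bset_cyc.
have EC : cyc_prod_pow Psi m 0 beta = setprodn Psi' m.-1.
  exact: (@cyc_prod0 R Psi').
have c1a := @jr_hadamard_le_cyc R X b Psi m alpha hm halpha bPsi.
have c1b := @jr_hadamard_cyc_le_pow R X b Psi m n alpha hm hn halpha bPsi.
have c1c := @jr_hadamard_pow_le R X b Psi m n alpha hm hn halpha bPsi.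
have d1a := @jr_hadamard_le_cyc R X b Psi' m (m%:R^-1) hm mm bPsi'.
have d1b := @jr_hadamard_cyc_le_pow R X b Psi' m n (m%:R^-1) hm hn mm bPsi'.
have d1c := @jr_hadamard_pow_le R X b Psi' m n (m%:R^-1) hm hn mm bPsi'.
have c2b : powR (jr b L nrm (cyc_prod_pow Psi m 0 beta)) (m%:R^-1) <=
    powR (jr b L nrm (setpow (setprodn Psi m.-1) beta)) (m%:R^-1).
  apply: powR_le; [by rewrite invr_ge0 ltW|exact: (@jr_ge0 R X b _ bC)|].
  exact: (@jr_setprod_pow_le R X b Psi m beta hm b1 bPsi).
have c2c := @jr_setpow_le_setpown R X b Psi m n beta hm hn b1 bPsi.
have c2d := @jr_setpow_setpown_le R X b Psi m n beta hm hn b1 bPsi.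
rewrite bm in c2d.
(* The start of the second chain is the composite of the three inequalities for [Psi'], valid
   without [1 <= alpha] because [beta] is at least 1 anyway. *)
have d2 : jr b L nrm (hprod_pow Psi m alpha) <=
    powR (jr b L nrm (cyc_prod_pow Psi m 0 beta)) (m%:R^-1).
  by rewrite EH EC; exact: le_trans d1a (le_trans d1b d1c).
rewrite -EH in d1a; rewrite -EC in d1c.
split; first exact: (conj c1a (conj c1b c1c)).
split; first exact: (conj d2 (conj c2b (conj c2c c2d))).
move=> a1; split.
  have c3c := @jr_hadamard_pow_le_prod R X b Psi m n alpha hm hn halpha bPsi a1.
  have c3d := @prod_jr_setpow_le R X b Psi m n alpha hm hn halpha bPsi a1.
  exact: (conj c1a (conj c1b (conj c3c c3d))).
exact: (conj d1a (conj d1b (conj d1c (conj c2b (conj c2c c2d))))).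
Qed.
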